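(* Let $e\ge 2$, $l\ge 1$, $n\ge 1$ be integers, let $s_0,\dots,s_{l-1}\in\{0,\dots,e-1\}$, and put $\mathfrak{s}=(s_0 \bmod e,\dots,s_{l-1}\bmod e)$, $-\mathfrak{s}=(-s_0\bmod e,\dots,-s_{l-1}\bmod e)$ and $\widetilde{\mathfrak{s}}=(-s_{l-1}\bmod e,\dots,-s_0\bmod e)$ in $(\mathbb{Z}/e\mathbb{Z})^l$. For $c=1,\dots,l-1$ let $p_c$ be the minimal nonnegative integer such that $s_{c-1}-s_c+p_ce>n-1$, and let $$-\mathbf{s}:=\Big(-s_0,\,-s_1+p_1e,\,-s_2+p_1e+p_2e,\,\dots,\,-s_{l-1}+\sum_{i=1}^{l-1}p_ie\Big)\in\mathbb{Z}^l,\qquad \widetilde{\mathbf{s}}:=\eta.(-\mathbf{s}),$$ where $\eta:=\alpha_1^{2(p_{l-1}+1)}\alpha_2^{2(p_{l-2}+1)}\cdots\alpha_{l-1}^{2(p_1+1)}w_0$. Let $\boldsymbol{\lambda}=(\lambda^{(0)},\dots,\lambda^{(l-1)})\in\Phi_e^{\mathfrak{s}}(n)$ be a Kleshchev $l$-partition of rank $n$, and put $\boldsymbol{\nu}:=(m_1(\lambda^{(0)}),\dots,m_1(\lambda^{(l-1)}))$. Then $\boldsymbol{\nu}\in\Phi_e^{-\mathfrak{s}}(n)=\Phi_e^{-\mathbf{s}}(n)$, the $l$-partition $\widehat{\boldsymbol{\nu}}:=\Psi_{e,n}^{-\mathbf{s}\rightarrow\widetilde{\mathbf{s}}}(\boldsymbol{\nu})$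 belongs to $\Phi_e^{\widetilde{\mathbf{s}}}(n)=\Phi_e^{\widetilde{\mathfrak{s}}}(n)$, and $$m_l(\boldsymbol{\lambda})=\widehat{\boldsymbol{\nu}}.$$
   Context: An $l$-partition of rank $n$ is an $l$-tuple $\boldsymbol{\lambda}=(\lambda^{(0)},\dots,\lambda^{(l-1)})$ of partitions with $\sum_k|\lambda^{(k)}|=n$, identified with its Young diagram; its nodes are triples $\gamma=(a,b,c)$ with $c\in\{0,\dots,l-1\}$ and $a,b$ the row and column indices of the node in $\lambda^{(c)}$. A node $\gamma\in\boldsymbol{\lambda}$ is removable if $\boldsymbol{\lambda}\setminus\{\gamma\}$ is an $l$-partition; a triple $\gamma\notin\boldsymbol{\lambda}$ is addable if $\boldsymbol{\lambda}\cup\{\gamma\}$ is an $l$-partition. Given $\mathbf{v}=(v_0,\dots,v_{l-1})\in\mathbb{Z}^l$ (a multicharge) with class $\mathfrak{v}\in(\mathbb{Z}/e\mathbb{Z})^l$, the content of $\gamma=(a,b,c)$ is $c(\gamma)=b-a+v_c$, and its residue is $c(\gamma)\bmod e$; $\gamma$ is an $i$-node if its residue is $i\in\mathbb{Z}/e\mathbb{Z}$. Two total orders on the addable and removable $i$-nodes of an $l$-partition are used, for $\gamma_j=(a_j,b_j,c_j)$: - Uglov order: $\gamma_1\prec_{\mathbf{v}}\gamma_2$ iff $c(\gamma_1)<c(\gamma_2)$, or $c(\gamma_1)=c(\gamma_2)$ and $c_1>c_2$; - Kleshchev order: $\gamma_1\prec_{\mathfrak{v}}\gamma_2$ iff $c_1<c_2$,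 or $c_1=c_2$ and $c(\gamma_1)<c(\gamma_2)$ (this depends only on $\mathfrak{v}$). For one of these orders and $i\in\mathbb{Z}/e\mathbb{Z}$, list the addable and removable $i$-nodes of $\boldsymbol{\lambda}$ in increasing order, writing $A$ for each addable and $R$ for each removable one; delete factors $RA$ recursively as long as possible to obtain a word $A^pR^q$. If $p>0$, the node corresponding to the rightmost remaining $A$ is the good $i$-node of $\boldsymbol{\lambda}$. The crystal $B_e^{\mathbf{v}}$ (order $\prec_{\mathbf{v}}$), resp. $B_e^{\mathfrak{v}}$ (order $\prec_{\mathfrak{v}}$), is the graph whose vertices are all $l$-partitions, with an arrow $\boldsymbol{\lambda}\overset{i}{\rightarrow}\boldsymbol{\mu}$ iff $\boldsymbol{\mu}$ is obtained from $\boldsymbol{\lambda}$ by adding its good $i$-node. Let $\Phi_e^{\mathbf{v}}$ (Uglov $l$-partitions), resp. $\Phi_e^{\mathfrak{v}}$ (Kleshchev $l$-partitions), be the vertex set of the connected component of the empty $l$-partition $\boldsymbol{\emptyset}$ in $B_e^{\mathbf{v}}$, resp. $B_e^{\mathfrak{v}}$; ''$(n)$'' denotes the subset of elements of rank $n$. These components are crystals of the irreducible highest weight module of $\mathcal{U}_v'(\widehat{\mathfrak{sl}_e})$ of highest weight $\sum_k\Lambda_{v_k \bmod e}$. For multicharges $\mathbf{v},\mathbf{v}'\in\mathbb{Z}^l$ whose classes mod $e$ agree up to permutation of coordinates, $\Psi_{e,n}^{\mathbf{v}\rightarrow\mathbf{v}'}:\Phi_e^{\mathbf{v}}(n)\to\Phi_e^{\mathbf{v}'}(n)$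 is the bijection given by the unique crystal isomorphism between the components of $\boldsymbol{\emptyset}$: if $\boldsymbol{\emptyset}\overset{i_1}{\rightarrow}\cdots\overset{i_n}{\rightarrow}\boldsymbol{\kappa}$ in $B_e^{\mathbf{v}}$, then $\Psi_{e,n}^{\mathbf{v}\rightarrow\mathbf{v}'}(\boldsymbol{\kappa})$ is the endpoint of the path from $\boldsymbol{\emptyset}$ with the same labels $i_1,\dots,i_n$ in $B_e^{\mathbf{v}'}$. Generalized Mullineux involution. $m_l:\Phi_e^{\mathfrak{s}}\to\Phi_e^{\widetilde{\mathfrak{s}}}$ is the bijection described as follows: if $\boldsymbol{\emptyset}\overset{i_1}{\rightarrow}\cdots\overset{i_n}{\rightarrow}\boldsymbol{\lambda}$ is a path in $B_e^{\mathfrak{s}}$, then $m_l(\boldsymbol{\lambda})$ is the endpoint of the path $\boldsymbol{\emptyset}\overset{-i_1}{\rightarrow}\cdots\overset{-i_n}{\rightarrow}$ in $B_e^{\widetilde{\mathfrak{s}}}$ (which exists, and whose endpoint does not depend on the chosen path). By a theorem of Fayers this is the map on labels of simple modules of Ariki–Koike algebras induced by the isomorphism $T_0\mapsto\widetilde{T}_0$, $T_i\mapsto -q\widetilde{T}_i$ $(1\le i\le n-1)$ from the algebra with parameters $(q;q^{s_0},\dots,q^{s_{l-1}})$ to that with parameter $q^{-1}$ and the multicharge $(s_{l-1},\dots,s_0)$. For $l=1$ this gives $m_1:\Phi_e^{(s \bmod e)}\to\Phi_e^{(-s \bmod e)}$, the classical Mullineux involution on $e$-regular partitions, which does not depend on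 $s$. Action on multicharges. For $\mathbf{v}=(v_0,\dots,v_{l-1})\in\mathbb{Z}^l$, $\sigma_c$ ($1\le c\le l-1$) exchanges the entries $v_{c-1}$ and $v_c$, and $\tau.\mathbf{v}=(v_1,\dots,v_{l-1},v_0+e)$. For $c\ge d>0$, $w_{(c,d)}=\sigma_c\sigma_{c-1}\cdots\sigma_d$. For $1\le p\le l-1$, $\gamma_p=w_{(l-p,1)}\cdots w_{(l-2,p-1)}w_{(l-1,p)}$ and $\alpha_p=\tau^{l-p}\gamma_p$, so that $\alpha_p.\mathbf{v}=(v_0,\dots,v_{p-1},v_p+e,\dots,v_{l-1}+e)$. Finally $w_0=w_{(1,1)}w_{(2,1)}\cdots w_{(l-1,1)}$, so $w_0.\mathbf{v}=(v_{l-1},\dots,v_0)$. Products act as compositions (rightmost factor first); empty products are the identity. *)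

(* Defs.v *)
From Stdlib Require Export Relation_Operators.
From mathcomp Require Export all_boot all_order all_algebra.

Set Implicit Arguments.
Unset Strict Implicit.
Unset Printing Implicit Defensive.

Import Order.TTheory GRing.Theory Num.Theory.
Local Open Scope ring_scope.

Definition is_part (p : seq nat) : bool := sorted geq p && (0%N \notin p).

Definition part : Type := {p : seq nat | is_part p}.

Definition lpart (l : nat) : Type := {ffun 'I_l -> part}.

Definition empty_part : part := exist is_part [::] isT.

Definition lempty (l : nat) : lpart l := [ffun=> empty_part].

Definition rank (l : nat) (la : lpart l) : nat :=
  (\sum_(c < l) sumn (val (la c)))%N.

(* Rows and columns are numbered from 0; contents b - a are unaffected. *)
Definition node (l : nat) : Type := (nat * nat * 'I_l)%type.

Definition row (l : nat) (g : node l) : nat := g.1.1.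
Definition col (l : nat) (g : node l) : nat := g.1.2.
Definition comp_of (l : nat) (g : node l) : 'I_l := g.2.

Definition diagram (l : nat) (la : lpart l) : seq (node l) :=
  flatten [seq [seq (a, b, c) | a <- iota 0 (size (val (la c))),
                                b <- iota 0 (nth 0%N (val (la c)) a)]
          | c <- enum 'I_l].

(* A finite set of nodes is the Young diagram of an l-partition iff it is
   closed under moving one step up or one step left (with 0.-1 = 0). *)
Definition is_young (l : nat) (D : seq (node l)) : bool :=
  all (fun g => (((row g).-1, col g, comp_of g) \in D) &&
                ((row g, (col g).-1, comp_of g) \in D)) D.

Definition addable (l : nat) (la : lpart l) (g : node l) : bool :=
  (g \notin diagram la) && is_young (g :: diagram la).

Definition removable (l : nat) (la : lpart l) (g : node l) : bool :=
  (g \in diagram la) && is_young (rem g (diagram la)).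

(* For an addable node g the new row lengths do form a partition, so the
   default value of insubd is not used. *)
Definition add_node (l : nat) (la : lpart l) (g : node l) : lpart l :=
  [ffun c => if c == comp_of g then insubd (la c) (incr_nth (val (la c)) (row g))
             else la c].

Record crystal_rule (e l : nat) := CrystalRule {
  residue : node l -> 'Z_e;
  precedes : rel (node l)
}.

Definition content (l : nat) (v : {ffun 'I_l -> int}) (g : node l) : int :=
  (col g)%:Z - (row g)%:Z + v (comp_of g).

Definition uglov (e l : nat) (v : {ffun 'I_l -> int}) : crystal_rule e l :=
  @CrystalRule e l
    (fun g => (content v g)%:~R)
    (fun g h => (content v g < content v h) ||
                ((content v g == content v h) && (comp_of h < comp_of g)%N)).

(* Inside one component the contents are only compared with each other, so the
   order does not involve the charge at all. *)
Definition kleshchev (e l : nat) (vv : {ffun 'I_l -> 'Z_e}) : crystal_rule e l :=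
  @CrystalRule e l
    (fun g => ((col g)%:Z - (row g)%:Z)%:~R + vv (comp_of g))
    (fun g h => (comp_of g < comp_of h)%N ||
                ((comp_of g == comp_of h) &&
                 ((col g)%:Z - (row g)%:Z < (col h)%:Z - (row h)%:Z))).

(* The addable and removable i-nodes in increasing order: the rows and columns
   of such nodes are at most the rank. *)
Definition signature_nodes (e l : nat) (B : crystal_rule e l) (i : 'Z_e)
    (la : lpart l) : seq (node l) :=
  sort (fun g h => (g == h) || precedes B g h)
    [seq g <- flatten [seq [seq (a, b, c) | a <- iota 0 (rank la).+1,
                                            b <- iota 0 (rank la).+1]
                      | c <- enum 'I_l]
    | (residue B g == i) && (addable la g || removable la g)].

(* Reading the word from the right, each R cancels with the leftmost surviving A
   to its right: this deletes factors RA until a word A^p R^q remains. *)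
Definition delete_RA (l : nat) (la : lpart l) (w : seq (node l)) : seq (node l) :=
  foldr (fun g w' => if removable la g && (if w' is h :: _ then addable la h else false)
                     then behead w' else g :: w') [::] w.

Definition good_node (e l : nat) (B : crystal_rule e l) (i : 'Z_e) (la : lpart l) :
    option (node l) :=
  ohead (rev [seq g <- delete_RA la (signature_nodes B i la) | addable la g]).

Definition crystal_f (e l : nat) (B : crystal_rule e l) (i : 'Z_e) (la : lpart l) :
    option (lpart l) :=
  omap (add_node la) (good_node B i la).

Definition edge (e l : nat) (B : crystal_rule e l) (la mu : lpart l) : Prop :=
  exists i : 'Z_e, crystal_f B i la = Some mu.

Definition Phi (e l : nat) (B : crystal_rule e l) (n : nat) (la : lpart l) : Prop :=
  clos_refl_sym_trans (lpart l) (edge B) (lempty l) la /\ rank la = n.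

Definition path_end (e l : nat) (B : crystal_rule e l) (w : seq 'Z_e) :
    option (lpart l) :=
  foldl (fun o i => obind (crystal_f B i) o) (Some (lempty l)) w.

(* The endpoint in B' of the path from the empty l-partition whose labels are the
   images under r of the labels of a path from the empty l-partition to la in B.
   The path to la is selected by pick; for the two maps defined below, the
   endpoint is independent of it.  The value is the empty l-partition if one of
   the paths does not exist. *)
Definition transport (e l : nat) (B B' : crystal_rule e l) (r : 'Z_e -> 'Z_e)
    (la : lpart l) : lpart l :=
  if [pick w : (rank la).-tuple 'Z_e | path_end B w == Some la] is Some w
  then odflt (lempty l) (path_end B' [seq r i | i <- w])
  else lempty l.

Definition Psi (e l : nat) (v v' : {ffun 'I_l -> int}) : lpart l -> lpart l :=
  transport (uglov e v) (uglov e v') id.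

Definition class_mod (e l : nat) (v : {ffun 'I_l -> int}) : {ffun 'I_l -> 'Z_e} :=
  [ffun c => (v c)%:~R].

Definition neg_class (e l : nat) (vv : {ffun 'I_l -> 'Z_e}) : {ffun 'I_l -> 'Z_e} :=
  [ffun c => - vv c].

Definition tilde_class (e l : nat) (vv : {ffun 'I_l -> 'Z_e}) : {ffun 'I_l -> 'Z_e} :=
  [ffun c => - vv (rev_ord c)].

Definition mullineux (e l : nat) (vv : {ffun 'I_l -> 'Z_e}) : lpart l -> lpart l :=
  transport (kleshchev vv) (kleshchev (tilde_class vv)) -%R.

(* The level one map on the component of class t.  It does not depend on t. *)
Definition mullineux1 (e : nat) (t : 'Z_e) (p : part) : part :=
  @mullineux e 1 [ffun=> t] [ffun=> p] ord0.

(* The action on multicharges; products are compositions, rightmost first.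
   Here 1 <= c <= l - 1, so that the defaults of insubd are not used. *)
Definition sigma (l c : nat) (v : {ffun 'I_l -> int}) : {ffun 'I_l -> int} :=
  [ffun j : 'I_l => if j == c.-1 :> nat then v (insubd j c)
                    else if j == c :> nat then v (insubd j c.-1) else v j].

Definition tau (e l : nat) (v : {ffun 'I_l -> int}) : {ffun 'I_l -> int} :=
  [ffun j : 'I_l => if j.+1 == l then v (insubd j 0%N) + e%:Z
                    else v (insubd j j.+1)].

(* sigma_c sigma_(c-1) ... sigma_d *)
Definition w_act (l c d : nat) (v : {ffun 'I_l -> int}) : {ffun 'I_l -> int} :=
  foldr (fun k => @sigma l k) v (rev (iota d (c.+1 - d)%N)).

(* w_(l-p,1) ... w_(l-2,p-1) w_(l-1,p) *)
Definition gamma_act (l p : nat) (v : {ffun 'I_l -> int}) : {ffun 'I_l -> int} :=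
  foldr (fun k => @w_act l (l - p + k).-1%N k) v (iota 1 p).

Definition alpha_act (e l p : nat) (v : {ffun 'I_l -> int}) : {ffun 'I_l -> int} :=
  iter (l - p)%N (@tau e l) (gamma_act p v).

(* w_(1,1) w_(2,1) ... w_(l-1,1) *)
Definition w0_act (l : nat) (v : {ffun 'I_l -> int}) : {ffun 'I_l -> int} :=
  foldr (fun k => @w_act l k 1) v (iota 1 l.-1).

(* alpha_1^(2(p_(l-1)+1)) alpha_2^(2(p_(l-2)+1)) ... alpha_(l-1)^(2(p_1+1)) w_0 *)
Definition eta_act (e l : nat) (p : nat -> nat) (v : {ffun 'I_l -> int}) :
    {ffun 'I_l -> int} :=
  foldr (fun k => iter (2 * (p (l - k)).+1)%N (@alpha_act e l k)) (w0_act v)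
    (iota 1 l.-1).

Definition is_min_shift (e l n : nat) (s : {ffun 'I_l -> int}) (p : nat -> nat) : Prop :=
  forall b c : 'I_l, c = b.+1 :> nat ->
    n%:Z - 1 < s b - s c + (p c * e)%N%:Z /\
    (forall q : nat, n%:Z - 1 < s b - s c + (q * e)%N%:Z -> (p c <= q)%N).

Definition neg_charge (e l : nat) (p : nat -> nat) (s : {ffun 'I_l -> int}) :
    {ffun 'I_l -> int} :=
  [ffun c : 'I_l => - s c + \sum_(1 <= i < c.+1) (p i * e)%N%:Z].

(* Main.v *)
Require Import Defs.
From mathcomp Require Import all_boot all_order all_algebra.
From mathcomp Require Import zify.

Set Implicit Arguments.
Unset Strict Implicit.
Unset Printing Implicit Defensive.

Import Order.TTheory GRing.Theory Num.Theory.
Local Open Scope ring_scope.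

(** The proof replaces representation theory by Stembridge's local description
of simply laced crystals.

For a fixed order on diagonals, translation invariant and total, the crystal
operators only see the weights of the diagonals: +1 when the diagonal carries
an addable node, -1 when it carries a removable one.  Both the Kleshchev and
the Uglov rule have this form ([kleshchev_rule], [uglov_rule], [crystal_fE]).
The good node is the first maximum of the partial sums of these weights, as in
Littelmann's path model.  For two adjacent colours the two height functions
live on one common word, and comparing their first maxima shows that two
arrows issuing from a vertex either commute or satisfy a braid relation of
length four ([rank_two], [local_moves]).  This gives Stembridge's axioms for
at least three colours ([fock_stembridge]).

Two crystals that satisfy these axioms and have highest weight vertices of the
same weight have isomorphic sets of vertices reachable from these vertices,
and these sets are closed under inverse arrows ([transfer_induction]).  With
two colours there is no such local description, so each multipartition is
doubled: a second copy of every component, with charge shifted by e, embeds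
the crystal with e colours in one with 2e colours, an i-arrow becoming a pair
of commuting arrows whose colours are the two lifts of i ([double_f]).  Hence,
for every e, the connected component of the empty multipartition consists of
the endpoints of paths from it ([fock_pred], [Phi_path]), and the endpoint of
a path can be transported to any other rule of the same highest weight, also
with all colours negated ([fock_transfer_run], [fock_transfer_fun]).

Let w be a path to the given Kleshchev multipartition.  In the Kleshchev
order the signature is the concatenation of the signatures of the components,
so an arrow acts on one component, chosen by the string lengths in the
components alone ([tensor_match]).  Level one Mullineux maps preserve these
string lengths while negating colours; therefore the path -w, for the class
-s with the components in the same order, ends at the componentwise Mullineux
image ([componentwise_mullineux]).  When the gaps of a charge exceed n - 1,
the Uglov and the Kleshchev order agree on multipartitions of rank less than n
([uglov_kleshchev_f]); this applies to -s and to its image under eta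
([neg_charge_gap], [tilde_charge_gap]).  So the map Psi sends that image to
the endpoint of -w for the reversed negated class, which is the generalized
Mullineux image by definition. *)

(** * Signature words and their heights *)

Definition first_max (h : nat -> int) (m k : nat) : Prop :=
  [/\ (0 < k <= m)%N, forall t, (t < k)%N -> h t < h k
    & forall t, (k < t <= m)%N -> h t <= h k].

Lemma first_max_uniq h m k k' : first_max h m k -> first_max h m k' -> k = k'.
Proof.
case=> kb kl kg [kb' kl' kg'].
case: (ltngtP k k') => // lt.
  have := kl' _ lt; have := kg k'; lia.
have := kl _ lt; have := kg' k; lia.
Qed.

Lemma first_max_ext h h' m k : (forall t, (t <= m)%N -> h t = h' t) ->
  first_max h m k -> first_max h' m k.
Proof.
move=> eqh [kb kl kg]; split=> // t tb.
  rewrite -!eqh; [exact: kl | lia | lia].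
rewrite -!eqh; [exact: kg | lia | lia].
Qed.

Definition unit_on (T : eqType) (w : T -> int) (s : seq T) : Prop :=
  {in s, forall x, [\/ w x = 1, w x = 0 | w x = -1]}.

Section Words.
Variable T : eqType.
Implicit Types (w : T -> int) (s : seq T).

(** The letters A that survive the deletion of the factors RA, where weight 1
encodes A and weight -1 encodes R: read from the right, each R cancels the
leftmost A still alive on its right. *)
Fixpoint free_adds w s : seq T :=
  if s is x :: s' then
    if w x == 1 then x :: free_adds w s'
    else if w x == -1 then behead (free_adds w s') else free_adds w s'
  else [::].

Definition phi w s : nat := size (free_adds w s).
Definition good w s : option T := ohead (rev (free_adds w s)).
(** Reversal together with exchange of A and R maps the surviving letters R to
surviving letters A, so that every fact about arrows has a mirror image about
inverse arrows. *)
Definition eps w s : nat := phi (fun x => - w x) (rev s).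
Definition cogood w s : option T := good (fun x => - w x) (rev s).

Definition height w s (k : nat) : int := \sum_(x <- take k s) w x.

Lemma height0 w s : height w s 0 = 0.
Proof. by rewrite /height take0 big_nil. Qed.

Lemma height_cons w x s k : height w (x :: s) k.+1 = w x + height w s k.
Proof. by rewrite /height /= big_cons. Qed.

Lemma free_adds_filter w s : free_adds w s = free_adds w [seq x <- s | w x != 0].
Proof.
elim: s => //= x s ->.
case: (w x =P 1) => [e|n1]; first by rewrite e /= e eqxx.
case: (w x =P -1) => [e|n2]; first by rewrite e /= e.
by case: (w x =P 0) => [e|n3] //=; case: eqP => // _; case: eqP.
Qed.

(** The surviving letters A are those where the partial sums reach a new
record, so the rightmost one ends the first prefix of maximal height. *)
Lemma good_cases w s : unit_on w s ->
  (phi w s = 0%N /\ good w s = None /\ forall t, height w s t <= 0) \/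
  (exists x k, [/\ good w s = Some x, nth x s k = x, first_max (height w s) (size s) k.+1
     & (phi w s)%:Z = height w s k.+1]).
Proof.
rewrite /phi /good; elim: s => [|x s IH] uw.
  by left; split=> //; split=> // t; rewrite /height big_nil.
have ux : [\/ w x = 1, w x = 0 | w x = -1] by apply: uw; rewrite mem_head.
have {}uw : unit_on w s by move=> y ys; apply: uw; rewrite inE ys orbT.
have rc : forall a r, r <> [::] -> ohead (rev (a :: r)) = ohead (rev r) :> option T.
  move=> a r; rewrite rev_cons; case: (lastP r) => // r' b _.
  by rewrite rev_rcons.
case: (IH uw) => [[p0 [_ hle]]|[y [k [gy ny fm ph]]]].
  have r0 : free_adds w s = [::] by apply: size0nil.
  case: ux => e; rewrite /= e /= ?r0.
  - right; exists x, 0%N; split=> //; last by rewrite height_cons height0 e.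
    split=> // -[|t] // tb; rewrite ?height0 !height_cons e height0 //.
    by have := hle t; lia.
  - left; split=> //; split=> // -[|t]; rewrite ?height0 // height_cons e.
    by have := hle t; lia.
  - left; split=> //; split=> // -[|t]; rewrite ?height0 // height_cons e.
    by have := hle t; lia.
have rn : free_adds w s <> [::] by move=> r0; rewrite r0 in gy.
have sgt : (0 < size (free_adds w s))%N by case: (free_adds w s) rn.
have [kb kl kg] := fm.
have fm' : 0 < w x + height w s k.+1 -> first_max (height w (x :: s)) (size (x :: s)) k.+2.
  move=> pos; split=> //; move=> [|t] tb //; rewrite ?height0 !height_cons //.
    by have := kl t; lia.
  by rewrite ?height0 ?height_cons; have := kg t; rewrite /= in tb; lia.
case: ux => e; rewrite /= e /=.
- right; exists y, k.+1; split=> //; first by rewrite rc.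
    by apply: fm'; lia.
  by rewrite height_cons; lia.
- right; exists y, k.+1; split=> //.
    by apply: fm'; lia.
  by rewrite height_cons; lia.
- case: (leqP 2 (size (free_adds w s))) => sz; last first.
    left; split; first by rewrite size_behead; lia.
    split; first by case: (free_adds w s) sz => [|a [|b r]].
    case=> [|t]; rewrite ?height0 // height_cons e.
    case: (ltngtP t k.+1) => tk; [have := kl t; lia | | subst t; lia].
    case: (leqP t (size s)) => ts; first by have := kg t; lia.
    rewrite /height take_oversize; last by lia.
    case: (ltngtP k.+1 (size s)) => ks; [ | lia |].
      have := kg (size s); rewrite /height take_size; rewrite /height in ph; lia.
    by move: ph; rewrite /height ks take_size; lia.
  right; exists y, k.+1; split=> //.
  + case: (free_adds w s) gy sz => [|a [|b r]] //= gy _.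
    by rewrite -gy (rc a) //.
  + by apply: fm'; lia.
  + by rewrite size_behead height_cons; lia.
Qed.

Lemma good_firstmax w s x : unit_on w s -> uniq s -> good w s = Some x ->
  [/\ x \in s, first_max (height w s) (size s) (index x s).+1
    & (phi w s)%:Z = height w s (index x s).+1].
Proof.
move=> uw us gx; case: (good_cases uw) => [[_ [g0 _]]|]; first by rewrite g0 in gx.
case=> y [k [gy ny fm ph]]; move: gx ny; rewrite gy => -[<-] ny.
have [kb _ _] := fm.
have <- : k = index y s by rewrite -{1}ny index_uniq //; lia.
by split=> //; rewrite -ny mem_nth //; lia.
Qed.

Lemma firstmax_good w s x : unit_on w s -> uniq s -> x \in s ->
  first_max (height w s) (size s) (index x s).+1 -> good w s = Some x.
Proof.
move=> uw us xs fm; case: (good_cases uw) => [[_ [_ hle]]|].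
  have [_ kl _] := fm; have := kl 0%N; have := hle (index x s).+1.
  by rewrite height0; lia.
case=> y [k [gy ny fm' ph]]; rewrite gy; congr Some.
have := first_max_uniq fm fm' => -[e].
by have := nth_index y xs; rewrite e ny.
Qed.

Lemma good_phi w s : isSome (good w s) = (0 < phi w s)%N.
Proof.
rewrite /good /phi; case: (lastP (free_adds w s)) => // r a.
by rewrite rev_rcons size_rcons.
Qed.

Lemma phi_ge w s t : unit_on w s -> height w s t <= (phi w s)%:Z.
Proof.
move=> uw; case: (good_cases uw) => [[-> [_ h]]|[x [k [_ _ [kb kl kg] ->]]]].
  exact: h.
have tri : (t <= size s)%N -> height w s t <= height w s k.+1.
  by move=> ts; case: (ltngtP t k.+1) => tk; [have := kl t; lia | have := kg t; lia | subst].
case: (leqP t (size s)) => ts; first exact: tri.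
rewrite {1}/height take_oversize; last by lia.
case: (ltngtP k.+1 (size s)) => ks; [ | lia | by rewrite /height ks take_size].
by have := kg (size s); rewrite {1}/height take_size; lia.
Qed.

Lemma phi_attained w s : unit_on w s -> exists2 t, (t <= size s)%N & (phi w s)%:Z = height w s t.
Proof.
move=> uw; case: (good_cases uw) => [[-> _]|[x [k [_ _ [kb _ _] ->]]]].
  by exists 0%N; rewrite ?height0.
by exists k.+1 => //; lia.
Qed.

Lemma unit_rev w s : unit_on w s -> unit_on (fun x => - w x) (rev s).
Proof.
move=> uw x; rewrite mem_rev => /uw[]->; [apply: Or33|apply: Or32|apply: Or31] => //.
Qed.

Lemma height_rev w s t : (t <= size s)%N ->
  height (fun x => - w x) (rev s) t = height w s (size s - t) - height w s (size s).
Proof.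
move=> ts; rewrite /height take_rev big_rev /= sumrN take_size.
have -> : \sum_(x <- s) w x = \sum_(x <- take (size s - t) s) w x
    + \sum_(x <- drop (size s - t) s) w x by rewrite -big_cat cat_take_drop.
by rewrite opprD addrA subrr add0r.
Qed.

(** The maximum of the heights is the number of surviving A, and its excess over
the final height is the number of surviving R. *)
Lemma phi_eps w s : unit_on w s ->
  (phi w s)%:Z - (eps w s)%:Z = \sum_(x <- s) w x.
Proof.
move=> uw; rewrite /eps.
have tot : \sum_(x <- s) w x = height w s (size s) by rewrite /height take_size.
have [t ts e1] := phi_attained uw.
have [t' ts' e2] := phi_attained (unit_rev uw).
rewrite size_rev in ts'; rewrite height_rev // in e2.
have := phi_ge (size s - t') uw; have := phi_ge (size s - t) (unit_rev uw).
rewrite height_rev ?leq_subr // subKn // tot; lia.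
Qed.

Lemma height_update w w' s k a : uniq s -> k \in s ->
  {in s, forall q, w' q = w q + (if q == k then a else 0)} ->
  forall t, height w' s t = height w s t + (if (index k s < t)%N then a else 0).
Proof.
move=> us ks eqw t; rewrite /height.
have -> : \sum_(x <- take t s) w' x = \sum_(x <- take t s) (w x + (if x == k then a else 0)).
  by apply: eq_big_seq => x xs; apply: eqw; apply: mem_take xs.
rewrite big_split /= -big_mkcond /=; congr (_ + _).
rewrite -big_filter.
have -> : [seq i <- take t s | i == k] = if (index k s < t)%N then [:: k] else [::].
  have <- := in_take t ks; case: ifP => kt.
    by rewrite -[LHS]/(filter (pred1 k) _) filter_pred1_uniq // take_uniq.
  apply/eqP; rewrite -[_ == _]negbK -has_filter; apply/hasPn => q qt.
  by apply: contraFN kt => /eqP <-.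
by case: ifP; rewrite ?big_seq1 ?big_nil.
Qed.

Lemma height_step w s x : x \in s -> uniq s ->
  height w s (index x s).+1 = height w s (index x s) + w x.
Proof.
move=> xs us; rewrite /height (take_nth x) ?index_mem // nth_index //.
by rewrite -cats1 big_cat big_seq1.
Qed.

Lemma good_weight w s x : unit_on w s -> uniq s -> good w s = Some x -> w x = 1.
Proof.
move=> uw us gx; have [xs [kb kl kg] ph] := good_firstmax uw us gx.
have := kl (index x s) (ltnSn _); rewrite height_step //.
by case: (uw x xs) => ->; lia.
Qed.

Lemma index_rev s x : x \in s -> uniq s -> index x (rev s) = (size s - (index x s).+1)%N.
Proof.
move=> xs us; have ix : (index x s < size s)%N by rewrite index_mem.
have lt : (size s - (index x s).+1 < size s)%N by lia.
rewrite -{1}[x](nth_index x xs).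
have -> : nth x s (index x s) = nth x (rev s) (size s - (index x s).+1).
  by rewrite nth_rev //; congr nth; lia.
by rewrite index_uniq ?size_rev ?rev_uniq.
Qed.

(** Turning the good A into R lowers all later heights by 2; the height just
before it is then the last maximum, which makes it the leftmost surviving R. *)
Lemma good_toggle w w' s k : unit_on w s -> unit_on w' s -> uniq s ->
  good w s = Some k ->
  {in s, forall q, w' q = w q + (if q == k then -2 else 0)} ->
  [/\ cogood w' s = Some k, eps w' s = (eps w s).+1 & phi w s = (phi w' s).+1].
Proof.
move=> uw uw' us gk eqw.
have [ks fm ph] := good_firstmax uw us gk.
have hu := height_update us ks eqw.
have ik : (index k s < size s)%N by rewrite index_mem.
have [kb kl kg] := fm.
have wk := good_weight uw us gk.
have st := height_step w ks us.
have cg : cogood w' s = Some k.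
  rewrite /cogood; apply: firstmax_good; rewrite ?rev_uniq ?mem_rev //.
    exact: unit_rev.
  rewrite size_rev index_rev // subnSK //.
  have e : (index k s = size s - (size s - index k s))%N by lia.
  split=> [|t tb|t tb]; first by lia.
  - rewrite !height_rev; [|lia|lia]; rewrite -e !hu ltnn.
    case: ifP => c1; case: ifP => c2; try lia.
      case: (ltngtP (size s - t)%N (index k s).+1) => c3; [lia | have := kg (size s - t)%N; lia|].
      by rewrite c3; lia.
  - rewrite !height_rev; [|lia|lia]; rewrite -e !hu ltnn.
    case: ifP => c1; case: ifP => c2; try lia.
    by have := kl (size s - t)%N; lia.
have pp : phi w s = (phi w' s).+1.
  have [t tb e1] := phi_attained uw'.
  have := phi_ge (index k s) uw'; rewrite hu ltnn; move: e1; rewrite hu.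
  case: ifP => c.
    case: (ltngtP t (index k s).+1) => c3; [lia | have := kg t; lia|].
    by rewrite c3; lia.
  by have := kl t; lia.
split=> //.
have := phi_eps uw; have := phi_eps uw'.
have -> : \sum_(x <- s) w' x = \sum_(x <- s) w x - 2.
  have := hu (size s); rewrite /height take_size ik; lia.
lia.
Qed.

Lemma free_adds_ext w w' s : {in s, w =1 w'} -> free_adds w s = free_adds w' s.
Proof.
elim: s => //= x s IH e; rewrite e ?mem_head // IH // => y ys.
by apply: e; rewrite inE ys orbT.
Qed.

End Words.

Lemma free_adds_map (T U : eqType) (f : T -> U) w s :
  free_adds w (map f s) = map f (free_adds (w \o f) s).
Proof.
by elim: s => //= x s ->; case: ifP => // _; case: ifP => //; rewrite behead_map.
Qed.

(** * First maxima of two height functions *)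

(** The effect on the heights of changing the weight of letter number k by a. *)
Definition bump_from (a : int) (h : nat -> int) (k t : nat) : int :=
  h t + (if (k <= t)%N then a else 0).

(** The numerical form of a braid relation between the operators f1 and f2, where
f_c lowers the heights of colour c by 2 from their first maximum on and raises
those of the other colour by 1.  When f2, f1, f1, f2 are applied in turn, the
second component lists the first maxima met after k2; when f1, f2, f2, f1 are
applied in turn, the third one lists those met after k1.  In both cases the
four letters k1, k2, j1, l2 are changed.  The first component
distinguishes this case from that of commuting operators. *)
Definition braid_at (h1 h2 : nat -> int) (m k1 k2 : nat) : Prop :=
  exists j1 l2, [/\ (l2 <> k2) /\
       (bump_from 1 h2 k1 l2 = h2 k2 + 1 /\ bump_from 1 h1 k2 k1 = h1 k1 + 1),
     [/\ first_max (bump_from 1 h1 k2) m k1,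
         first_max (bump_from (-2) (bump_from 1 h1 k2) k1) m j1
       & first_max (bump_from 1 (bump_from 1 (bump_from (-2) h2 k2) k1) j1) m l2]
   & [/\ first_max (bump_from 1 h2 k1) m l2,
         first_max (bump_from (-2) (bump_from 1 h2 k1) l2) m k2
       & first_max (bump_from 1 (bump_from 1 (bump_from (-2) h1 k1) l2) k2) m j1]].

(** Raising h1 from k2 on does not move its first maximum k1.  Raising h2 from
k1 on moves its first maximum exactly when h2 attains its maximum again at or
after k1; then l2 is the first such point, and j1 is the first point from k2 on
where h1 is one below its maximum, which exists because h1 rises by at most one
per step. *)
Lemma rank_two_lt (h1 h2 : nat -> int) m k1 k2 :
  (forall t, (t < m)%N -> h1 t.+1 <= h1 t + 1) ->
  first_max h1 m k1 -> first_max h2 m k2 -> (k2 < k1)%N ->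
  [/\ first_max (bump_from 1 h2 k1) m k2, first_max (bump_from 1 h1 k2) m k1
    & bump_from 1 h2 k1 k2 = h2 k2]
  \/ braid_at h1 h2 m k1 k2.
Proof.
move=> st [kb1 kl1 kg1] [kb2 kl2 kg2] lt21.
pose P t := [&& (k1 <= t)%N, (t <= m)%N & h2 t == h2 k2].
case: (boolP (has P (iota 0 m.+1))) => [/hasP [t0 _ Pt0]|/hasPn noP]; last first.
  left; rewrite /bump_from; split; last by (case: ifP => ?); lia.
    split=> [|t tb|t tb]; first by lia.
      by have := kl2 t; do 2 (case: ifP => ?); lia.
    have := kg2 t; have := noP t; rewrite mem_iota /P; case: eqP => ?;
      do 2 (case: ifP => ?); lia.
  split=> [|t tb|t tb]; first by lia.
    by have := kl1 t; do 2 (case: ifP => ?); lia.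
  by have := kg1 t; do 2 (case: ifP => ?); lia.
right.
have exP : exists t, P t by exists t0.
case: (ex_minnP exP) => l2 /and3P [l2a l2b /eqP l2e] l2m.
pose Q t := (k2 <= t < k1)%N && (h1 t == h1 k1 - 1).
have exQ : exists t, Q t.
  exists k1.-1; rewrite /Q; have := st k1.-1; have := kl1 k1.-1.
  rewrite prednK; last by lia.
  move=> a b; have := a _; have := b _; lia.
case: (ex_minnP exQ) => j1 /andP [j1a /eqP j1e] j1m.
have hl2 : forall t, (t < l2)%N -> (k1 <= t)%N -> h2 t < h2 k2.
  move=> t tl tk; have := kg2 t; have := l2m t; rewrite /P.
  by case: eqP; lia.
have hj1 : forall t, (t < j1)%N -> (k2 <= t)%N -> h1 t < h1 k1 - 1.
  move=> t tl tk; have := kl1 t; have := j1m t; rewrite /Q.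
  by case: eqP; lia.
exists j1, l2; rewrite /bump_from; split; [| split | split].
- split; first by lia.
  by split; case: ifP => ?; lia.
all: split=> [|t tb|t tb]; first by lia.
all: move: (kl1 t) (kg1 t) (kl2 t) (kg2 t) (hl2 t) (hj1 t).
all: case: (ltngtP t k1) => ?; try subst t; try lia.
all: try (case: (ltngtP t k2) => ?; try subst t; try lia).
all: by repeat (case: ifP => ?); lia.
Qed.

(** The first maxima are distinct, since a step that raises both heights is
excluded. *)
Lemma rank_two (h1 h2 : nat -> int) m k1 k2 :
  (forall t, (t < m)%N -> [/\ h1 t.+1 <= h1 t + 1, h2 t.+1 <= h2 t + 1
     & h1 t.+1 <= h1 t \/ h2 t.+1 <= h2 t]) ->
  first_max h1 m k1 -> first_max h2 m k2 ->
  [\/ [/\ first_max (bump_from 1 h2 k1) m k2, first_max (bump_from 1 h1 k2) m k1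
    & bump_from 1 h2 k1 k2 = h2 k2 \/ bump_from 1 h1 k2 k1 = h1 k1],
   braid_at h1 h2 m k1 k2 | braid_at h2 h1 m k2 k1].
Proof.
move=> st f1 f2; case: (ltngtP k1 k2) => c.
- have := rank_two_lt (fun t tm => let: And3 _ b _ := st t tm in b) f2 f1 c.
  by case=> [[? ? ?]|?]; [apply: Or31; split=> //; right | apply: Or33].
- have := rank_two_lt (fun t tm => let: And3 b _ _ := st t tm in b) f1 f2 c.
  by case=> [[? ? ?]|?]; [apply: Or31; split=> //; left | apply: Or32].
case: f1 f2 => b1 l1 _ [_ l2 _]; subst k2.
have := st k1.-1; have := l1 k1.-1; have := l2 k1.-1.
rewrite prednK; last by lia.
by move=> h h' h''; have := h _; have := h' _; case: h''; lia.
Qed.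

(** * Good moves for two adjacent colours *)

(** A relation [mv k x y] (y is x with letter k changed), restricted to the good
letter of x.  Reversed words, negated weights and the converse relation turn
this into the description of inverse arrows. *)
Definition good_move (K : eqType) (X : Type) (s : seq K) (W : X -> K -> int)
    (mv : K -> X -> X -> Prop) (x y : X) : Prop :=
  exists k, [/\ k \in s, good (W x) s = Some k & mv k x y].

(** Changing a letter of one colour subtracts the simple root: its own weight drops
by 2 and the weight of the letter of the adjacent colour on the same index
grows by 1. *)
Definition toggles (K : eqType) (X : Type) (s : seq K) (W W' : X -> K -> int)
    (mv : K -> X -> X -> Prop) : Prop :=
  forall k x y, k \in s -> mv k x y -> {in s, forall q,
    W y q = W x q + (if q == k then -2 else 0) /\
    W' y q = W' x q + (if q == k then 1 else 0)}.

Section LocalMoves.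
Variables (K : eqType) (X : Type) (s : seq K).
Hypothesis us : uniq s.

Section OneColour.
Variables (W W' : X -> K -> int) (mv : K -> X -> X -> Prop).
Hypothesis uW : forall x, unit_on (W x) s.
Hypothesis tg : toggles s W W' mv.
Hypothesis ex : forall x k, k \in s -> W x k = 1 -> exists y, mv k x y.

Lemma good_move_heights x y k g g' :
  k \in s -> mv k x y -> height (W x) s =1 g -> height (W' x) s =1 g' ->
  height (W y) s =1 bump_from (-2) g (index k s).+1 /\
  height (W' y) s =1 bump_from 1 g' (index k s).+1.
Proof.
move=> ks m e e'; split=> t.
  by rewrite (height_update us ks (fun q qs => (tg ks m qs).1)) e.
by rewrite (height_update us ks (fun q qs => (tg ks m qs).2)) e'.
Qed.

Lemma first_max_move x0 x k g g' :
  height (W x) s =1 g -> height (W' x) s =1 g' -> first_max g (size s) k ->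
  exists y, [/\ good_move s W mv x y, mv (nth x0 s k.-1) x y,
    height (W y) s =1 bump_from (-2) g k & height (W' y) s =1 bump_from 1 g' k].
Proof.
move=> e e' fm; have [kb _ _] := fm.
have qs : nth x0 s k.-1 \in s by apply: mem_nth; lia.
have ik : (index (nth x0 s k.-1) s).+1 = k by rewrite index_uniq //; lia.
have gx : good (W x) s = Some (nth x0 s k.-1).
  apply: firstmax_good => //; rewrite ik; apply: first_max_ext fm => t _; exact/esym/e.
have [y my] := ex qs (good_weight (uW x) us gx).
have [h h'] := good_move_heights qs my e e'.
by exists y; split=> //; [exists (nth x0 s k.-1) | rewrite -ik | rewrite -ik].
Qed.

Lemma good_move_first_max x y : good_move s W mv x y ->
  exists k, [/\ k \in s, mv k x y, first_max (height (W x) s) (size s) (index k s).+1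
    & (phi (W x) s)%:Z = height (W x) s (index k s).+1].
Proof.
by case=> k [ks gk m]; have [_ ? ?] := good_firstmax (uW x) us gk; exists k.
Qed.

Lemma phi_first_max x k g : height (W x) s =1 g -> first_max g (size s) k ->
  (phi (W x) s)%:Z = g k.
Proof.
move=> e [kb kl kg].
have := phi_ge k (uW x); have [t tb] := phi_attained (uW x); rewrite !e => ->.
case: (ltngtP t k) => c; [have := kl t; lia | have := kg t; lia | by subst].
Qed.

End OneColour.

Section TwoColours.
Variables (W1 W2 : X -> K -> int) (mv1 mv2 : K -> X -> X -> Prop).
Hypothesis uW1 : forall x, unit_on (W1 x) s.
Hypothesis uW2 : forall x, unit_on (W2 x) s.
Hypothesis tg1 : toggles s W1 W2 mv1.
Hypothesis tg2 : toggles s W2 W1 mv2.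
Hypothesis ex1 : forall x k, k \in s -> W1 x k = 1 -> exists y, mv1 k x y.
Hypothesis ex2 : forall x k, k \in s -> W2 x k = 1 -> exists y, mv2 k x y.

Variables (Q : Type) (B : X -> Q -> int) (D1 D2 : K -> Q -> int).
Hypothesis mvB1 : forall k x y, mv1 k x y -> forall q, B y q = B x q + D1 k q.
Hypothesis mvB2 : forall k x y, mv2 k x y -> forall q, B y q = B x q + D2 k q.
Hypothesis injB : forall x y, (forall q, B x q = B y q) -> x = y.

Local Notation G1 := (good_move s W1 mv1).
Local Notation G2 := (good_move s W2 mv2).

(** Both sides of the braid change the same four letters.  States are
compared through an additive invariant [B], for which the order of the changes
is irrelevant. *)
Lemma braid_moves z y1 y2 k1 k2 : k1 \in s -> k2 \in s -> mv1 k1 z y1 -> mv2 k2 z y2 ->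
  first_max (height (W1 z) s) (size s) (index k1 s).+1 ->
  first_max (height (W2 z) s) (size s) (index k2 s).+1 ->
  braid_at (height (W1 z) s) (height (W2 z) s) (size s) (index k1 s).+1 (index k2 s).+1 ->
  [/\ (phi (W2 z) s < phi (W2 y1) s)%N, (phi (W1 z) s < phi (W1 y2) s)%N,
    ~ (exists x, G2 y1 x /\ G1 y2 x)
    & exists a b c d x, [/\ G2 y1 a, G2 a b & G1 b x] /\ [/\ G1 y2 c, G1 c d & G2 d x]].
Proof.
move=> k1s k2s m1 m2 f1 f2 [j1 [l2 [[nl2 [r2 r1]] [a1 a2 a3] [b1 b2 b3]]]].
have [hy11 hy12] := good_move_heights tg1 k1s m1 (frefl _) (frefl _).
have [hy22 hy21] := good_move_heights tg2 k2s m2 (frefl _) (frefl _).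
have [c [Gc mc hc1 hc2]] := first_max_move uW1 tg1 ex1 k1 hy21 hy22 a1.
have [d [Gd md hd1 hd2]] := first_max_move uW1 tg1 ex1 k1 hc1 hc2 a2.
have [x [Gx mx hx2 hx1]] := first_max_move uW2 tg2 ex2 k1 hd2 hd1 a3.
have [a [Ga ma ha2 ha1]] := first_max_move uW2 tg2 ex2 k1 hy12 hy11 b1.
have [b [Gb mb hb2 hb1]] := first_max_move uW2 tg2 ex2 k1 ha2 ha1 b2.
have [x' [Gx' mx' hx'1 hx'2]] := first_max_move uW1 tg1 ex1 k1 hb1 hb2 b3.
have p1 := phi_first_max uW1 (frefl _) f1.
have p2 := phi_first_max uW2 (frefl _) f2.
have p12 := phi_first_max uW2 hy12 b1.
have p21 := phi_first_max uW1 hy21 a1.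
have ik1 : nth k1 s (index k1 s).+1.-1 = k1 by rewrite /= nth_index.
have ik2 : nth k1 s (index k2 s).+1.-1 = k2 by rewrite /= nth_index.
split; [lia | lia | |]; last first.
  exists a, b, c, d, x; split; split=> //.
  suff -> : x = x' by [].
  apply: injB => q.
  rewrite (mvB2 mx) (mvB1 md) (mvB1 mc) (mvB2 m2) (mvB1 mx') (mvB2 mb) (mvB2 ma) (mvB1 m1).
  by rewrite ik1 ik2; lia.
case=> u [[q [qs gq mq]] [q' [qs' gq' mq']]].
have [_ fq _] := good_firstmax (uW2 y1) us gq.
have e : (index q s).+1 = l2.
  by apply: first_max_uniq b1; apply: first_max_ext fq => t _; rewrite hy12.
have nq : (k2 == q) = false by apply: contraTF (introN eqP nl2) => /eqP ->; rewrite e eqxx.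
have [_ fq' _] := good_firstmax (uW1 y2) us gq'.
have e' : (index q' s).+1 = (index k1 s).+1.
  by apply: first_max_uniq a1; apply: first_max_ext fq' => t _; rewrite hy21.
have eq' : q' = k1 by case: e' => e'; rewrite -(nth_index k1 qs') e' nth_index.
have := (tg2 qs mq k2s).1; have := (tg1 k1s m1 k2s).2.
have := (tg1 qs' mq' k2s).2; have := (tg2 k2s m2 k2s).1.
by rewrite nq eq' eqxx; case: ifP => _; lia.
Qed.

End TwoColours.
End LocalMoves.

(** One of the two strings keeps its length when the arrows commute; both grow
when they satisfy the braid relation.  The statement is about an abstract move
relation because it is used both for arrows and for inverse arrows. *)
Lemma local_moves (K : eqType) (X : Type) (s : seq K) (us : uniq s)
  (W1 W2 : X -> K -> int) (mv1 mv2 : K -> X -> X -> Prop)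
  (uW1 : forall x, unit_on (W1 x) s) (uW2 : forall x, unit_on (W2 x) s)
  (noAA : forall x, {in s, forall k, W1 x k = 1 -> W2 x k <> 1})
  (tg1 : toggles s W1 W2 mv1) (tg2 : toggles s W2 W1 mv2)
  (ex1 : forall x k, k \in s -> W1 x k = 1 -> exists y, mv1 k x y)
  (ex2 : forall x k, k \in s -> W2 x k = 1 -> exists y, mv2 k x y)
  (Q : Type) (B : X -> Q -> int) (D1 D2 : K -> Q -> int)
  (mvB1 : forall k x y, mv1 k x y -> forall q, B y q = B x q + D1 k q)
  (mvB2 : forall k x y, mv2 k x y -> forall q, B y q = B x q + D2 k q)
  (injB : forall x y, (forall q, B x q = B y q) -> x = y)
  (G1 := good_move s W1 mv1) (G2 := good_move s W2 mv2) (z y1 y2 : X) :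
  G1 z y1 -> G2 z y2 ->
  (exists2 x, G2 y1 x /\ G1 y2 x &
     phi (W2 y1) s = phi (W2 z) s \/ phi (W1 y2) s = phi (W1 z) s) \/
  [/\ (phi (W2 z) s < phi (W2 y1) s)%N, (phi (W1 z) s < phi (W1 y2) s)%N,
    ~ (exists x, G2 y1 x /\ G1 y2 x)
    & exists a b c d x, [/\ G2 y1 a, G2 a b & G1 b x] /\ [/\ G1 y2 c, G1 c d & G2 d x]].
Proof.
move=> g1 g2.
have [k1 [k1s m1 f1 p1]] := good_move_first_max us uW1 g1.
have [k2 [k2s m2 f2 p2]] := good_move_first_max us uW2 g2.
have st : forall t, (t < size s)%N ->
    [/\ height (W1 z) s t.+1 <= height (W1 z) s t + 1,
        height (W2 z) s t.+1 <= height (W2 z) s t + 1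
      & height (W1 z) s t.+1 <= height (W1 z) s t \/
        height (W2 z) s t.+1 <= height (W2 z) s t].
  move=> t ts; have qs := mem_nth k1 ts.
  have it : index (nth k1 s t) s = t by rewrite index_uniq.
  have := height_step (W1 z) qs us; have := height_step (W2 z) qs us; rewrite it => -> ->.
  have n := noAA z _ qs.
  case: (uW1 z _ qs) => e1; case: (uW2 z _ qs) => e2; rewrite e1 e2; split; try lia.
case: (rank_two st f1 f2) => [[c1 c2 c3]|br|br]; last 2 first.
- right; exact: (braid_moves us uW1 uW2 tg1 tg2 ex1 ex2 mvB1 mvB2 injB k1s k2s m1 m2 f1 f2 br).
- right.
  have [i1 i2 i3 [a [b [c [d [x [i4 i5]]]]]]] :=
    braid_moves us uW2 uW1 tg2 tg1 ex2 ex1 mvB2 mvB1 injB k2s k1s m2 m1 f2 f1 br.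
  split=> //; first by case=> u [u1 u2]; apply: i3; exists u.
  by exists c, d, a, b, x.
have [hy11 hy12] := good_move_heights us tg1 k1s m1 (frefl _) (frefl _).
have [hy22 hy21] := good_move_heights us tg2 k2s m2 (frefl _) (frefl _).
have [x [Gx mx _ _]] := first_max_move us uW2 tg2 ex2 k1 hy12 hy11 c1.
have [x' [Gx' mx' _ _]] := first_max_move us uW1 tg1 ex1 k1 hy21 hy22 c2.
have ik1 : nth k1 s (index k1 s).+1.-1 = k1 by rewrite /= nth_index.
have ik2 : nth k1 s (index k2 s).+1.-1 = k2 by rewrite /= nth_index.
left; exists x; first split=> //.
  suff -> : x = x' by [].
  apply: injB => q.
  by rewrite (mvB2 _ _ _ mx) (mvB1 _ _ _ m1) (mvB1 _ _ _ mx') (mvB2 _ _ _ m2) ik1 ik2; lia.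
have := phi_first_max us uW2 hy12 c1; have := phi_first_max us uW1 hy21 c2.
by case: c3 => e; [left | right]; lia.
Qed.

(** * Crystals with Stembridge's local axioms *)

(** Stembridge's axioms for a crystal with operators [f], string lengths [ep]
and [ph] and Cartan matrix [a].  The growth of the string lengths in [st_f]
decides, from data at the source and one step below it, which of the two
relations holds; this is what makes the axioms transferable. *)
Record stembridge (I : eqType) (a : I -> I -> int) (S : Type) (f : I -> S -> option S)
    (ep ph : I -> S -> nat) : Prop := Stembridge {
  st_ph : forall i x, isSome (f i x) = (0 < ph i x)%N;
  st_ep : forall i x, (0 < ep i x)%N <-> exists y, f i y = Some x;
  st_epS : forall i x y, f i x = Some y -> ep i y = (ep i x).+1;
  st_wt : forall i x y, f i x = Some y -> forall j,
    (ph j y)%:Z - (ep j y)%:Z = (ph j x)%:Z - (ep j x)%:Z - a i j;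
  st_inj : forall i x y z, f i x = Some z -> f i y = Some z -> x = y;
  st_f : forall i j z y1 y2, i != j -> f i z = Some y1 -> f j z = Some y2 ->
    (exists2 x, f j y1 = Some x /\ f i y2 = Some x &
       ph j y1 = ph j z \/ ph i y2 = ph i z) \/
    [/\ (ph j z < ph j y1)%N, (ph i z < ph i y2)%N,
      ~ (exists x, f j y1 = Some x /\ f i y2 = Some x)
      & exists a b c d x, [/\ f j y1 = Some a, f j a = Some b & f i b = Some x] /\
          [/\ f i y2 = Some c, f i c = Some d & f j d = Some x]];
  st_e : forall i j x y1 y2, i != j -> f i y1 = Some x -> f j y2 = Some x ->
    (exists z, f j z = Some y1 /\ f i z = Some y2) \/
    (exists a b c d z, [/\ f i z = Some a, f j a = Some b & f j b = Some y1] /\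
          [/\ f j z = Some c, f i c = Some d & f i d = Some y2])
}.

Definition run (I S : Type) (f : I -> S -> option S) (o : S) (w : seq I) : option S :=
  foldl (fun u i => obind (f i) u) (Some o) w.

Lemma run_rcons (I S : Type) (f : I -> S -> option S) (o : S) w i :
  run f o (rcons w i) = obind (f i) (run f o w).
Proof. by rewrite /run foldl_rcons. Qed.

Section Paired.
Variables (I : eqType) (S S' : Type) (f : I -> S -> option S) (f' : I -> S' -> option S').

(** Endpoints of paths with the same labels in two crystals. *)
Definition paired (o : S) (o' : S') (n : nat) (x : S) (x' : S') : Prop :=
  exists w, [/\ size w = n, run f o w = Some x & run f' o' w = Some x'].

(** Inverse arrows at x are matched by inverse arrows of the same colour at x',
with sources again reached by common paths. *)
Definition half_match o o' n x x' : Prop :=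
  forall j y, f j y = Some x ->
    exists2 m, n = m.+1 & exists2 y', f' j y' = Some x' & paired o o' m y y'.
End Paired.

Section HalfTransfer.
Variables (I : eqType) (a : I -> I -> int) (S S' : Type).
Variables (f : I -> S -> option S) (ep ph : I -> S -> nat).
Variables (f' : I -> S' -> option S') (ep' ph' : I -> S' -> nat).
Hypothesis st : stembridge a f ep ph.
Hypothesis st' : stembridge a f' ep' ph'.
Variables (o : S) (o' : S').

Local Notation P := (paired f f' o o').

Lemma paired_step n x x' i y : P n x x' -> ph i x = ph' i x' -> f i x = Some y ->
  exists y', f' i x' = Some y' /\ P n.+1 y y'.
Proof.
case=> w [sw rx rx'] e fx.
have : isSome (f' i x') by rewrite (st_ph st') -e -(st_ph st) fx.
case fx' : (f' i x') => [y'|] // _; exists y' => //; split=> //.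
by exists (rcons w i); rewrite size_rcons sw !run_rcons rx rx' /= fx fx'.
Qed.

Variable n : nat.
Hypothesis IHeq : forall m x x', (m <= n)%N -> P m x x' ->
  forall j, ep j x = ep' j x' /\ ph j x = ph' j x'.
Hypothesis IHhalf : forall m x x', (m <= n)%N -> P m x x' ->
  half_match f f' o o' m x x'.

Lemma paired_forward m x x' i y : (m <= n)%N -> P m x x' -> f i x = Some y ->
  exists y', f' i x' = Some y' /\ P m.+1 y y'.
Proof.
move=> mn p fx.
exact: paired_step p (IHeq mn p i).2 fx.
Qed.

(** If f_i f_j z = f_j f_i z holds at z, then the string lengths at z, f_i z and f_j z,
which coincide in the two crystals by induction, force the same
relation at the vertex paired with z. *)
Lemma half_match_commute y y' i x x' j y2 z : P n y y' -> f i y = Some x ->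
  f' i y' = Some x' -> i != j -> f j y2 = Some x -> f j z = Some y -> f i z = Some y2 ->
  exists2 y2', f' j y2' = Some x' & P n y2 y2'.
Proof.
move=> p fx fx' nij fy2 fz fz2.
have [m en [z' fz' pz]] := IHhalf (leqnn n) p fz.
have mn : (m <= n)%N by lia.
have [y2' [fz2' p2]] := paired_forward mn pz fz2; rewrite -en in p2.
exists y2' => //.
have nb : ph j y2 = ph j z \/ ph i y = ph i z.
  case: (st_f st nij fz2 fz) => [[u [u1 u2] //]|[_ _ c _]].
  by case: c; exists x.
case: (st_f st' nij fz2' fz') => [[u [u1 u2] _]|[h1 h2 _ _]].
  by move: u2; rewrite fx' => -[->].
rewrite -!(IHeq (leqnn n) p2 _).2 -!(IHeq (leqnn n) p _).2 -!(IHeq mn pz _).2 in h1 h2.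
by case: nb; lia.
Qed.

(** Two inverse arrows at x close up to a square or to a braid with
top z.  The inverse arrows from f_i y = x through y up to z are matched by
induction, and so are the arrows from z down to y2; the axioms for arrows at
the vertex paired with z then produce the same figure above x'. *)
Lemma half_match_succ y y' i x x' : P n y y' -> f i y = Some x -> f' i y' = Some x' ->
  half_match f f' o o' n.+1 x x'.
Proof.
move=> p fx fx' j y2 fy2; exists n => //.
case: (i =P j) => [e|/eqP nij].
  by subst j; rewrite (st_inj st fy2 fx); exists y'.
case: (st_e st nij fx fy2) => [[z [z1 z2]]|].
  exact: (half_match_commute p fx fx' nij fy2 z1 z2).
case=> a1 [a2 [b1 [b2 [z [[za1 za2 za3] [zb1 zb2 zb3]]]]]].
case: (st_f st nij za1 zb1) => [[u [u1 u2] _]|[h1 h2 _ _]].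
  (* The arrows at z commute, so the bottom of the braid is already a square. *)
  apply: (half_match_commute p fx fx' nij fy2 za3).
  by move: u1; rewrite za2 => -[eu]; move: u2; rewrite zb2 => -[eb]; rewrite eu -eb.
have [m em [a2' fa2 pa2]] := IHhalf (leqnn n) p za3.
have mn : (m <= n)%N by lia.
have [m1 em1 [a1' fa1 pa1]] := IHhalf mn pa2 za2.
have m1n : (m1 <= n)%N by lia.
have [m2 em2 [z' fz pz]] := IHhalf m1n pa1 za1.
have m2n : (m2 <= n)%N by lia.
have m2n1 : (m2.+1 <= n)%N by lia.
have m2n2 : (m2.+2 <= n)%N by lia.
have [b1' [fb1 pb1]] := paired_forward m2n pz zb1.
have [b2' [fb2 pb2]] := paired_forward m2n1 pb1 zb2.
have [y2' [fb3 py2]] := paired_forward m2n2 pb2 zb3.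
exists y2'; last by have -> : n = m2.+3 by lia.
case: (st_f st' nij fz fb1) => [[u _ nb]|].
  move: nb; rewrite -!(IHeq m2n pz _).2 -(IHeq m1n pa1 _).2 -(IHeq m2n1 pb1 _).2.
  by case; lia.
case=> _ _ _ [a3 [b3 [c3 [d3 [u [[]]]]]]].
rewrite fa1 => -[<-]; rewrite fa2 => -[<-]; rewrite fx' => -[<-] [].
by rewrite fb2 => -[<-]; rewrite fb3 => -[<-].
Qed.
End HalfTransfer.

Lemma paired_sym (I : eqType) (S S' : Type) (f : I -> S -> option S) (f' : I -> S' -> option S')
    o o' n x x' : paired f f' o o' n x x' -> paired f' f o' o n x' x.
Proof. by case=> w [? ? ?]; exists w. Qed.

Section TransferTheorem.
Variables (I : eqType) (a : I -> I -> int) (S S' : Type).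
Variables (f : I -> S -> option S) (ep ph : I -> S -> nat).
Variables (f' : I -> S' -> option S') (ep' ph' : I -> S' -> nat).
Hypothesis st : stembridge a f ep ph.
Hypothesis st' : stembridge a f' ep' ph'.
Variables (o : S) (o' : S').
Hypothesis ep0 : forall i, ep i o = 0%N.
Hypothesis ep0' : forall i, ep' i o' = 0%N.
Hypothesis ph0 : forall i, ph i o = ph' i o'.

(** Induction on the length of paths: a new vertex x = f_i y gets
its string lengths from the inverse arrows at x, which are matched, and from
the weight. *)
Lemma transfer_induction n : forall m x x', (m <= n)%N -> paired f f' o o' m x x' ->
  [/\ forall j, ep j x = ep' j x' /\ ph j x = ph' j x',
    half_match f f' o o' m x x' & half_match f' f o' o m x' x].
Proof.
elim: n => [|n IH] m x x'.
  rewrite leqn0 => /eqP -> [w [/size0nil -> /= [<-] [<-]]]; split.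
  - by move=> j; rewrite ep0 ep0' ph0.
  - by move=> j y fy; have := (st_ep st j o).2 (ex_intro _ y fy); rewrite ep0.
  - by move=> j y fy; have := (st_ep st' j o').2 (ex_intro _ y fy); rewrite ep0'.
rewrite leq_eqVlt => /orP [/eqP ->|]; last by rewrite ltnS; apply: IH.
have IHeq m' y y' (mn : (m' <= n)%N) p := let: And3 h _ _ := IH m' y y' mn p in h.
have IHhalf m' y y' (mn : (m' <= n)%N) p := let: And3 _ h _ := IH m' y y' mn p in h.
have IHeq' m' y y' : (m' <= n)%N -> paired f' f o' o m' y y' ->
    forall j, ep' j y = ep j y' /\ ph' j y = ph j y'.
  by move=> mn p j; have [-> ->] := IHeq m' y' y mn (paired_sym p) j.
have IHhalf' m' y y' (mn : (m' <= n)%N) p := let: And3 _ _ h := IH m' y' y mn (paired_sym p) in h.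
case=> w [sw]; move: sw; case/lastP: w => // w i; rewrite size_rcons => -[sw].
rewrite !run_rcons; case ry: (run f o w) => [y|] //= fx; case ry': (run f' o' w) => [y'|] //= fx'.
have p : paired f f' o o' n y y' by exists w.
have h := half_match_succ st st' IHeq IHhalf p fx fx'.
have h' := half_match_succ st' st IHeq' IHhalf' (paired_sym p) fx' fx.
split=> // j.
have eph : ep j x = ep' j x'.
  case: (posnP (ep j x)) => [e0|/(st_ep st) [y2 fy2]]; last first.
    have [_ [<-] [y2' fy2' p2]] := h j y2 fy2.
    by rewrite (st_epS st fy2) (st_epS st' fy2') (IHeq n y2 y2' (leqnn n) p2 j).1.
  rewrite e0; case: (posnP (ep' j x')) => // /(st_ep st') [y2' fy2'].
  have [_ [<-] [y2 fy2 p2]] := h' j y2' fy2'.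
  by have := st_epS st fy2; rewrite e0.
split=> //.
have [e1 e2] := IHeq n y y' (leqnn n) p j.
have := st_wt st fx j; have := st_wt st' fx' j; lia.
Qed.

Theorem transfer_eq n x x' : paired f f' o o' n x x' ->
  forall j, ep j x = ep' j x' /\ ph j x = ph' j x'.
Proof. by move=> p; case: (transfer_induction (leqnn n) p). Qed.

(** Applied to a crystal and itself, this says that the vertices reachable from the
highest weight vertex are closed under inverse arrows. *)
Theorem transfer_pred n x x' j y : paired f f' o o' n x x' -> f j y = Some x ->
  exists2 m, n = m.+1 & exists2 y', f' j y' = Some x' & paired f f' o o' m y y'.
Proof. by move=> p; case: (transfer_induction (leqnn n) p) => _ h _; apply: h. Qed.

Theorem transfer_run w x : run f o w = Some x -> exists x', run f' o' w = Some x'.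
Proof.
elim/last_ind: w x => [|w i IH] x; first by exists o'.
rewrite !run_rcons; case r: (run f o w) => [y|] //= fx.
have [y' r'] := IH y r; rewrite r' /=.
have p : paired f f' o o' (size w) y y' by exists w.
have : isSome (f' i y') by rewrite (st_ph st') -(transfer_eq p i).2 -(st_ph st) fx.
by case: (f' i y') => [x'|] // _; exists x'.
Qed.

Theorem transfer_fun n x x' x'' : paired f f' o o' n x x' -> paired f f' o o' n x x'' ->
  x' = x''.
Proof.
elim: n x x' x'' => [|n IH] x x' x''.
  by case=> w [/size0nil -> /= _ [<-]] [w' [/size0nil -> /= _ [<-]]].
case=> w [sw]; move: sw; case/lastP: w => // w i; rewrite size_rcons => -[sw].
rewrite !run_rcons; case ry: (run f o w) => [y|] //= fx; case ry': (run f' o' w) => [y'|] //= fx'.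
move=> p; have [_ [<-] [y'' fy'' p'']] := transfer_pred p fx.
have e := IH y y' y'' (ex_intro _ w (And3 sw ry ry')) p''.
by move: fy''; rewrite -e fx' => -[].
Qed.

End TransferTheorem.

(** * Partitions as bead configurations *)

Section Partitions.
Implicit Types p q : part.

Definition prow p (a : nat) : nat := nth 0%N (val p) a.

Lemma is_partE (s : seq nat) :
  reflect ((forall a, (nth 0 s a.+1 <= nth 0 s a)%N) /\ (forall a, (a < size s)%N -> (0 < nth 0
    s a)%N))
    (is_part s).
Proof.
apply: (iffP andP) => [[/(sortedP 0%N) so n0]|[h pos]].
  split=> a; last first.
    by move=> sa; rewrite lt0n; apply: contra n0 => /eqP <-; rewrite mem_nth.
  case: (ltnP a.+1 (size s)) => c; first exact: so.
  by rewrite [nth _ _ a.+1]nth_default.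
split; first by apply/(sortedP 0%N) => i _; apply: h.
by apply/negP => /(nthP 0%N) [i si e]; have := pos i si; rewrite e.
Qed.

Lemma prow_le p a b : (a <= b)%N -> (prow p b <= prow p a)%N.
Proof.
elim: b => [|b IH]; first by rewrite leqn0 => /eqP ->.
rewrite leq_eqVlt => /orP [/eqP -> //|]; rewrite ltnS => /IH.
by apply: leq_trans; have [h _] := is_partE _ (valP p); apply: h.
Qed.

Lemma prow_gt0 p a : (0 < prow p a)%N = (a < size (val p))%N.
Proof.
case: (ltnP a (size (val p))) => c; last by rewrite /prow nth_default.
by have [_ h] := is_partE _ (valP p); apply: h.
Qed.

Lemma prow_ext p q : prow p =1 prow q -> p = q.
Proof.
move=> e; apply: val_inj; apply: (@eq_from_nth _ 0%N) => [|a _]; last exact: e.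
have h r r' : prow r =1 prow r' -> (size (val r) <= size (val r'))%N.
  move=> {}e; rewrite leqNgt -prow_gt0 e.
  by rewrite prow_gt0 ltnn.
by apply/eqP; rewrite eqn_leq !h.
Qed.

(** The beta-set of the partition, extended to infinitely many zero rows: row a
contributes a bead at its length minus a. *)
Definition bead p (d : int) : bool :=
  has (fun a => (prow p a)%:Z - a%:Z == d) (iota 0 (size (val p) + `|d|).+1).

Lemma beadP p d : reflect (exists a, (prow p a)%:Z - a%:Z = d) (bead p d).
Proof.
apply: (iffP hasP) => [[a _ /eqP e]|[a e]]; first by exists a.
exists a; last exact/eqP.
rewrite mem_iota; have := prow_gt0 p a; lia.
Qed.

(** The rows are recovered from the top, since the beads of the rows form a
strictly decreasing sequence. *)
Lemma bead_inj p q : bead p =1 bead q -> p = q.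
Proof.
move=> e; apply: prow_ext => a.
have key r r' n : bead r =1 bead r' -> (forall b, (b < n)%N -> prow r b = prow r' b) ->
    (prow r' n <= prow r n)%N.
  move=> {}e IH.
  have : bead r ((prow r' n)%:Z - n%:Z) by rewrite e; apply/beadP; exists n.
  case/beadP => b eb; case: (ltnP b n) => bn.
    by have := prow_le r' (ltnW bn); rewrite -(IH b bn); lia.
  by have := prow_le r bn; lia.
elim/ltn_ind: a => n IH.
by apply/eqP; rewrite eqn_leq !key // => b bn; rewrite IH.
Qed.

(** A node can be added on diagonal d when the bead at d can move to d + 1, and
removed when the bead at d + 1 can move to d. *)
Definition dweight p (d : int) : int := (bead p d : nat)%:Z - (bead p (d + 1) : nat)%:Z.

Lemma dweight_unit p d : [\/ dweight p d = 1, dweight p d = 0 | dweight p d = -1].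
Proof.
by rewrite /dweight; case: (bead p d); case: (bead p (d + 1));
  [apply: Or32 | apply: Or31 | apply: Or33 | apply: Or32].
Qed.

Lemma dweight_add p d : dweight p d = 1 <->
  exists a, (prow p a)%:Z - a%:Z = d /\ ((a == 0%N) || (prow p a < prow p a.-1)%N).
Proof.
rewrite /dweight; split.
  case: (beadP p d) => [[a ea]|_]; last by case: bead.
  case: (beadP p (d + 1)) => // nb _; exists a; split=> //.
  case: a ea => //= a ea; rewrite ltnNge; apply/negP => le.
  by apply: nb; exists a; have := prow_le p (leqnSn a); lia.
case=> a [ea h].
have -> : bead p d by apply/beadP; exists a.
suff /negbTE -> : ~~ bead p (d + 1) by [].
apply/beadP => -[b eb].
case: (ltnP b a) => c; last by have := prow_le p c; lia.
have := @prow_le p b a.-1; case: a c ea h => //= a; lia.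
Qed.

Lemma dweight_rem p d : dweight p d = -1 <->
  exists a, (prow p a)%:Z - a%:Z = d + 1 /\ (prow p a.+1 < prow p a)%N.
Proof.
rewrite /dweight; split.
  case: (beadP p (d + 1)) => [[a ea]|_]; last by case: bead.
  case: (beadP p d) => // nb _; exists a; split=> //.
  rewrite ltnNge; apply/negP => le.
  by apply: nb; exists a.+1; have := prow_le p (leqnSn a); lia.
case=> a [ea h].
have -> : bead p (d + 1) by apply/beadP; exists a.
suff /negbTE -> : ~~ bead p d by [].
apply/beadP => -[b eb].
case: (ltnP a b) => c; last by have := prow_le p c; lia.
have := @prow_le p a.+1 b; lia.
Qed.

Lemma sumn_size p : (size (val p) <= sumn (val p))%N.
Proof.
have /andP [_] := valP p; elim: (val p) => //= x s IH.
rewrite inE negb_or => /andP [x0 /IH]; lia.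
Qed.

Lemma prow_sumn p a : (prow p a <= sumn (val p))%N.
Proof.
rewrite /prow; elim: (val p) a => [|x s IH] [|a] //=; first exact: leq_addr.
by have := IH a; lia.
Qed.

Lemma addable_row_le p a : (a == 0%N) || (prow p a < prow p a.-1)%N -> (a <= size (val p))%N.
Proof.
case: a => [//|a] /orP [//|h]; have {}h : (prow p a.+1 < prow p a)%N by [].
by rewrite -prow_gt0; lia.
Qed.

Lemma dweight_bound p d : dweight p d != 0 -> (`|d| <= sumn (val p))%N.
Proof.
have := sumn_size p; have := prow_sumn p => hp hs.
case: (dweight_unit p d) => [/dweight_add [a [ea ha]] _|->//|/dweight_rem [a [ea ha]] _].
  by have := hp a; have := addable_row_le ha; lia.
by have := hp a; have := prow_gt0 p a; lia.
Qed.

(** Additive form of a bead moving from d to d + 1. *)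
Definition bead_move p d q : Prop := forall d',
  (bead q d' : nat)%:Z = (bead p d' : nat)%:Z + (if d' == d + 1 then 1 else 0)
     - (if d' == d then 1 else 0).

Lemma bead_move_rows p q a : (forall b, prow q b = prow p b + (a == b))%N ->
  bead_move p ((prow p a)%:Z - a%:Z) q.
Proof.
move=> e d'; set d := (prow p a)%:Z - a%:Z.
have inj r b b' : (prow r b)%:Z - b%:Z = (prow r b')%:Z - b'%:Z -> b = b'.
  by case: (ltngtP b b') => // c; [have := prow_le r (ltnW c)|have := prow_le r (ltnW c)]; lia.
have qa : (prow q a)%:Z - a%:Z = d + 1 by rewrite e eqxx /d; lia.
case: (d' =P d + 1) => [->|n1].
  have -> : bead q (d + 1) by apply/beadP; exists a.
  have -> : (d + 1 == d) = false by lia.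
  suff /negbTE -> : ~~ bead p (d + 1) by [].
  apply/beadP => -[b eb]; have [ab|/eqP nab] := a =P b; first by subst b; rewrite /d in eb; lia.
  have : (prow q b)%:Z - b%:Z = (prow q a)%:Z - a%:Z by rewrite e (negbTE nab) addn0 eb qa.
  by move/inj => ba; rewrite ba eqxx in nab.
case: (d' =P d) => [->|n2].
  have -> : bead p d by apply/beadP; exists a.
  suff /negbTE -> : ~~ bead q d by [].
  apply/beadP => -[b eb]; have [ab|/eqP nab] := a =P b; first by subst b; lia.
  have : (prow p b)%:Z - b%:Z = (prow p a)%:Z - a%:Z by rewrite -[RHS]eb e (negbTE nab) addn0.
  by move/inj => ba; rewrite ba eqxx in nab.
rewrite addr0 subr0; congr (nat_of_bool _)%:Z.
by apply/beadP/beadP => -[b eb]; exists b; have [ab|/eqP nab] := a =P b;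
  try (by subst b; rewrite /d in n1 n2 qa *; lia); rewrite -eb e (negbTE nab) addn0.
Qed.

(** For a diagonal with an addable node the search succeeds and the incremented
list is a partition, so no default value occurs. *)
Definition add_diag p (d : int) : part :=
  insubd p (incr_nth (val p) (find (fun a => (prow p a)%:Z - a%:Z == d) (iota 0 (size (val
    p)).+1))).

Lemma incr_is_part p a : (a == 0%N) || (prow p a < prow p a.-1)%N ->
  is_part (incr_nth (val p) a).
Proof.
move=> h; have [h1 h2] := is_partE _ (valP p).
apply/is_partE; split=> b; rewrite ?nth_incr_nth.
  have := h1 b; rewrite /prow in h; case: (a =P b.+1) => [e|_]; last by move=> ?; lia.
  have {}h : (nth 0 (val p) b.+1 < nth 0 (val p) b)%N by rewrite e in h.
  by subst a; have -> : (b.+1 == b) = false; lia.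
rewrite size_incr_nth => sb; case: (a =P b) => // /eqP nab; rewrite add0n.
by apply: h2; have := addable_row_le h; move: sb; case: ifP; lia.
Qed.

Lemma add_diag_row p a : (a == 0%N) || (prow p a < prow p a.-1)%N ->
  val (add_diag p ((prow p a)%:Z - a%:Z)) = incr_nth (val p) a.
Proof.
move=> h; rewrite /add_diag.
set P := (fun b : nat => _).
have aS : (a < (size (val p)).+1)%N by rewrite ltnS addable_row_le.
have -> : find P (iota 0 (size (val p)).+1) = a; last by rewrite insubdK //; exact: incr_is_part.
have hP : has P (iota 0 (size (val p)).+1).
  by apply/hasP; exists a; rewrite ?mem_iota // /P.
have := nth_find 0%N hP; rewrite has_find size_iota in hP; rewrite nth_iota // add0n /P.
move/eqP; set b := find _ _.
by case: (ltngtP b a) => // c; [have := prow_le p (ltnW c)|have := prow_le p (ltnW c)]; lia.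
Qed.

Lemma sumn_incr_nth (s : seq nat) i : sumn (incr_nth s i) = (sumn s).+1.
Proof.
elim: s i => [|x s IH] [|i] //=; last by rewrite IH addnS.
by elim: i => //= i ->.
Qed.

Lemma add_diagP p d : dweight p d = 1 ->
  bead_move p d (add_diag p d) /\ sumn (val (add_diag p d)) = (sumn (val p)).+1.
Proof.
case/dweight_add => a [<- h]; rewrite add_diag_row // sumn_incr_nth; split=> //.
by apply: bead_move_rows => b; rewrite {1}/prow add_diag_row // nth_incr_nth addnC.
Qed.

Lemma bead_move_uniq p d q q' : bead_move p d q -> bead_move p d q' -> q = q'.
Proof.
move=> m m'; apply: bead_inj => d'.
by have := m d'; have := m' d'; case: (bead q d'); case: (bead q' d'); lia.
Qed.

Lemma bead_move_weight p d q : bead_move p d q -> dweight p d = 1.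
Proof.
move=> m; have := m d; have := m (d + 1); rewrite !eqxx.
have -> : (d + 1 == d) = false by lia.
have -> : (d == d + 1) = false by lia.
by rewrite /dweight; do 4 case: bead => /=; lia.
Qed.

Lemma bead_move_add p d q : bead_move p d q -> q = add_diag p d.
Proof.
by move=> m; have [m' _] := add_diagP (bead_move_weight m); apply: bead_move_uniq m m'.
Qed.

(** The shortened row may become empty, so the new partition stops at the first
zero of the new row lengths. *)
Lemma bead_move_rem q d : dweight q d = -1 -> exists p, bead_move p d q.
Proof.
case/dweight_rem => a [e h].
have [h1 h2] := is_partE _ (valP q).
pose r b := (prow q b - (a == b))%N.
have sa : (a < size (val q))%N by rewrite -prow_gt0; lia.
have rS b : (r b.+1 <= r b)%N.
  rewrite /r; have := h1 b; rewrite -!/(prow q _); have [ab|_] := a =P b; last by move=> ?; lia.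
  by subst b; have -> : (a == a.+1) = false; lia.
have r0 b : (size (val q) <= b)%N -> r b = 0%N.
  by rewrite /r; have := prow_gt0 q b; lia.
have exN : exists b, r b == 0%N by exists (size (val q)); rewrite r0.
case: (ex_minnP exN) => N /eqP rN Nm.
have rle b c : (b <= c)%N -> (r c <= r b)%N.
  elim: c => [|c IH]; first by rewrite leqn0 => /eqP ->.
  rewrite leq_eqVlt => /orP [/eqP -> //|]; rewrite ltnS => /IH.
  exact: leq_trans.
have nthr b : nth 0%N (mkseq r N) b = r b.
  case: (ltnP b N) => c; first by rewrite nth_mkseq.
  by rewrite nth_default ?size_mkseq //; have := rle N b c; lia.
have ip : is_part (mkseq r N).
  apply/is_partE; split=> b; rewrite !nthr // size_mkseq => bN.
  by rewrite lt0n; apply/negP => rb; have := Nm b rb; lia.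
exists (exist is_part _ ip).
have pr b : prow (exist is_part _ ip) b = r b by rewrite /prow /= nthr.
have -> : d = (prow (exist is_part _ ip) a)%:Z - a%:Z by rewrite pr /r eqxx; lia.
apply: bead_move_rows => b; rewrite pr /r; have [ab|_] := a =P b; last by lia.
by subst b; lia.
Qed.

Lemma bead_empty d : bead empty_part d = (d <= 0).
Proof.
apply/beadP/idP => [[a <-]|h]; first by rewrite /prow /= nth_nil; lia.
by exists `|d|%N; rewrite /prow /= nth_nil; lia.
Qed.

End Partitions.

(** * Crystals of multipartitions with an order on diagonals *)

(** A position is a component with a diagonal; the shift is to the next
diagonal. *)
Definition shiftp (C : Type) (k : C * int) : C * int := (k.1, k.2 + 1).

(** Invariance under the shift lets one word of positions carry the
letters of two adjacent colours. *)
Record shift_order (C : eqType) (lt : rel (C * int)) : Prop := ShiftOrder {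
  so_irr : irreflexive lt;
  so_trans : transitive lt;
  so_total : forall k q, k != q -> lt k q || lt q k;
  so_shift : forall k q, lt (shiftp k) (shiftp q) = lt k q
}.

Section Fock.
Variables (C : finType) (v : C -> int) (N : nat) (lt : rel (C * int)).
Hypothesis so : shift_order lt.

Local Notation K := (C * int)%type.
Local Notation X := ({ffun C -> part}).
Implicit Types (x y z : X) (k q : K) (s : seq K).

Definition fres k : 'Z_N := (v k.1 + k.2)%:~R.
Definition fweight x k : int := dweight (x k.1) k.2.
Definition fbead x k : int := (bead (x k.1) k.2 : nat)%:Z.
Definition node_count x : nat := (\sum_c sumn (val (x c)))%N.
Definition add_at k x : X := [ffun c => if c == k.1 then add_diag (x c) k.2 else x c].

Definition box (T : nat) : seq K :=
  [seq (c, d%:Z - T%:Z) | c <- enum C, d <- iota 0 (2 * T).+1].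
Definition positions (T : nat) (i : 'Z_N) : seq K :=
  sort (fun k q => (k == q) || lt k q) [seq k <- box T | fres k == i].

Definition fsig (i : 'Z_N) x : seq K := positions (node_count x) i.
Definition fock_f (i : 'Z_N) x : option X :=
  omap (fun k => add_at k x) (good (fweight x) (fsig i x)).
Definition fock_phi (i : 'Z_N) x : nat := phi (fweight x) (fsig i x).
Definition fock_eps (i : 'Z_N) x : nat := eps (fweight x) (fsig i x).

Definition fmove k x y : Prop := forall q,
  fbead y q = fbead x q + (if q == shiftp k then 1 else 0) - (if q == k then 1 else 0).

Lemma shiftp_inj : injective (@shiftp C).
Proof. by move=> [c d] [c' d'] [-> e]; congr (_, _); lia. Qed.

Lemma shiftp_eq k q : (shiftp k == shiftp q) = (k == q).
Proof. exact: inj_eq shiftp_inj _ _. Qed.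

Lemma fweightE x k : fweight x k = fbead x k - fbead x (shiftp k).
Proof. by []. Qed.

Lemma fweight_unit x s : unit_on (fweight x) s.
Proof. by move=> k _; apply: dweight_unit. Qed.

Lemma fweight_unitN x s : unit_on (fun k => - fweight x k) s.
Proof.
move=> k _; case: (dweight_unit (x k.1) k.2) => e; rewrite /fweight e.
- exact: Or33. - exact: Or32. - exact: Or31.
Qed.

Lemma fbead_inj x y : (forall q, fbead x q = fbead y q) -> x = y.
Proof.
move=> e; apply/ffunP => c; apply: bead_inj => d.
by have := e (c, d); rewrite /fbead /=; do 2 case: bead.
Qed.

Lemma sumn_le_node_count x c : (sumn (val (x c)) <= node_count x)%N.
Proof. by rewrite /node_count (bigD1 c) //= leq_addr. Qed.

Lemma fweight_bound x k : fweight x k != 0 -> (`|k.2| <= node_count x)%N.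
Proof. by move/dweight_bound => h; apply: leq_trans h (sumn_le_node_count _ _). Qed.

Lemma fmove_weight k x y : fmove k x y -> forall q,
  fweight y q = fweight x q + (if q == k then -2 else 0) + (if q == shiftp k then 1 else 0)
     + (if shiftp q == k then 1 else 0).
Proof.
move=> m q; rewrite !fweightE !m shiftp_eq.
have [->|n] := q =P k; last by do 2 case: ifP => _; lia.
have -> : (k == shiftp k) = false.
  by apply/negbTE; case: k {m} => c d; rewrite /shiftp xpair_eqE /= eqxx /=; lia.
have -> : (shiftp k == k) = false; last by lia.
by apply/negbTE; case: k {m} => c d; rewrite /shiftp xpair_eqE /= eqxx /=; lia.
Qed.

Lemma fmove_diag k x y : fmove k x y <->
  bead_move (x k.1) k.2 (y k.1) /\ forall c, c != k.1 -> y c = x c.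
Proof.
split=> [m|[m e] [c d]].
  split=> [d|c nc]; first by have := m (k.1, d); rewrite /fbead /shiftp; case: k m => c d' /= _;
    rewrite !xpair_eqE !eqxx.
  apply: bead_inj => d; have := m (c, d); rewrite /fbead /shiftp; case: k m nc => c' d' /= _ nc.
  by rewrite !xpair_eqE (negbTE nc) /=; do 2 case: bead; lia.
rewrite /fbead /shiftp; case: k m e => c' d' /= m e; rewrite !xpair_eqE.
have [-> /=|/eqP nc /=] := c =P c'; first exact: m.
by rewrite e // addr0 subr0.
Qed.

Lemma fmove_add_at k x y : fmove k x y -> y = add_at k x.
Proof.
case/fmove_diag => m e; apply/ffunP => c; rewrite ffunE.
by have [->|/eqP/e] := c =P k.1; first exact: bead_move_add.
Qed.

Lemma add_atP k x : fweight x k = 1 -> fmove k x (add_at k x).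
Proof.
move=> w; apply/fmove_diag; rewrite ffunE eqxx; split; first by case: (add_diagP w).
by move=> c /negbTE nc; rewrite ffunE nc.
Qed.

Lemma fmove_weight1 k x y : fmove k x y -> fweight x k = 1.
Proof. by case/fmove_diag => /bead_move_weight. Qed.

Lemma fmove_rem k y : fweight y k = -1 -> exists x, fmove k x y.
Proof.
case/bead_move_rem => p m; exists [ffun c => if c == k.1 then p else y c].
apply/fmove_diag; rewrite ffunE eqxx; split=> // c /negbTE nc; by rewrite ffunE nc.
Qed.

Lemma fmove_inj k x x' y : fmove k x y -> fmove k x' y -> x = x'.
Proof. by move=> m m'; apply: fbead_inj => q; have := m q; have := m' q; lia. Qed.

Lemma fmove_node_count k x y : fmove k x y -> node_count y = (node_count x).+1.
Proof.
case/fmove_diag => m e; rewrite /node_count (bigD1 k.1) //= [in RHS](bigD1 k.1) //=.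
have [_ h] := add_diagP (bead_move_weight m).
rewrite (bead_move_add m) h addSn; congr (_ + _).+1.
by apply: eq_bigr => c /e ->.
Qed.

Lemma mem_box T k : (k \in box T) = (`|k.2| <= T)%N.
Proof.
apply/allpairsP/idP => [[[c d] [_ hd ->]]|h].
  have {}hd : d \in iota 0 (2 * T).+1 := hd.
  by move: hd; rewrite mem_iota /=; lia.
exists (k.1, absz (k.2 + T%:Z)%R); split.
- by rewrite mem_enum.
- by rewrite mem_iota [(_, _).2]/=; lia.
- by case: k h => c d /= h; congr (_, _); lia.
Qed.

Lemma box_uniq T : uniq (box T).
Proof.
apply: allpairs_uniq; rewrite ?enum_uniq ?iota_uniq //.
by move=> [c d] [c' d'] _ _ [-> e]; congr (_, _); lia.
Qed.

Lemma sort_lt_sorted s : uniq s -> sorted lt (sort (fun k q => (k == q) || lt k q) s).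
Proof.
move=> us; set le := (fun k q : K => _).
have tot : total le.
  by move=> k q; rewrite /le; have [//|/eqP n] := k =P q; case/orP: (so_total so n) => ->;
    rewrite ?orbT.
have := sort_sorted tot s; have : uniq (sort le s) by rewrite sort_uniq.
elim: (sort le s) => //= k s' IH /andP [kn u].
case: s' kn u IH => //= q s'; rewrite inE negb_or => /andP [nkq _] u IH.
case/andP => /orP [/eqP e|-> h]; first by rewrite e eqxx in nkq.
exact: IH.
Qed.

Lemma shift_sorted_uniq s : sorted lt s -> uniq s.
Proof. exact: sorted_uniq (so_trans so) (so_irr so) s. Qed.

Lemma shift_sorted_eq s s' : sorted lt s -> sorted lt s' -> s =i s' -> s = s'.
Proof. exact: irr_sorted_eq (so_trans so) (so_irr so) s s'. Qed.

(** Such a word gives the same surviving letters as the canonical signature of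
every multipartition with at most T nodes, since additional positions have
weight 0.  It allows several multipartitions and two adjacent colours to share
one word. *)
Definition complete (i : 'Z_N) (T : nat) s : Prop :=
  [/\ sorted lt s, {in s, forall k, fres k = i}
    & forall k, fres k = i -> (`|k.2| <= T)%N -> k \in s].

Lemma positions_complete T i : complete i T (positions T i).
Proof.
split; first by apply: sort_lt_sorted; rewrite filter_uniq // box_uniq.
  by move=> k; rewrite mem_sort mem_filter => /andP [/eqP].
by move=> k e kT; rewrite mem_sort mem_filter e eqxx mem_box.
Qed.

Lemma complete_filter i T s x : complete i T s -> (node_count x <= T)%N ->
  [seq k <- s | fweight x k != 0] = [seq k <- fsig i x | fweight x k != 0].
Proof.
move=> [so1 r1 c1] xT; have [so2 r2 c2] := positions_complete (node_count x) i.
apply: shift_sorted_eq; try exact: sorted_filter (so_trans so) _ _ _.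
move=> k; rewrite !mem_filter; case: (boolP (fweight x k != 0)) => //= /fweight_bound kb.
apply/idP/idP => [/r1 e|/r2 e]; first exact: c2.
by apply: c1 => //; apply: leq_trans xT.
Qed.

Lemma complete_adds i T s x : complete i T s -> (node_count x <= T)%N ->
  free_adds (fweight x) s = free_adds (fweight x) (fsig i x).
Proof.
by move=> cs xT; rewrite free_adds_filter (complete_filter cs xT) -free_adds_filter.
Qed.

Lemma complete_coadds i T s x : complete i T s -> (node_count x <= T)%N ->
  free_adds (fun k => - fweight x k) (rev s) = free_adds (fun k => - fweight x k) (rev (fsig i
    x)).
Proof.
move=> cs xT; rewrite free_adds_filter [RHS]free_adds_filter; congr free_adds.
have e : (fun k => - fweight x k != 0) =1 (fun k => fweight x k != 0).
  by move=> k; rewrite oppr_eq0.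
by rewrite !(eq_filter e) !filter_rev (complete_filter cs xT).
Qed.

Lemma complete_phi i T s x : complete i T s -> (node_count x <= T)%N ->
  fock_phi i x = phi (fweight x) s.
Proof. by move=> cs xT; rewrite /fock_phi /phi -(complete_adds cs xT). Qed.

Lemma complete_eps i T s x : complete i T s -> (node_count x <= T)%N ->
  fock_eps i x = eps (fweight x) s.
Proof. by move=> cs xT; rewrite /fock_eps /eps /phi -(complete_coadds cs xT). Qed.

Lemma complete_f i T s x y : complete i T s -> (node_count x <= T)%N ->
  fock_f i x = Some y <-> good_move s fweight fmove x y.
Proof.
move=> cs xT; have [ss _ _] := cs; have us := shift_sorted_uniq ss.
rewrite /fock_f /good -(complete_adds cs xT) -/(good _ _); split.
  case g: good => [k|] //= [<-]; exists k; split=> //.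
    by have [] := good_firstmax (@fweight_unit x s) us g.
  by apply: add_atP; apply: good_weight g => //; apply: fweight_unit.
by case=> k [ks -> m] /=; rewrite -(fmove_add_at m).
Qed.

Lemma fres_shiftp k : fres (shiftp k) = fres k + 1.
Proof. by rewrite /fres /shiftp /= addrA rmorphD. Qed.

Lemma shiftp_neq k q : fres k = fres q -> (k == shiftp q) = false.
Proof.
move=> e; apply/eqP => kq; have := fres_shiftp q; rewrite -kq e => /eqP.
by rewrite -subr_eq0 opprD addrA subrr sub0r oppr_eq0 oner_eq0.
Qed.

Lemma fmove_same_colour k x y q : fmove k x y -> fres q = fres k ->
  fweight y q = fweight x q + (if q == k then -2 else 0).
Proof.
move=> m e; rewrite (fmove_weight m) (shiftp_neq e) [shiftp q == k]eq_sym shiftp_neq //.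
by rewrite !addr0.
Qed.

(** Mirror image of [complete_f], through [good_toggle]. *)
Lemma complete_e i T s x y : complete i T s -> (node_count x <= T)%N ->
  fock_f i y = Some x <->
  good_move (rev s) (fun x k => - fweight x k) (fun k x y => fmove k y x) x y.
Proof.
move=> cs xT; have [ss rs cc] := cs; have us := shift_sorted_uniq ss.
have usr : uniq (rev s) by rewrite rev_uniq.
have tg k a b (m : fmove k a b) : k \in s -> {in s, forall q, fweight b q = fweight a q + (if q
  == k then -2 else 0)}.
  by move=> ks q qs; apply: fmove_same_colour m _; rewrite (rs q qs) (rs k ks).
split.
  move=> fy; have [k [ks g m]] : good_move s fweight fmove y x.
    have yT : (node_count y < node_count x)%N.
      have [k [_ _ m]] := (complete_f x (positions_complete (node_count y) i) (leqnn _)).1 fy.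
      by rewrite (fmove_node_count m).
    by apply/(complete_f x cs) => //; lia.
  exists k; rewrite mem_rev; split=> //.
  by have [] := good_toggle (@fweight_unit y s) (@fweight_unit x s) us g (tg _ _ _ m ks).
case=> k; rewrite mem_rev => -[ks g m].
have yT : (node_count y <= T)%N by have := fmove_node_count m; lia.
apply/(complete_f x cs) => //; exists k; split=> //.
have tg' : {in rev s, forall q, - fweight y q = - fweight x q + (if q == k then -2 else 0)}.
  by move=> q; rewrite mem_rev => /(tg _ _ _ m ks) ->; case: ifP; lia.
have [] := good_toggle (@fweight_unitN x (rev s)) (@fweight_unitN y (rev s)) usr g tg'.
rewrite /cogood revK => <- _ _; rewrite /good; congr (ohead (rev _)).
by apply: free_adds_ext => q _; rewrite opprK.
Qed.

End Fock.

(** * Strings and weights *)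

(** The Cartan matrix of the cyclic quiver with N vertices, when N is at least
three. *)
Definition cartan (N : nat) (i j : 'Z_N) : int :=
  (if j == i then 2 else 0) - (if j == i + 1 then 1 else 0) - (if j + 1 == i then 1 else 0).

Lemma good_map (T U : eqType) (f : T -> U) w s :
  good w (map f s) = omap f (good (w \o f) s).
Proof. by rewrite /good free_adds_map -map_rev; case: (rev _). Qed.

Lemma free_adds_sub (T : eqType) (w : T -> int) s : {subset free_adds w s <= s}.
Proof.
elim: s => //= x s IH y; rewrite inE; case: ifP => _.
  by rewrite inE => /orP [->|/IH ->]; rewrite ?orbT.
by case: ifP => _; [move/mem_behead|]; move/IH => ->; rewrite orbT.
Qed.

Lemma good_mem (T : eqType) (w : T -> int) s x : good w s = Some x -> x \in s.
Proof.
rewrite /good => e; apply: (@free_adds_sub _ w); rewrite -mem_rev.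
by move: e; case: (rev _) => //= a r [<-]; rewrite mem_head.
Qed.

Lemma good_move_map (K : eqType) (X : Type) (f : K -> K) (s : seq K) (W : X -> K -> int) mv x y :
  good_move (map f s) W mv x y <->
  good_move s (fun x k => W x (f k)) (fun k => mv (f k)) x y.
Proof.
rewrite /good_move; split=> [[k [_]]|[k [ks g m]]]; last first.
  by exists (f k); rewrite map_f // good_map; split=> //; rewrite /comp g.
rewrite good_map; case g: good => [q|] //= [<-] m; exists q; split=> //.
exact: good_mem g.
Qed.

Section FockStembridge.
Variables (C : finType) (v : C -> int) (N : nat) (lt : rel (C * int)).
Hypothesis so : shift_order lt.

Local Notation K := (C * int)%type.
Local Notation X := ({ffun C -> part}).
Local Notation f := (fock_f v lt).
Local Notation ph := (fock_phi v lt).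
Local Notation ep := (fock_eps v lt).
Local Notation pos := (@positions C v N lt).
Local Notation cmp := (@complete C v N lt).
Implicit Types (x y z : X) (k q : K) (s : seq K) (i j : 'Z_N).

Lemma sorted_complete i T s : cmp i T s -> uniq s.
Proof. case=> h _ _. exact: (shift_sorted_uniq so h). Qed.

Lemma complete_shift i T s : cmp i T.+1 s -> cmp (i + 1) T (map (@shiftp C) s).
Proof.
case=> ss rs cs; split.
- rewrite sorted_map; apply: sub_sorted ss => k q; by rewrite /= (so_shift so).
- by move=> k /mapP [q qs ->]; rewrite fres_shiftp rs.
move=> [c d] e dT; apply/mapP; exists (c, d - 1); last by congr (_, _) => /=; lia.
apply: cs; last by move: dT => /=; lia.
apply: (addIr 1); rewrite -fres_shiftp -e; congr (fres _ _ (_, _)) => /=; lia.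
Qed.

Lemma complete_weaken i T s : cmp i T.+1 s -> cmp i T s.
Proof. by case=> ? ? cs; split=> // k e kT; apply: cs => //; apply: leqW. Qed.

Lemma fock_f_phi i x : isSome (f i x) = (0 < ph i x)%N.
Proof. by rewrite /fock_f /fock_phi -good_phi; case: good. Qed.

Lemma fock_f_move i x y : f i x = Some y -> exists k, [/\ fres v N k = i & fmove k x y].
Proof.
move/(complete_f so y (positions_complete v so (node_count x) i) (leqnn _)) => [k [ks _ m]].
by exists k; split=> //; case: (positions_complete v so (node_count x) i) => _ h _; apply: h.
Qed.

Lemma fock_f_node_count i x y : f i x = Some y -> node_count y = (node_count x).+1.
Proof. by case/fock_f_move => k [_ /fmove_node_count]. Qed.

Lemma fock_eps_gt0 i x : (0 < ep i x)%N <-> exists y, f i y = Some x.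
Proof.
have cs := positions_complete v so (node_count x) i.
rewrite /fock_eps /eps -good_phi; split.
  case g: good => [k|] // _.
  have ks := good_mem g; have := good_weight (@fweight_unitN _ x _) _ g.
  rewrite rev_uniq (sorted_complete cs) => /(_ isT) w1.
  have [y m] : exists y, fmove k y x by apply: fmove_rem; lia.
  by exists y; apply/(complete_e so y cs (leqnn _)); exists k.
by case=> y /(complete_e so y cs (leqnn _)) [k [_ -> _]].
Qed.

Lemma fock_epsS i x y : f i x = Some y -> ep i y = (ep i x).+1.
Proof.
move=> fx; have yx := fock_f_node_count fx.
have cs := positions_complete v so (node_count y) i.
have xT : (node_count x <= node_count y)%N by rewrite yx.
rewrite (complete_eps so cs xT) (complete_eps so cs (leqnn _)).
have [k [ks g m]] := (complete_f so y cs xT).1 fx.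
have [_ rs _] := cs.
have tg : {in pos (node_count y) i, forall q, fweight y q = fweight x q + (if q == k then -2
  else 0)}.
  by move=> q qs; apply: (@fmove_same_colour _ v N _ _ _ _ m); rewrite (rs q qs) (rs k ks).
by have [] := good_toggle (@fweight_unit _ x _) (@fweight_unit _ y _) (sorted_complete cs) g tg.
Qed.

(** The difference of string lengths is the sum of all weights of the colour, and
a new node on diagonal d changes the weights on d - 1, d and d + 1 only. *)
Lemma fock_weight i x y j : f i x = Some y ->
  (ph j y)%:Z - (ep j y)%:Z = (ph j x)%:Z - (ep j x)%:Z - cartan i j.
Proof.
move=> fx; have yx := fock_f_node_count fx.
have [k [kr m]] := fock_f_move fx.
have cs := positions_complete v so (node_count y).+1 j.
have xT : (node_count x <= (node_count y).+1)%N by lia.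
have yT : (node_count y <= (node_count y).+1)%N by lia.
rewrite (complete_eps so cs xT) (complete_eps so cs yT) (complete_phi so cs xT)
  (complete_phi so cs yT) !phi_eps; try exact: fweight_unit.
have kb : (`|k.2| <= node_count x)%N.
  by apply: fweight_bound; rewrite (fmove_weight1 m).
have us := sorted_complete cs; have [_ rs cc] := cs.
have one q (a : int) : (`|q.2| <= (node_count y).+1)%N ->
    \sum_(r <- pos (node_count y).+1 j) (if r == q then a else 0) = if fres v N q == j then a
      else 0.
  move=> qb; rewrite -big_mkcond /= -big_filter.
  have [e|/eqP e] := fres v N q =P j.
    by rewrite (filter_pred1_uniq us) ?big_seq1 //; apply: cc.
  rewrite (_ : [seq _ <- _ | _] = [::]) ?big_nil //.
  apply/eqP; rewrite -[_ == _]negbK -has_filter; apply/hasPn => r rin.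
  by apply: contra e => /eqP <-; rewrite rs.
pose k' : K := (k.1, k.2 - 1).
have kk : shiftp k' = k by rewrite /shiftp /k' /= subrK -surjective_pairing.
have e r : fweight y r = fweight x r + (if r == k then -2 else 0)
    + (if r == shiftp k then 1 else 0) + (if r == k' then 1 else 0).
  by rewrite (fmove_weight m) -(shiftp_eq r k') kk.
rewrite (eq_bigr _ (fun r _ => e r)) !big_split /= !one; try by move: kb; rewrite /=; lia.
rewrite fres_shiftp kr /cartan.
have -> : (fres v N k' == j) = (j + 1 == i).
  by rewrite -kr -kk fres_shiftp (inj_eq (addIr 1)) eq_sym.
rewrite [i == j]eq_sym [i + 1 == j]eq_sym.
by do 3 case: ifP => _; lia.
Qed.

Lemma fock_inj i x y z : f i x = Some z -> f i y = Some z -> x = y.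
Proof.
have cs := positions_complete v so (node_count z) i.
move=> /(complete_e so x cs (leqnn _)) [k [_ g m]] /(complete_e so y cs (leqnn _)) [k' [_ g' m']].
by move: g m; rewrite g' => -[<-]; move/fmove_inj; apply.
Qed.

End FockStembridge.

(** * Stembridge's axioms for at least three colours *)

Section FockLocal.
Variables (C : finType) (v : C -> int) (N : nat) (lt : rel (C * int)).
Hypothesis so : shift_order lt.
Hypothesis N3 : (2 < N)%N.

Local Notation K := (C * int)%type.
Local Notation X := ({ffun C -> part}).
Local Notation f := (fock_f v lt).
Local Notation ph := (fock_phi v lt).
Local Notation ep := (fock_eps v lt).
Local Notation cmp := (@complete C v N lt).
Implicit Types (x y z : X) (k q : K) (s : seq K) (i j : 'Z_N).

Local Notation W1 := (@fweight C).
Local Notation W2 := (fun x k => fweight x (shiftp k)).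
Local Notation mv1 := (@fmove C).
Local Notation mv2 := (fun k => fmove (C := C) (shiftp k)).
Local Notation nW1 := (fun x k => - fweight x k).
Local Notation nW2 := (fun x k => - fweight x (shiftp k)).
Local Notation nmv1 := (fun k x y => fmove (C := C) k y x).
Local Notation nmv2 := (fun k x y => fmove (C := C) (shiftp k) y x).

Definition move_delta k q : int := (if q == shiftp k then 1 else 0) - (if q == k then 1 else 0).

Lemma fmove_delta k x y : fmove k x y -> forall q, fbead y q = fbead x q + move_delta k q.
Proof. by move=> m q; rewrite m /move_delta addrA. Qed.

Lemma two_neq0 : (2%:R == 0 :> 'Z_N) = false.
Proof.
apply/negbTE/eqP => e; have : nat_of_ord (2%:R : 'Z_N) = 0%N by rewrite e.
by rewrite val_Zp_nat ?modn_small //; lia.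
Qed.

Lemma shiftp2_neq k q : fres v N k = fres v N q -> (k == shiftp (shiftp q)) = false.
Proof.
move=> e; apply/eqP => kq; have := fres_shiftp v N (shiftp q); rewrite -kq fres_shiftp e => /eqP.
by rewrite -subr_eq0 -addrA opprD addrA subrr sub0r oppr_eq0 two_neq0.
Qed.

Section Colour.
Variables (i : 'Z_N) (s : seq K).
Hypothesis sres : {in s, forall k, fres v N k = i}.

Lemma colour_toggles k x y q : k \in s -> q \in s -> fmove k x y ->
  fweight y q = fweight x q + (if q == k then -2 else 0) /\
  fweight y (shiftp q) = fweight x (shiftp q) + (if q == k then 1 else 0).
Proof.
move=> ks qs m; have e : fres v N q = fres v N k by rewrite !sres.
rewrite !(fmove_weight m) shiftp_eq (shiftp_neq e) [shiftp q == k]eq_sym (shiftp_neq (esym e)).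
by rewrite [shiftp _ == k]eq_sym (shiftp2_neq (esym e)) !addr0.
Qed.

Lemma next_colour_toggles k x y q : k \in s -> q \in s -> fmove (shiftp k) x y ->
  fweight y (shiftp q) = fweight x (shiftp q) + (if q == k then -2 else 0) /\
  fweight y q = fweight x q + (if q == k then 1 else 0).
Proof.
move=> ks qs m; have e : fres v N q = fres v N k by rewrite !sres.
rewrite !(fmove_weight m) !shiftp_eq (shiftp_neq e) (shiftp2_neq e).
by rewrite [shiftp q == k]eq_sym (shiftp_neq (esym e)) !addr0.
Qed.
End Colour.

(** The weights of consecutive diagonals share the bead between them. *)
Lemma fweight_noAA x k : fweight x k = 1 -> fweight x (shiftp k) <> 1.
Proof. by rewrite !fweightE /fbead; do 3 case: bead. Qed.

Lemma fweight_noRR x k : - fweight x k = 1 -> - fweight x (shiftp k) <> 1.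
Proof. by rewrite !fweightE /fbead; do 3 case: bead. Qed.

Lemma shift_unit x s : unit_on (fun k => fweight x (shiftp k)) s.
Proof. by move=> k _; apply: (@fweight_unit _ x [:: shiftp k]); rewrite mem_head. Qed.

Lemma shift_unitN x s : unit_on (fun k => - fweight x (shiftp k)) s.
Proof. by move=> k _; apply: (@fweight_unitN _ x [:: shiftp k]); rewrite mem_head. Qed.

(** The positions of colour i + 1 are the shifts of those of colour i, so one word
carries both colours; with at least three colours a move of one of them
affects no further letter of this word. *)
Lemma adjacent_f i z y1 y2 : f i z = Some y1 -> f (i + 1) z = Some y2 ->
  (exists2 x, f (i + 1) y1 = Some x /\ f i y2 = Some x &
       ph (i + 1) y1 = ph (i + 1) z \/ ph i y2 = ph i z) \/
    [/\ (ph (i + 1)%R z < ph (i + 1)%R y1)%N, (ph i z < ph i y2)%N,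
      ~ (exists x, f (i + 1) y1 = Some x /\ f i y2 = Some x)
      & exists a b c d x, [/\ f (i + 1) y1 = Some a, f (i + 1) a = Some b & f i b = Some x] /\
          [/\ f i y2 = Some c, f i c = Some d & f (i + 1) d = Some x]].
Proof.
move=> fy1 fy2; set T := (node_count z + 5)%N.
have cs0 := positions_complete v so T.+1 i; set s := positions _ _ _ _ in cs0.
have cs1 := complete_weaken cs0; have cs2 := complete_shift so cs0.
have us := sorted_complete so cs0; have [_ rs _] := cs0.
have F1 x y : (node_count x <= T)%N -> f i x = Some y <-> good_move s W1 mv1 x y.
  by move=> xT; apply: (complete_f so y cs1 xT).
have F2 x y : (node_count x <= T)%N -> f (i + 1) x = Some y <-> good_move s W2 mv2 x y.
  by move=> xT; rewrite -good_move_map; apply: (complete_f so y cs2 xT).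
have P1 x : (node_count x <= T)%N -> ph i x = phi (W1 x) s by move=> xT; apply: (complete_phi so
  cs1 xT).
have P2 x : (node_count x <= T)%N -> ph (i + 1) x = phi (W2 x) s.
  move=> xT; rewrite (complete_phi so cs2 xT) /phi free_adds_map size_map.
  by congr size; apply: free_adds_ext.
have R1 x y : good_move s W1 mv1 x y -> node_count y = (node_count x).+1 by case=> k [_ _
  /fmove_node_count].
have R2 x y : good_move s W2 mv2 x y -> node_count y = (node_count x).+1 by case=> k [_ _
  /fmove_node_count].
have zT : (node_count z <= T)%N by lia.
have tg1 : toggles s W1 W2 mv1 by move=> k x y ks m q qs; apply: (colour_toggles rs).
have tg2 : toggles s W2 W1 mv2 by move=> k x y ks m q qs; apply: (next_colour_toggles rs).
have g1 := (F1 _ _ zT).1 fy1; have g2 := (F2 _ _ zT).1 fy2.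
have r1 := R1 _ _ g1; have r2 := R2 _ _ g2.
have y1T : (node_count y1 <= T)%N by lia.
have y2T : (node_count y2 <= T)%N by lia.
have := local_moves us (fun x => @fweight_unit _ x s) (fun x => @shift_unit x s)
   (fun x k _ => @fweight_noAA x k) tg1 tg2
   (fun x k _ h => ex_intro _ _ (add_atP h)) (fun x k _ h => ex_intro _ _ (add_atP h))
   fmove_delta (fun k => @fmove_delta (shiftp k)) (@fbead_inj C) g1 g2.
rewrite -!P1 // -!P2 //.
case=> [[x [h1 h2] h]|[h1 h2 h3 [a [b [c [d [x [[a1 a2 a3] [b1 b2 b3]]]]]]]]].
  by left; exists x => //; split; [apply/F2 | apply/F1].
have := (R2 _ _ a1, R2 _ _ a2, R1 _ _ b1, R1 _ _ b2) => -[[[q1 q2] q3] q4].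
right; split=> //.
  by case=> u [/F2 u1 /F1 u2]; apply: h3; exists u; split; [apply: u1|apply: u2].
exists a, b, c, d, x; split; split; first [apply/F1 | apply/F2] => //; lia.
Qed.

Lemma adjacent_e i x y1 y2 : f i y1 = Some x -> f (i + 1) y2 = Some x ->
    (exists z, f (i + 1) z = Some y1 /\ f i z = Some y2) \/
    (exists a b c d z,
      [/\ f i z = Some a, f (i + 1) a = Some b & f (i + 1) b = Some y1] /\
      [/\ f (i + 1) z = Some c, f i c = Some d & f i d = Some y2]).
Proof.
move=> fy1 fy2; set T := (node_count x + 5)%N.
have cs0 := positions_complete v so T.+1 i; set s := positions _ _ _ _ in cs0.
have cs1 := complete_weaken cs0; have cs2 := complete_shift so cs0.
have us := sorted_complete so cs0; have [_ rs _] := cs0.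
have usr : uniq (rev s) by rewrite rev_uniq.
have F1 z y : (node_count z <= T)%N -> f i y = Some z <-> good_move (rev s) nW1 nmv1 z y.
  by move=> xT; apply: (complete_e so y cs1 xT).
have F2 z y : (node_count z <= T)%N -> f (i + 1) y = Some z <-> good_move (rev s) nW2 nmv2 z y.
  move=> xT; rewrite (complete_e so y cs2 xT) -map_rev.
  exact: good_move_map.
have R1 z y : good_move (rev s) nW1 nmv1 z y -> node_count z = (node_count y).+1 by case=> k [_
  _ /fmove_node_count].
have R2 z y : good_move (rev s) nW2 nmv2 z y -> node_count z = (node_count y).+1 by case=> k [_
  _ /fmove_node_count].
have xT : (node_count x <= T)%N by lia.
have tg1 : toggles (rev s) nW1 nW2 nmv1.
  move=> k z y; rewrite mem_rev => ks m q; rewrite mem_rev => qs.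
  by have [-> ->] := colour_toggles rs ks qs m; case: ifP; lia.
have tg2 : toggles (rev s) nW2 nW1 nmv2.
  move=> k z y; rewrite mem_rev => ks m q; rewrite mem_rev => qs.
  by have [-> ->] := next_colour_toggles rs ks qs m; case: ifP; lia.
have g1 := (F1 _ _ xT).1 fy1; have g2 := (F2 _ _ xT).1 fy2.
have dl k z y : fmove k y z -> forall q, fbead y q = fbead z q + - move_delta k q.
  by move=> /fmove_delta m q; rewrite m addrK.
have ex k z : - fweight z k = 1 -> exists y, fmove k y z by move=> h; apply: fmove_rem; lia.
have := local_moves usr (fun x => @fweight_unitN _ x _) (fun x => @shift_unitN x _)
   (fun x k _ => @fweight_noRR x k) tg1 tg2
   (fun x k _ h => ex k x h) (fun x k _ h => ex _ x h)
   dl (fun k => dl (shiftp k)) (@fbead_inj C) g1 g2.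
have r1 := R1 _ _ g1; have r2 := R2 _ _ g2.
case=> [[z [h1 h2] _]|[_ _ _ [a [b [c [d [z [[a1 a2 a3] [b1 b2 b3]]]]]]]]].
  by left; exists z; split; [apply/F2 | apply/F1] => //; lia.
right; exists b, a, d, c, z.
have := (R2 _ _ a1, R2 _ _ a2, R1 _ _ b1, R1 _ _ b2) => -[[[q1 q2] q3] q4].
split; split; first [apply/F1 | apply/F2] => //; lia.
Qed.

(** A new node changes no weight of a colour that is neither equal nor adjacent to
its own. *)
Lemma far_weight i j k x y q : j != i + 1 -> i != j + 1 -> i != j ->
  fres v N k = i -> fres v N q = j -> fmove k x y -> fweight y q = fweight x q.
Proof.
move=> n1 n2 n3 ek eq m; rewrite (fmove_weight m).
rewrite !ifF ?addr0 //; apply/eqP => h; [move: n2 | move: n1 | move: n3].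
- by rewrite -ek -eq -h fres_shiftp eqxx.
- by rewrite -ek -eq h fres_shiftp eqxx.
- by rewrite -ek -eq h eqxx.
Qed.

Lemma far_adds i j x y T : j != i + 1 -> i != j + 1 -> i != j -> f i x = Some y ->
  free_adds (fweight y) (positions v lt T j) = free_adds (fweight x) (positions v lt T j) /\
  free_adds (fun k => - fweight y k) (rev (positions v lt T j)) =
  free_adds (fun k => - fweight x k) (rev (positions v lt T j)).
Proof.
move=> n1 n2 n3 /(fock_f_move so) [k [kr m]].
have [_ rs _] := positions_complete v so T j.
split; apply: free_adds_ext => q qs; last rewrite mem_rev in qs; rewrite ?(far_weight n1 n2 n3
  kr _ m) ?rs //.
Qed.

Lemma far_f i j z y1 y2 : j != i + 1 -> i != j + 1 -> i != j ->
  f i z = Some y1 -> f j z = Some y2 ->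
  exists2 x, f j y1 = Some x /\ f i y2 = Some x &
       ph j y1 = ph j z \/ ph i y2 = ph i z.
Proof.
move=> n1 n2 n3 f1 f2; set T := (node_count z + 1)%N.
have c1 := positions_complete v so T i; have c2 := positions_complete v so T j.
have zT : (node_count z <= T)%N by lia.
have y1T : (node_count y1 <= T)%N by rewrite (fock_f_node_count so f1); lia.
have y2T : (node_count y2 <= T)%N by rewrite (fock_f_node_count so f2); lia.
have n3' : j != i by rewrite eq_sym.
have [a1 _] := far_adds T n1 n2 n3 f1; have [a2 _] := far_adds T n2 n1 n3' f2.
have [k1 [ks1 g1 m1]] := (complete_f so y1 c1 zT).1 f1.
have [k2 [ks2 g2 m2]] := (complete_f so y2 c2 zT).1 f2.
have g1' : good (fweight y2) (positions v lt T i) = Some k1 by rewrite /good a2.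
have g2' : good (fweight y1) (positions v lt T j) = Some k2 by rewrite /good a1.
have x1 := add_atP (good_weight (@fweight_unit _ _ _) (sorted_complete so c1) g1').
have x2 := add_atP (good_weight (@fweight_unit _ _ _) (sorted_complete so c2) g2').
have e : add_at k2 y1 = add_at k1 y2.
  apply: fbead_inj => q; rewrite (fmove_delta x1) (fmove_delta x2) (fmove_delta m1) (fmove_delta
    m2).
  by rewrite addrAC.
exists (add_at k2 y1).
  split; [apply/(complete_f so _ c2 y1T) | apply/(complete_f so _ c1 y2T)].
    by exists k2.
  by exists k1; rewrite e.
by left; rewrite (complete_phi so c2 y1T) (complete_phi so c2 zT) /phi a1.
Qed.

Lemma far_e i j x y1 y2 : j != i + 1 -> i != j + 1 -> i != j ->
  f i y1 = Some x -> f j y2 = Some x -> exists z, f j z = Some y1 /\ f i z = Some y2.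
Proof.
move=> n1 n2 n3 f1 f2; set T := node_count x.
have c1 := positions_complete v so T i; have c2 := positions_complete v so T j.
have y1T : (node_count y1 <= T)%N by rewrite /T (fock_f_node_count so f1).
have y2T : (node_count y2 <= T)%N by rewrite /T (fock_f_node_count so f2).
have n3' : j != i by rewrite eq_sym.
have [_ a1] := far_adds T n1 n2 n3 f1; have [_ a2] := far_adds T n2 n1 n3' f2.
have [k1 [ks1 g1 m1]] := (complete_e so y1 c1 (leqnn _)).1 f1.
have [k2 [ks2 g2 m2]] := (complete_e so y2 c2 (leqnn _)).1 f2.
have g1' : good (fun k => - fweight y2 k) (rev (positions v lt T i)) = Some k1.
  by rewrite /good -a2.
have g2' : good (fun k => - fweight y1 k) (rev (positions v lt T j)) = Some k2.
  by rewrite /good -a1.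
have us1 := sorted_complete so c1; have us2 := sorted_complete so c2.
have [z1 x1] : exists z, fmove k1 z y2.
  apply: fmove_rem; have := good_weight (@fweight_unitN _ y2 _) _ g1'.
  by rewrite rev_uniq => /(_ us1); lia.
have [z2 x2] : exists z, fmove k2 z y1.
  apply: fmove_rem; have := good_weight (@fweight_unitN _ y1 _) _ g2'.
  by rewrite rev_uniq => /(_ us2); lia.
have e : z1 = z2.
  apply: fbead_inj => q; have := fmove_delta x1 q; have := fmove_delta x2 q.
  by have := fmove_delta m1 q; have := fmove_delta m2 q; lia.
exists z1; split; [apply/(complete_e so _ c2 y1T) | apply/(complete_e so _ c1 y2T)].
  by exists k2; rewrite e.
by exists k1.
Qed.

Theorem fock_stembridge : stembridge (@cartan N) f ep ph.
Proof.
split.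
- exact: fock_f_phi.
- exact: fock_eps_gt0.
- exact: fock_epsS.
- by move=> i x y fx j; apply: fock_weight.
- exact: fock_inj.
- move=> i j z y1 y2 nij f1 f2; have [ej|n1] := eqVneq j (i + 1).
    by subst j; apply: adjacent_f.
  have [ei|n2] := eqVneq i (j + 1).
    subst i; case: (adjacent_f f2 f1) => [[x [x1 x2] h]|[h1 h2 h3 [a [b [c [d [x [h4 h5]]]]]]]].
      by left; exists x => //; case: h; [right|left].
    right; split=> //; first by case=> u [u1 u2]; apply: h3; exists u.
    by exists c, d, a, b, x.
  by left; apply: far_f n1 n2 nij f1 f2.
- move=> i j x y1 y2 nij f1 f2; have [ej|n1] := eqVneq j (i + 1).
    by subst j; apply: adjacent_e f1 f2.
  have [ei|n2] := eqVneq i (j + 1).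
    subst i; case: (adjacent_e f2 f1) => [[z [z1 z2]]|[a [b [c [d [z [h4 h5]]]]]]].
      by left; exists z.
    by right; exists c, d, a, b, z.
  by left; apply: far_e n1 n2 nij f1 f2.
Qed.

End FockLocal.

(** * Doubling the number of colours *)

Lemma Zp_intr_eq0 (N : nat) (m : int) : (1 < N)%N ->
  (m%:~R = 0 :> 'Z_N) <-> exists q : int, m = q * N%:Z.
Proof.
move=> N1.
have N0 : (N%:Z%:~R = 0 :> 'Z_N) by rewrite -pmulrn char_Zp.
split=> [e|[q ->]]; last by rewrite rmorphM /= N0 mulr0.
exists (m %/ N%:Z)%Z; rewrite {1}(divz_eq m N%:Z).
suff -> : (m %% N%:Z)%Z = 0 by rewrite addr0.
have r0 : (0 <= m %% N%:Z)%Z by apply: modz_ge0; lia.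
have rN : (m %% N%:Z < N%:Z)%Z by apply: ltz_pmod; lia.
move: e; rewrite {1}(divz_eq m N%:Z) rmorphD rmorphM /= N0 mulr0 add0r.
case: (m %% N%:Z)%Z r0 rN => // r _ rN; rewrite -pmulrn => e.
have : nat_of_ord (r%:R : 'Z_N) = 0%N by rewrite e.
by rewrite val_Zp_nat // modn_small // => ->.
Qed.

Lemma Zp_intr_eq (N : nat) (m n : int) : (1 < N)%N ->
  (m%:~R = n%:~R :> 'Z_N) <-> exists q : int, m = n + q * N%:Z.
Proof.
move=> N1; have h := Zp_intr_eq0 (m - n) N1; split=> [e|[q e]].
  have e0 : (m - n)%:~R = 0 :> 'Z_N by rewrite rmorphB /= e subrr.
  by have [q eq] := h.1 e0; exists q; lia.
have : (m - n)%:~R = 0 :> 'Z_N by apply/h; exists q; lia.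
by rewrite rmorphB /= => /eqP; rewrite subr_eq0 => /eqP.
Qed.

Lemma Zp_intr_val (N : nat) (i : 'Z_N) : (nat_of_ord i)%:Z%:~R = i.
Proof. by rewrite -pmulrn natr_Zp. Qed.

Section Doubling.
Variables (C : finType) (v : C -> int) (e : nat) (lt : rel (C * int)).
Hypothesis so : shift_order lt.
Hypothesis e1 : (1 < e)%N.

Local Notation K := (C * int)%type.
Local Notation X := ({ffun C -> part}).
Local Notation C2 := (C * bool)%type.
Local Notation K2 := (C2 * int)%type.
Local Notation X2 := ({ffun C2 -> part}).

(** The second copy of each component has its charge shifted by e, so the two
copies of a node have the two colours modulo 2e above its colour modulo e. *)
Definition charge2 (cb : C2) : int := v cb.1 + (if cb.2 then e%:Z else 0).
Definition forget (k : K2) : K := (k.1.1, k.2).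
(** Two positions of the same colour that forget to the same position are equal,
so among the positions of one colour this is the given order; the comparison
of the copies only makes it total. *)
Definition order2 : rel K2 := fun k q =>
  lt (forget k) (forget q) || ((forget k == forget q) && (~~ k.1.2 && q.1.2)).
Definition doubled (x : X) : X2 := [ffun cb => x cb.1].

Lemma order2_shift : shift_order order2.
Proof.
have fs k : forget (shiftp k) = shiftp (forget k) by [].
split.
- by move=> k; rewrite /order2 (so_irr so) andNb andbF.
- move=> q k r; rewrite /order2 => /orP [h1|/andP [/eqP h1 b1]] /orP [h2|/andP [/eqP h2 b2]].
  + by rewrite (so_trans so h1 h2).
  + by rewrite -h2 h1.
  + by rewrite h1 h2.
  + by case/andP: b1 b2 => _ ->.
- move=> k q n; rewrite /order2.
  have [ef|nf] := eqVneq (forget k) (forget q).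
    rewrite !ef (so_irr so) /=.
    move: n ef; case: k => [[c b] d]; case: q => [[c' b'] d'] /= n [ec ed].
    by move: n; rewrite ec ed; case: b; case: b' => //; rewrite eqxx.
  by case/orP: (so_total so nf) => ->; rewrite ?orbT.
- by move=> k q; rewrite /order2 !fs (so_shift so) (inj_eq (@shiftp_inj C)).
Qed.

(** Congruence modulo e between a colour modulo e and one modulo 2e. *)
Definition colour_over (i : 'Z_e) (j : 'Z_(2 * e)) : Prop :=
  exists q : int, i = q%:~R /\ j = q%:~R.

Local Notation E := (e%:R : 'Z_(2 * e)).
Local Notation r2 := (fres charge2 (2 * e)).
Local Notation r1 := (fres v e).

Let e2 : (1 < 2 * e)%N. Proof. by lia. Qed.

Lemma over_lift i : colour_over i (nat_of_ord i)%:R.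
Proof. by exists (nat_of_ord i)%:Z; rewrite Zp_intr_val -pmulrn. Qed.

Lemma over_exists j : exists i, colour_over i j.
Proof. by exists (nat_of_ord j)%:R; exists (nat_of_ord j)%:Z; rewrite Zp_intr_val -pmulrn. Qed.

Lemma over_add i j : colour_over i j -> colour_over i (j + E).
Proof.
case=> q [-> ->]; exists (q + e%:Z); rewrite !rmorphD /= -!pmulrn char_Zp // addr0.
by split.
Qed.

Lemma over_opp i j : colour_over i j -> colour_over (- i) (- j).
Proof. by case=> q [-> ->]; exists (- q); rewrite !rmorphN. Qed.

Lemma half_sum : E + E = 0.
Proof. by rewrite -natrD addnn -mul2n char_Zp. Qed.

Lemma forget_colour k i j : colour_over i j -> r2 k = j -> r1 (forget k) = i.
Proof.
case=> q [-> ->]; rewrite /fres /charge2 => /(Zp_intr_eq _ _ e2) [t et].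
apply/(Zp_intr_eq _ _ e1); exists (2 * t - (if k.1.2 then 1 else 0)); move: et; rewrite /forget
  /=.
by case: ifP => _; lia.
Qed.

Lemma lift_colour (k : K) i j : colour_over i j -> r1 k = i ->
  exists b, r2 ((k.1, b), k.2) = j.
Proof.
case=> q [-> ->]; rewrite /fres /charge2 => /(Zp_intr_eq _ _ e1) [t et] /=.
(* The content is q + t e, and b records the parity of t. *)
have [u [b eb]] : exists u : int, exists b : bool, t = 2 * u - (if b then 1 else 0).
  exists ((t + 1) %/ 2)%Z, (odd `|t|); case: ifP; lia.
exists b; apply/(Zp_intr_eq _ _ e2); exists u; move: et; rewrite eb; case: ifP => _; lia.
Qed.

Lemma lift_distinct (k : K) : r2 ((k.1, true), k.2) <> r2 ((k.1, false), k.2).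
Proof.
rewrite /fres /charge2 /= => /(Zp_intr_eq _ _ e2) [t et].
have h : (2 * t - 1) * e%:Z = 0 by lia.
by move/eqP: h; rewrite mulf_eq0; lia.
Qed.

Lemma half_far (j : 'Z_(2 * e)) : [/\ j + E != j + 1, j != j + E + 1 & j != j + E].
Proof.
have h (m : nat) : (0 < m < 2 * e)%N -> (m%:R == 0 :> 'Z_(2 * e)) = false.
  move=> mb; apply/eqP => e0; have : nat_of_ord (m%:R : 'Z_(2 * e)) = 0%N by rewrite e0.
  by rewrite val_Zp_nat // modn_small //; lia.
split.
- rewrite (inj_eq (addrI j)) -subr_eq0 -[X in _ - X]/(1%:R) -natrB; last by lia.
  by rewrite h //; lia.
- by rewrite -addrA -subr_eq0 opprD addrA subrr sub0r oppr_eq0 natr1 h //; lia.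
- by rewrite -subr_eq0 opprD addrA subrr sub0r oppr_eq0 h //; lia.
Qed.

(** Exactly one of the two copies of a position has the prescribed colour above
its own. *)
Definition lift_pos (j : 'Z_(2 * e)) (k : K) : K2 := ((k.1, r2 ((k.1, true), k.2) == j), k.2).

Lemma lift_pos_colour i j k : colour_over i j -> r1 k = i -> r2 (lift_pos j k) = j.
Proof.
move=> o ri; rewrite /lift_pos; have [//|n] := r2 ((k.1, true), k.2) =P j.
by case: (lift_colour o ri) => -[].
Qed.

Lemma lift_forget j k : r2 k = j -> k = lift_pos j (forget k).
Proof.
move=> rk; case: k rk => [[c b] d] rk; rewrite /lift_pos /forget /=; congr (_, _, _).
case: b rk => rk; first by rewrite rk eqxx.
by apply/esym/eqP => h; apply: (@lift_distinct (c, d)); rewrite /= h rk.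
Qed.

Lemma lift_pos_forget j k : forget (lift_pos j k) = k.
Proof. by case: k. Qed.

Lemma lift_pos_eq j q k : (q == lift_pos j k) =
  (q.1.2 == (r2 ((k.1, true), k.2) == j)) && (forget q == k).
Proof.
case: q k => [[c b] d] [c' d']; rewrite /lift_pos /forget /= !xpair_eqE.
by rewrite andbAC andbA andbC -andbA.
Qed.

Lemma shift_lift_pos_eq j q k : (q == shiftp (lift_pos j k)) =
  (q.1.2 == (r2 ((k.1, true), k.2) == j)) && (forget q == shiftp k).
Proof.
case: q k => [[c b] d] [c' d']; rewrite /lift_pos /shiftp /forget /= !xpair_eqE.
by rewrite andbAC andbA andbC -andbA.
Qed.

Lemma lift_complete i j T s : colour_over i j -> complete v lt i T s ->
  complete charge2 order2 j T (map (lift_pos j) s).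
Proof.
move=> o [ss rs cs]; split.
- rewrite sorted_map; apply: sub_sorted ss => k q h.
  by rewrite /order2 /= !lift_pos_forget h.
- by move=> k /mapP [q qs ->]; apply: lift_pos_colour o _; apply: rs.
- move=> k rk kT; apply/mapP; exists (forget k); last exact: lift_forget.
  by apply: cs; first exact: forget_colour o rk.
Qed.

Lemma double_weight x k : fweight (doubled x) k = fweight x (forget k).
Proof. by rewrite /fweight ffunE. Qed.

Lemma double_node_count x : node_count (doubled x) = (2 * node_count x)%N.
Proof.
rewrite /node_count (eq_bigr (fun cb : C2 => sumn (val (x cb.1)))); last by move=> cb _; rewrite
  ffunE.
rewrite -(pair_bigA _ (fun c (b : bool) => sumn (val (x c)))) /= big_distrr /=.
by apply: eq_bigr => c _; rewrite sum_nat_const card_bool.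
Qed.

Lemma doubled_inj : injective doubled.
Proof. by move=> x y h; apply/ffunP => c; have /ffunP /(_ (c, true)) := h; rewrite !ffunE. Qed.

Local Notation f := (fock_f v lt).
Local Notation f2 := (fock_f charge2 order2).
Local Notation T x := (2 * node_count x)%N.

Lemma double_phi i j x : colour_over i j -> fock_phi charge2 order2 j (doubled x) = fock_phi v
  lt i x.
Proof.
move=> o; have cs := positions_complete v so (T x) i; have cs2 := lift_complete o cs.
have xT : (node_count x <= T x)%N by lia.
have x2T : (node_count (doubled x) <= T x)%N by rewrite double_node_count.
rewrite (complete_phi order2_shift cs2 x2T) (complete_phi so cs xT) /phi free_adds_map size_map.
by congr size; apply: free_adds_ext => k _; rewrite /= double_weight lift_pos_forget.
Qed.

Lemma double_eps i j x : colour_over i j -> fock_eps charge2 order2 j (doubled x) = fock_eps v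
  lt i x.
Proof.
move=> o; have cs := positions_complete v so (T x) i; have cs2 := lift_complete o cs.
have xT : (node_count x <= T x)%N by lia.
have x2T : (node_count (doubled x) <= T x)%N by rewrite double_node_count.
rewrite (complete_eps order2_shift cs2 x2T) (complete_eps so cs xT) /eps -map_rev /phi
  free_adds_map size_map.
by congr size; apply: free_adds_ext => k _; rewrite /= double_weight lift_pos_forget.
Qed.

(** Each of the two colours above i sees one copy of every diagonal of
colour i, in the same order and with the same weights.  The two colours differ
by e, hence are not adjacent modulo 2e, and the first arrow does not affect
the second. *)
Lemma double_f i j x y : colour_over i j -> f i x = Some y ->
  exists2 u, f2 j (doubled x) = Some u & f2 (j + E) u = Some (doubled y).
Proof.
move=> o fx; have cs := positions_complete v so (T x).+1 i.
have o' := over_add o; have cs2 := lift_complete o cs; have cs2' := lift_complete o' cs.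
have xT : (node_count x <= (T x).+1)%N by lia.
have x2T : (node_count (doubled x) <= (T x).+1)%N by rewrite double_node_count.
have [k [ks g m]] := (complete_f so y cs xT).1 fx.
have [_ rs _] := cs.
have gl j' : good (fweight (doubled x)) (map (lift_pos j') (positions v lt (T x).+1 i)) = Some
  (lift_pos j' k).
  rewrite good_map -[RHS]/(omap (lift_pos j') (Some k)) -g.
  by rewrite /good; congr (omap _ (ohead (rev _))); apply: free_adds_ext => q _;
    rewrite /= double_weight lift_pos_forget.
have w j' : fweight (doubled x) (lift_pos j' k) = 1.
  by rewrite double_weight lift_pos_forget (fmove_weight1 m).
exists (add_at (lift_pos j k) (doubled x)).
  apply/(complete_f order2_shift _ cs2 x2T); exists (lift_pos j k); split=> //.
  - by rewrite map_f.
  - exact: add_atP.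
set u := add_at _ _.
have mu : fmove (lift_pos j k) (doubled x) u by apply: add_atP.
have uT : (node_count u <= (T x).+1)%N by rewrite (fmove_node_count mu) double_node_count.
(* The second arrow is not affected by the first one. *)
have [n1 n2 n3] := half_far j.
apply/(complete_f order2_shift _ cs2' uT); exists (lift_pos (j + E) k); split.
- by rewrite map_f.
- rewrite -(gl (j + E)) /good; congr (ohead (rev _)); apply: free_adds_ext => q qs.
  apply: (far_weight n1 n2 n3 _ _ mu); first by apply: lift_pos_colour o _; apply: rs.
  by case/mapP: qs => q' q's ->; apply: lift_pos_colour o' _; apply: rs.
- have nb : (r2 ((k.1, true), k.2) == j) = ~~ (r2 ((k.1, true), k.2) == j + E).
    have c1 := lift_pos_colour o (rs k ks); have c2 := lift_pos_colour o' (rs k ks).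
    rewrite /lift_pos in c1 c2.
    case: eqP c1 => h1 c1; case: eqP c2 => h2 c2 //.
      by move: n3; rewrite -h2 h1 eqxx.
    by move: n3; rewrite -{1}c1 c2 eqxx.
  move=> q; have := mu q; have := m (forget q).
  rewrite /fbead !ffunE => mq muq.
  rewrite mq muq !lift_pos_eq !shift_lift_pos_eq nb; case: (r2 _ == _); case: (q.1.2) => /=; lia.
Qed.

Lemma double_f_None i j x : colour_over i j -> f i x = None -> f2 j (doubled x) = None.
Proof.
move=> o fx; have := fock_f_phi v lt i x; have := fock_f_phi charge2 order2 j (doubled x).
by rewrite (double_phi x o) fx; case: (f2 _ _) => // a <-.
Qed.

End Doubling.

(** * Comparison of crystals of the same highest weight *)

(** Optional negation of colours, which makes the isomorphism of the crystals and
the Mullineux map two cases of the same statement. *)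
Definition twist (b : bool) (V : zmodType) (i : V) : V := if b then - i else i.
Arguments twist b {V} i.

(** Negation is an automorphism of the cyclic Dynkin diagram. *)
Lemma stembridge_twist b N (S : Type) f (ep ph : 'Z_N -> S -> nat) :
  stembridge (@cartan N) f ep ph ->
  stembridge (@cartan N) (fun i => f (twist b i)) (fun i => ep (twist b i))
    (fun i => ph (twist b i)).
Proof.
case: b => // st.
have nn i j : i != j -> - i != - j :> 'Z_N by rewrite eqr_opp.
split.
- by move=> i x; apply: (st_ph st).
- by move=> i x; apply: (st_ep st).
- by move=> i x y; apply: (st_epS st).
- move=> i x y fx j; rewrite /twist in fx *; rewrite (st_wt st fx (- j)) /cartan.
  have -> : (- j == - i) = (j == i) by rewrite eqr_opp.
  have -> : (- j == - i + 1) = (j + 1 == i).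
    by rewrite -[- i + 1]opprK opprD opprK eqr_opp eq_sym subr_eq eq_sym.
  have -> : (- j + 1 == - i) = (j == i + 1).
    by rewrite -[- j + 1]opprK opprD opprK eqr_opp subr_eq.
  by congr (_ - _); rewrite addrAC.
- by move=> i x y z; apply: (st_inj st).
- by move=> i j z y1 y2 /nn; apply: (st_f st).
- by move=> i j x y1 y2 /nn; apply: (st_e st).
Qed.

Definition fempty (C : finType) : {ffun C -> part} := [ffun=> empty_part].

Section Empty.
Variables (C : finType) (v : C -> int) (e : nat) (lt : rel (C * int)).
Hypothesis so : shift_order lt.

Lemma node_count_empty : node_count (fempty C) = 0%N.
Proof. by rewrite /node_count big1 // => c _; rewrite ffunE. Qed.

Lemma fock_eps_empty (i : 'Z_e) : fock_eps v lt i (fempty C) = 0%N.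
Proof.
apply/eqP; rewrite -leqn0 leqNgt; apply/negP => /(fock_eps_gt0 v so) [y /(fock_f_node_count so)].
by rewrite node_count_empty.
Qed.

(** The empty multipartition has one addable node in each component, on
diagonal 0. *)
Lemma fock_phi_empty (i : 'Z_e) :
  fock_phi v lt i (fempty C) = (\sum_c ((v c)%:~R == i))%N.
Proof.
have := phi_eps (@fweight_unit _ (fempty C) (fsig v lt i (fempty C))).
rewrite -/(fock_phi _ _ _ _) -/(fock_eps _ _ _ _) fock_eps_empty subr0 => h.
apply/eqP; rewrite -eqz_nat h /fsig node_count_empty /positions (perm_big _ (permEl (perm_sort _
  _))) /= big_filter.
rewrite big_mkcond /box big_allpairs_dep /= big_enum /=.
rewrite (eq_bigr (fun c => Posz ((v c)%:~R == i :> 'Z_e))); last first.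
  move=> c _; rewrite big_seq1 /fres /= addr0 /fweight /dweight /= ffunE !bead_empty.
  by case: (_ == _).
by rewrite (big_morph Posz PoszD (erefl _)).
Qed.
End Empty.

Section Runs.
Variables (C : finType) (v : C -> int) (e : nat) (lt : rel (C * int)).
Hypothesis so : shift_order lt.
Hypothesis e1 : (1 < e)%N.

Local Notation f := (fock_f v lt (N := e)).
Local Notation f2 := (fock_f (charge2 v e) (order2 lt) (N := 2 * e)).
Local Notation o := (fempty C).
Local Notation o2 := (fempty (C * bool)%type).
Local Notation E := (e%:R : 'Z_(2 * e)).

Lemma double_empty : doubled o = o2.
Proof. by apply/ffunP => cb; rewrite !ffunE. Qed.

(** The labels of the path of doubled multipartitions. *)
Definition dword (w : seq 'Z_e) : seq 'Z_(2 * e) :=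
  flatten [seq [:: (nat_of_ord i)%:R; (nat_of_ord i)%:R + E] | i <- w].

Lemma dword_rcons w i :
  dword (rcons w i) = rcons (rcons (dword w) (nat_of_ord i)%:R) ((nat_of_ord i)%:R + E).
Proof. by rewrite /dword map_rcons -cats1 flatten_cat /= -!cats1 -catA. Qed.

Lemma over_twist b (i : 'Z_e) (j : 'Z_(2 * e)) : colour_over i j -> colour_over (twist b i)
  (twist b j).
Proof. by case: b => //; apply: over_opp. Qed.

Lemma twist_half b (j : 'Z_(2 * e)) : twist b (j + E) = twist b j + E.
Proof.
case: b => //=; rewrite opprD; congr (_ + _).
by apply/esym/eqP; rewrite -addr_eq0 half_sum.
Qed.

Lemma double_run b w x : run f o (map (twist b) w) = Some x ->
  run (fun j => f2 (twist b j)) o2 (dword w) = Some (doubled x).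
Proof.
elim/last_ind: w x => [|w i IH] x; first by move=> /= [<-]; rewrite double_empty.
rewrite map_rcons run_rcons dword_rcons !run_rcons.
case r: (run f o _) => [y|] //= fy; rewrite (IH y r) /=.
have ov := over_twist b (over_lift i).
by have [u -> /=] := double_f so e1 ov fy; rewrite twist_half.
Qed.

Lemma double_run_defined b w x : run (fun j => f2 (twist b j)) o2 (dword w) = Some x ->
  exists y, run f o (map (twist b) w) = Some y.
Proof.
elim/last_ind: w x => [|w i IH] x; first by exists o.
rewrite map_rcons run_rcons dword_rcons !run_rcons.
case r: (run _ o2 (dword w)) => [u|] //= fu.
have [y ry] := IH u r; rewrite ry /=.
have := double_run ry; rewrite r => -[eu].
case fy: (f _ y) => [z|]; first by exists z.
by move: fu; rewrite eu (double_f_None so e1 (over_twist b (over_lift i)) fy).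
Qed.

Lemma fock2_stembridge b :
  stembridge (@cartan (2 * e)) (fun j => f2 (twist b j))
    (fun j => fock_eps (charge2 v e) (order2 lt) (twist b j))
    (fun j => fock_phi (charge2 v e) (order2 lt) (twist b j)).
Proof.
by apply: stembridge_twist; apply: fock_stembridge; [apply: order2_shift | lia].
Qed.

Lemma run_node_count w x : run f o w = Some x -> node_count x = size w.
Proof.
elim/last_ind: w x => [|w i IH] x; first by move=> /= [<-]; rewrite node_count_empty.
rewrite run_rcons size_rcons; case r: (run f o w) => [y|] //= fy.
by rewrite (fock_f_node_count so fy) (IH y r).
Qed.

(** A reachable doubled multipartition other than the empty one has an
inverse arrow, of a colour above some i; then the multipartition itself has an
inverse arrow of colour i, and doubling it lifts to two inverse arrows, whose
source is again reachable. *)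
Lemma double_reachable n w y : node_count y = n -> run f2 o2 w = Some (doubled y) ->
  exists w', run f o w' = Some y.
Proof.
elim: n w y => [|n IH] w y cy.
  exists [::]; congr Some; apply/ffunP => c; rewrite ffunE; apply: val_inj => /=.
  have := sumn_le_node_count y c; rewrite cy leqn0 => /eqP s0.
  by have := sumn_size (y c); rewrite s0 leqn0 => /nilP ->.
case/lastP: w => [|w j].
  by move=> /= [] h; have := double_node_count y; rewrite -h node_count_empty cy.
rewrite run_rcons; case r: (run f2 o2 w) => [u|] //= fu.
have [i ov] := over_exists j.
have : (0 < fock_eps v lt i y)%N.
  rewrite -(double_eps v so e1 _ ov); apply/(fock_eps_gt0 (charge2 v e) (order2_shift so)).
  by exists u.
case/(fock_eps_gt0 v so) => y0 fy0.
have [u' g1 g2] := double_f so e1 ov fy0.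
have st := fock2_stembridge false.
have ep0 (j' : 'Z_(2 * e)) : fock_eps (charge2 v e) (order2 lt) (twist false j') o2 = 0%N.
  exact: fock_eps_empty (order2_shift so) _.
have p : paired f2 f2 o2 o2 (size w).+1 (doubled y) (doubled y).
  by exists (rcons w j); rewrite size_rcons run_rcons r.
have [m1 _ [_ _ [w1 [_ r1 _]]]] :=
  transfer_pred st st ep0 ep0 (fun _ => erefl) p g2.
have p1 : paired f2 f2 o2 o2 (size w1) u' u' by exists w1.
have [m2 _ [_ _ [w2 [_ r2 _]]]] :=
  transfer_pred st st ep0 ep0 (fun _ => erefl) p1 g1.
have c0 : node_count y0 = n by have := fock_f_node_count so fy0; rewrite cy => -[].
have [w' rw'] := IH w2 y0 c0 r2.
by exists (rcons w' i); rewrite run_rcons rw'.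
Qed.

Theorem fock_pred w x i y : run f o w = Some x -> f i y = Some x ->
  exists w', run f o w' = Some y.
Proof.
move=> rw fy; have ov := over_lift i.
have [u g1 g2] := double_f so e1 ov fy.
have st := fock2_stembridge false.
have ep0 (j' : 'Z_(2 * e)) : fock_eps (charge2 v e) (order2 lt) (twist false j') o2 = 0%N.
  exact: fock_eps_empty (order2_shift so) _.
have rd : run f2 o2 (dword w) = Some (doubled x).
  by have := @double_run false w x; rewrite map_id; apply.
have p : paired f2 f2 o2 o2 (size (dword w)) (doubled x) (doubled x) by exists (dword w).
have [m1 _ [_ _ [w1 [_ r1 _]]]] :=
  transfer_pred st st ep0 ep0 (fun _ => erefl) p g2.
have p1 : paired f2 f2 o2 o2 (size w1) u u by exists w1.
have [m2 _ [_ _ [w2 [_ r2 _]]]] :=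
  transfer_pred st st ep0 ep0 (fun _ => erefl) p1 g1.
exact: double_reachable (erefl _) r2.
Qed.

End Runs.

Section FockTransfer.
Variables (C C' : finType) (v : C -> int) (v' : C' -> int) (e : nat).
Variables (lt : rel (C * int)) (lt' : rel (C' * int)) (b : bool).
Hypotheses (so : shift_order lt) (so' : shift_order lt').
Hypothesis e1 : (1 < e)%N.

Local Notation f := (fock_f v lt (N := e)).
Local Notation f' := (fock_f v' lt' (N := e)).
Local Notation o := (fempty C).
Local Notation o' := (fempty C').

Hypothesis same_weight : forall i : 'Z_e,
  fock_phi v lt i o = fock_phi v' lt' (twist b i) o'.

Let st := fock2_stembridge v so e1 false.
Let st' := fock2_stembridge v' so' e1 b.

Let ep0 (j : 'Z_(2 * e)) : fock_eps (charge2 v e) (order2 lt) (twist false j) (fempty (C *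
  bool)%type) = 0%N.
Proof. exact: fock_eps_empty (order2_shift so) _. Qed.

Let ep0' (j : 'Z_(2 * e)) : fock_eps (charge2 v' e) (order2 lt') (twist b j) (fempty (C' *
  bool)%type) = 0%N.
Proof. exact: fock_eps_empty (order2_shift so') _. Qed.

Let ph0 (j : 'Z_(2 * e)) : fock_phi (charge2 v e) (order2 lt) (twist false j) (fempty (C *
  bool)%type) =
  fock_phi (charge2 v' e) (order2 lt') (twist b j) (fempty (C' * bool)%type).
Proof.
have [i ov] := over_exists j.
rewrite -!double_empty (double_phi v so e1 _ ov) same_weight.
by rewrite (double_phi v' so' e1 _ (over_twist b ov)).
Qed.

Lemma double_paired w x x' : run f o w = Some x -> run f' o' (map (twist b) w) = Some x' ->
  paired (fun j : 'Z_(2 * e) => fock_f (charge2 v e) (order2 lt) (twist false j))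
    (fun j : 'Z_(2 * e) => fock_f (charge2 v' e) (order2 lt') (twist b j))
    (fempty (C * bool)%type) (fempty (C' * bool)%type) (2 * size w) (doubled x) (doubled x').
Proof.
move=> r r'; exists (dword w); split.
- by elim: w {r r'} => //= i w; rewrite /dword /= mulnS => ->.
- by apply: double_run => //; rewrite map_id.
- exact: double_run.
Qed.

Theorem fock_transfer_run w x : run f o w = Some x ->
  exists x', run f' o' (map (twist b) w) = Some x'.
Proof.
move=> r; have r2 : run (fun j : 'Z_(2 * e) => fock_f (charge2 v e) (order2 lt) (twist false j))
    (fempty (C * bool)%type) (dword w) = Some (doubled x).
  by apply: double_run => //; rewrite map_id.
have [u ru] := transfer_run st st' ep0 ep0' ph0 r2.
exact: double_run_defined ru.
Qed.

Theorem fock_transfer_eq w x x' (i : 'Z_e) : run f o w = Some x ->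
  run f' o' (map (twist b) w) = Some x' ->
  fock_eps v lt i x = fock_eps v' lt' (twist b i) x' /\
  fock_phi v lt i x = fock_phi v' lt' (twist b i) x'.
Proof.
move=> r r'; have := transfer_eq st st' ep0 ep0' ph0 (double_paired r r') (nat_of_ord i)%:R.
have ov := over_lift i.
rewrite (double_eps v so e1 _ ov) (double_phi v so e1 _ ov).
by rewrite (double_eps v' so' e1 _ (over_twist b ov)) (double_phi v' so' e1 _ (over_twist b ov)).
Qed.

Theorem fock_transfer_fun w1 w2 x x1 x2 : run f o w1 = Some x -> run f o w2 = Some x ->
  run f' o' (map (twist b) w1) = Some x1 -> run f' o' (map (twist b) w2) = Some x2 -> x1 = x2.
Proof.
move=> r1 r2 r1' r2'; apply: doubled_inj.
have p1 := double_paired r1 r1'; have p2 := double_paired r2 r2'.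
have es : size w1 = size w2 by rewrite -(run_node_count so r1) (run_node_count so r2).
rewrite -es in p2.
exact: (transfer_fun st st' ep0 ep0' ph0 p1 p2).
Qed.

End FockTransfer.

(** * Signatures of nodes and weights of diagonals *)

Local Notation row := Defs.row.
Local Notation col := Defs.col.

(** A multipartition has at most one addable or removable node on each diagonal of
a component, so the position determines the node. *)
Definition position (l : nat) (g : node l) : 'I_l * int :=
  (comp_of g, (col g)%:Z - (row g)%:Z).

Section Nodes.
Variables (l : nat) (la : lpart l).
Implicit Types (g h : node l).

Lemma mem_diagram g : (g \in diagram la) = (col g < prow (la (comp_of g)) (row g))%N.
Proof.
case: g => [[a b] c]; rewrite /diagram /Defs.col /Defs.row /comp_of /=.
apply/flattenP/idP => [[s /mapP [c' _ ->]]|h].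
  by move=> /allpairsPdep [a' [b' [_]]]; rewrite mem_iota /= => h [-> -> ->].
eexists; first by apply/mapP; exists c; rewrite ?mem_enum.
apply/allpairsPdep; exists a, b; rewrite !mem_iota /= add0n; split=> //.
by rewrite -prow_gt0; lia.
Qed.

Lemma diagram_uniq : uniq (diagram la).
Proof.
rewrite /diagram; have := enum_uniq 'I_l; elim: (enum 'I_l) => //= c s IH /andP [cs us].
rewrite cat_uniq IH // andbT; apply/andP; split.
  apply: allpairs_uniq_dep; rewrite ?iota_uniq //.
    by move=> a _; apply: iota_uniq.
  by move=> [a b] [a' b'] /= _ _ [-> ->].
apply/hasPn => g /flattenP [r /mapP [c' c's ->]] /allpairsPdep [a [b [_ _ ->]]].
apply/negP => /allpairsPdep [a' [b' [_ _ [_ _ e]]]].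
by move: cs; rewrite -e c's.
Qed.

Lemma addableE g : addable la g =
  (col g == prow (la (comp_of g)) (row g)) &&
  ((row g == 0%N) || (prow (la (comp_of g)) (row g) < prow (la (comp_of g)) (row g).-1)%N).
Proof.
rewrite /addable mem_diagram -leqNgt /is_young /=.
have -> : all (fun h : node l => (((row h).-1, col h, comp_of h) \in g :: diagram la) &&
    ((row h, (col h).-1, comp_of h) \in g :: diagram la)) (diagram la).
  apply/allP => h hD; rewrite !inE !mem_diagram /Defs.row /Defs.col /comp_of /= in hD *.
  apply/andP; split; apply/orP; right; last by lia.
  by apply: leq_trans hD _; apply: prow_le; lia.
rewrite andbT !inE !mem_diagram; case: g => [[a b] c]; rewrite /Defs.row /Defs.col /comp_of /=.
rewrite !xpair_eqE !eqxx !andbT.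
have l1 := prow_le (la c) (leq_pred a).
by case: a l1 => [|a] /= l1; case: b => [|b] /=; rewrite ?eqxx; lia.
Qed.

Lemma removableE g : removable la g =
  (prow (la (comp_of g)) (row g) == (col g).+1) &&
  (prow (la (comp_of g)) (row g).+1 < prow (la (comp_of g)) (row g))%N.
Proof.
rewrite /removable mem_diagram /is_young.
have mr h : (h \in rem g (diagram la)) = (h != g) && (h \in diagram la).
  by rewrite mem_rem_uniq ?diagram_uniq.
case: g mr => [[a b] c] mr; rewrite /Defs.row /Defs.col /comp_of /=.
apply/andP/andP => [[bD /allP yD]|[/eqP pa lt]].
  have na : (a, b.+1, c) \notin diagram la.
    apply/negP => h; have /yD : (a, b.+1, c) \in rem (a, b, c) (diagram la).
      by rewrite mr h andbT !xpair_eqE; lia.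
    by rewrite !mr /Defs.row /Defs.col /comp_of /= eqxx andbF.
  have nb : (a.+1, b, c) \notin diagram la.
    apply/negP => h; have /yD : (a.+1, b, c) \in rem (a, b, c) (diagram la).
      by rewrite mr h andbT !xpair_eqE; lia.
    by rewrite !mr /Defs.row /Defs.col /comp_of /= eqxx.
  by move: na nb; rewrite !mem_diagram /Defs.row /Defs.col /comp_of /=; lia.
split; first by lia.
apply/allP => -[[a' b'] c']; rewrite !mr !mem_diagram /Defs.row /Defs.col /comp_of /= => /andP
  [n h].
have l1 := prow_le (la c') (leq_pred a').
rewrite !xpair_eqE in n *; have [ec|nc] := eqVneq c' c; last first.
  by rewrite !andbF /=; lia.
subst c'; rewrite eqxx !andbT in n *.
apply/andP; split; last first.
  rewrite andbC; apply/andP; split; first by lia.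
  apply/negP => /andP [/eqP ea /eqP eb]; subst a'; case: b' eb n h => [|b'] /= eb n h; lia.
rewrite andbC; apply/andP; split; first by lia.
apply/negP => /andP [/eqP ea /eqP eb]; case: a' ea n h {l1} => [|a'] /= ea n h; subst; lia.
Qed.

Lemma addable_weight g : addable la g -> fweight la (position g) = 1.
Proof.
rewrite addableE => /andP [/eqP e h]; apply/dweight_add; exists (row g).
by rewrite /position /= e.
Qed.

Lemma removable_weight g : removable la g -> fweight la (position g) = -1.
Proof.
rewrite removableE => /andP [/eqP e h]; apply/dweight_rem; exists (row g).
by rewrite /position /= e; split=> //; lia.
Qed.

Lemma addable_not_removable g : addable la g -> removable la g = false.
Proof.
by move=> /addable_weight a; apply/negP => /removable_weight; rewrite a.
Qed.

Lemma weight_node k : fweight la k != 0 ->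
  exists2 g, position g = k & addable la g || removable la g.
Proof.
case: k => c d; rewrite /fweight /=; case: (dweight_unit (la c) d) => e; rewrite e // => _.
  have [a [ea h]] := (dweight_add _ _).1 e; exists (a, prow (la c) a, c).
    by rewrite /position /= ea.
  by rewrite addableE /Defs.col /Defs.row /comp_of /= eqxx h.
have [a [ea h]] := (dweight_rem _ _).1 e; exists (a, (prow (la c) a).-1, c).
  by rewrite /position /comp_of /Defs.col /Defs.row /=; congr (_, _); lia.
by rewrite removableE /Defs.col /Defs.row /comp_of /= h andbT; apply/orP; right; lia.
Qed.

Lemma position_inj g h : addable la g || removable la g -> addable la h || removable la h ->
  position g = position h -> g = h.
Proof.
case: g h => [[a b] c] [[a' b'] c'] hg hh ep.
have [ec ed] : c = c' /\ b%:Z - a%:Z = b'%:Z - a'%:Z by case: ep.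
subst c'.
have mono x y : (x <= y)%N -> (prow (la c) y <= prow (la c) x)%N by apply: prow_le.
suff ea : a = a' by subst a'; congr (_, _, _); lia.
case/orP: hg => hg; case/orP: hh => hh; try by
  [have := addable_weight hg; rewrite ep (removable_weight hh)
  |have := addable_weight hh; rewrite -ep (removable_weight hg)].
- move: hg hh; rewrite !addableE /Defs.row /Defs.col /comp_of /= => /andP [/eqP e1 _] /andP
  [/eqP e2 _].
  by have := mono a a'; have := mono a' a; lia.
- move: hg hh; rewrite !removableE /Defs.row /Defs.col /comp_of /= => /andP [/eqP e1 _] /andP
  [/eqP e2 _].
  by have := mono a a'; have := mono a' a; lia.
Qed.

Lemma add_node_at g : addable la g -> add_node la g = add_at (position g) la.
Proof.
rewrite addableE => /andP [/eqP e h]; apply/ffunP => c; rewrite !ffunE.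
have [->|//] := c =P comp_of g.
rewrite /position /= e; apply: val_inj; rewrite add_diag_row // insubdK //.
exact: incr_is_part h.
Qed.

(** The reduced word has its addable nodes in front of its removable
ones, so a removable node that finds no addable node at the head of the
reduced word finds none in it. *)
Lemma delete_RA_adds w : {in w, forall g, addable la g || removable la g} ->
  (exists k, all (addable la) (take k (delete_RA la w)) /\
     all (predC (addable la)) (drop k (delete_RA la w))) /\
  map (@position l) [seq g <- delete_RA la w | addable la g] =
  free_adds (fweight la) (map (@position l) w).
Proof.
elim: w => [|g w IH] hw; first by split=> //; exists 0%N.
have [|[k [h1 h2]] e] := IH; first by move=> h hh; apply: hw; rewrite inE hh orbT.
have hg : addable la g || removable la g by apply: hw; rewrite mem_head.
rewrite /= -/(delete_RA la w) -e; set D := delete_RA la w in h1 h2 e *.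
case/orP: hg => hg.
  rewrite (addable_not_removable hg) (addable_weight hg) /= hg; split=> //.
  by exists k.+1; rewrite /= hg.
have ng : addable la g = false by apply/negP => /addable_not_removable; rewrite hg.
rewrite hg (removable_weight hg) /=.
case: D h1 h2 e => [|x D] h1 h2 e /=.
  by rewrite ng; split=> //; exists 0%N; rewrite /= ng.
have [ax|nx] := boolP (addable la x).
  rewrite /=; split=> //; exists k.-1.
  case: k h1 h2 => [|k] /=; last by case/andP.
  by rewrite ax.
have k0 : k = 0%N by case: k h1 {h2} => //= k; rewrite (negbTE nx).
subst k; rewrite /= ng (negbTE nx) /=; split; first by exists 0%N; rewrite /= ng; rewrite drop0
  in h2.
move: h2; rewrite drop0 /= nx /= => h2.
by rewrite (_ : [seq _ <- _ | _] = [::]) //; apply/eqP; rewrite -[_ == _]negbK -has_filter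
  -all_predC.
Qed.

End Nodes.

Section Rule.
Variables (e l : nat) (B : crystal_rule e l) (v : 'I_l -> int) (lt : rel ('I_l * int)).
Hypothesis so : shift_order lt.
Hypothesis Bres : forall g, residue B g = fres v e (position g).
Hypothesis Blt : forall g h, precedes B g h = lt (position g) (position h).

Lemma signature_nodes_mem (i : 'Z_e) (la : lpart l) g :
  (g \in signature_nodes B i la) = (residue B g == i) && (addable la g || removable la g).
Proof.
rewrite mem_sort mem_filter; apply: andb_idr => /andP [_ ar].
have rb (p : part) a : (a <= size (val p))%N -> (a <= sumn (val p))%N.
  by move=> h; apply: leq_trans h (sumn_size p).
have lr : (sumn (val (la (comp_of g))) <= rank la)%N by apply: (@sumn_le_node_count _ la).
have [ra ca] : (row g <= rank la)%N /\ (col g <= rank la)%N.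
  case/orP: ar; rewrite ?addableE ?removableE => /andP [/eqP e1 h].
    split; last by rewrite e1; apply: leq_trans lr; apply: prow_sumn.
    by apply: leq_trans lr; apply: rb; apply: addable_row_le.
  have := prow_sumn (la (comp_of g)) (row g); rewrite e1 => cs; split; last by lia.
  by apply: leq_trans lr; apply: rb; apply: ltnW; rewrite -prow_gt0 e1.
case: g ra ca {ar lr} => [[a b] c]; rewrite /Defs.row /Defs.col /= => ra ca.
apply/flattenP; exists [seq (a', b', c) | a' <- iota 0 (rank la).+1, b' <- iota 0 (rank la).+1].
  by apply/mapP; exists c; rewrite ?mem_enum.
by apply/allpairsPdep; exists a, b; rewrite !mem_iota; split=> //; lia.
Qed.

(** Both lists are strictly increasing and have the same elements. *)
Lemma signature_nodes_map (i : 'Z_e) (la : lpart l) :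
  map (@position l) (signature_nodes B i la) =
  [seq k <- fsig v lt i la | fweight la k != 0].
Proof.
set s := signature_nodes B i la.
have sm g : g \in s -> addable la g || removable la g.
  by rewrite signature_nodes_mem => /andP [].
have us : uniq s.
  rewrite sort_uniq filter_uniq //.
  move: (iota 0 (rank la).+1) (iota_uniq 0 (rank la).+1) => t ut.
  have := enum_uniq 'I_l; elim: (enum 'I_l) => //= c r IH /andP [cs ur].
  rewrite cat_uniq IH // andbT; apply/andP; split.
    by apply: allpairs_uniq => // -[a b] [a' b'] /= _ _ [-> ->].
  apply/hasPn => g /flattenP [r' /mapP [c' c's ->]] /allpairsP [[a b] [_ _ ->]].
  apply/negP => /allpairsP [[a' b'] [_ _ [_ _ ec]]].
  by move: cs; rewrite -ec c's.
have ip : {in s &, injective (@position l)}.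
  by move=> g h /sm gs /sm hs; apply: position_inj gs hs.
have ss : sorted lt (map (@position l) s).
  have tot : {in s &, total (fun g h => (g == h) || precedes B g h)}.
    move=> g h gs hs; rewrite !Blt; have [//|n] := eqVneq g h.
    have np : position g != position h by apply: contra n => /eqP /(ip _ _ gs hs) ->.
    by case/orP: (so_total so np) => ->; rewrite ?orbT.
  have srt : sorted (fun g h => (g == h) || precedes B g h) s.
    apply: (@sort_sorted_in _ (mem s) _ tot); apply/allP => g.
    by rewrite -(mem_sort (fun g h => (g == h) || precedes B g h)).
  rewrite sorted_map; move: srt us; elim: (s) => //= g r IH.
  case: r IH => //= h r IH /andP [/orP [/eqP ->|gh] p] /andP [n u].
    by rewrite mem_head in n.
  by rewrite -Blt gh /=; apply: IH.
have [sf rf cf] := positions_complete v so (node_count la) i.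
apply: (shift_sorted_eq so ss); first exact: sorted_filter (so_trans so) _ _ sf.
move=> k; rewrite mem_filter; apply/mapP/andP => [[g gs ->]|[w kf]].
  move: gs; rewrite signature_nodes_mem => /andP [/eqP gr ar].
  have w : fweight la (position g) != 0.
    by case/orP: ar => [/addable_weight|/removable_weight] ->.
  by split=> //; apply: cf; rewrite -?Bres //; apply: fweight_bound.
have [g gk ar] := weight_node w; exists g; last by rewrite gk.
by rewrite signature_nodes_mem ar Bres gk (rf _ kf) eqxx.
Qed.

Theorem crystal_fE (i : 'Z_e) (la : lpart l) : crystal_f B i la = fock_f v lt i la.
Proof.
rewrite /crystal_f /fock_f /good_node /good free_adds_filter -signature_nodes_map.
have sm : {in signature_nodes B i la, forall g, addable la g || removable la g}.
  by move=> g; rewrite signature_nodes_mem => /andP [].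
have [_ <-] := delete_RA_adds sm.
rewrite -map_rev; have : all (addable la) (rev [seq g <- delete_RA la (signature_nodes B i la) |
  addable la g]).
  by rewrite all_rev filter_all.
by case: (rev _) => //= g r /andP [/add_node_at -> _].
Qed.

End Rule.

(** * Paths in Kleshchev and Uglov crystals *)

(** The rule depends on nodes only through their component and diagonal. *)
Record fock_rule (e l : nat) (B : crystal_rule e l) (v : 'I_l -> int) (lt : rel ('I_l * int)) :
    Prop := FockRule {
  fr_order : shift_order lt;
  fr_res : forall g, residue B g = fres v e (position g);
  fr_prec : forall g h, precedes B g h = lt (position g) (position h)
}.

Definition uglov_lt (l : nat) (v : 'I_l -> int) : rel ('I_l * int) := fun k q =>
  (v k.1 + k.2 < v q.1 + q.2) || ((v k.1 + k.2 == v q.1 + q.2) && (q.1 < k.1)%N).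

Definition kleshchev_lt (l : nat) : rel ('I_l * int) := fun k q =>
  (k.1 < q.1)%N || ((k.1 == q.1) && (k.2 < q.2)).

(** Any integral lift of the classes would do; the Kleshchev order does not
see it. *)
Definition lift_charge (e l : nat) (vv : {ffun 'I_l -> 'Z_e}) (c : 'I_l) : int :=
  (nat_of_ord (vv c))%:Z.

Lemma ord_neq_lt l (c c' : 'I_l) : c != c' -> (c < c')%N || (c' < c)%N.
Proof. by rewrite -neq_ltn. Qed.

Lemma uglov_rule e l (v : {ffun 'I_l -> int}) : fock_rule (uglov e v) v (uglov_lt v).
Proof.
split.
- split.
  + by move=> k; rewrite /uglov_lt ltxx ltnn andbF.
  + by move=> q k r; rewrite /uglov_lt; lia.
  + move=> [c d] [c' d'] n; rewrite /uglov_lt /=.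
    have [ec|nc] := eqVneq c c'; last by have h := ord_neq_lt nc; lia.
    subst c'; have nd : d != d' by apply: contra n => /eqP ->.
    by lia.
  + by move=> [c d] [c' d']; rewrite /uglov_lt /shiftp /=; lia.
- by move=> g; rewrite /= /fres /content addrC.
- by move=> g h; rewrite /= /uglov_lt /content /= ![v _ + _]addrC.
Qed.

Lemma kleshchev_rule e l (vv : {ffun 'I_l -> 'Z_e}) :
  fock_rule (kleshchev vv) (lift_charge vv) (@kleshchev_lt l).
Proof.
split=> [|g|g h //].
- split.
  + by move=> k; rewrite /kleshchev_lt ltxx ltnn andbF.
  + move=> q k r; rewrite /kleshchev_lt => /orP [h1|/andP [/eqP e1 h1]] /orP [h2|/andP [/eqP e2
    h2]].
    * by rewrite (ltn_trans h1 h2).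
    * by rewrite -e2 h1.
    * by rewrite e1 h2.
    * by rewrite e1 e2 eqxx (lt_trans h1 h2) orbT.
  + move=> [c d] [c' d'] n; rewrite /kleshchev_lt /=.
    have [ec|nc] := eqVneq c c'; last by case/orP: (ord_neq_lt nc) => ->; rewrite ?orbT.
    subst c'; have nd : d != d' by apply: contra n => /eqP ->.
    by rewrite ltnn /=; lia.
  + by move=> k q; rewrite /kleshchev_lt /shiftp /= ltrD2r.
- by rewrite /fres /lift_charge rmorphD [X in _ = X + _]Zp_intr_val addrC.
Qed.

Section Paths.
Variables (e l : nat) (B : crystal_rule e l) (v : 'I_l -> int) (lt : rel ('I_l * int)).
Hypothesis fr : fock_rule B v lt.
Hypothesis e1 : (1 < e)%N.

Local Notation f := (fock_f v lt (N := e)).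

Lemma crystal_fock (i : 'Z_e) la : crystal_f B i la = f i la.
Proof. by case: fr => so h1 h2; apply: crystal_fE. Qed.

Lemma path_run w : path_end B w = run f (fempty 'I_l) w.
Proof.
rewrite /path_end /run -[lempty l]/(fempty 'I_l); elim: w (Some _) => //= i w IH u.
by rewrite IH; congr foldl; case: u => //= x; apply: crystal_fock.
Qed.

Lemma path_rank w la : path_end B w = Some la -> rank la = size w.
Proof. by rewrite path_run => /(run_node_count (fr_order fr)). Qed.

Lemma path_rcons w i : path_end B (rcons w i) = obind (crystal_f B i) (path_end B w).
Proof. exact: run_rcons. Qed.

(** By [fock_pred], the endpoints of paths from the empty multipartition are closed
under arrows and inverse arrows. *)
Theorem Phi_path n la : Phi B n la <-> exists2 w, size w = n & path_end B w = Some la.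
Proof.
split=> [[cl <-]|[w <- p]]; last first.
  split; last exact: path_rank.
  elim/last_ind: w la p => [|w i IH] la; first by move=> [<-]; apply: rst_refl.
  rewrite path_rcons; case p: (path_end B w) => [mu|] //= fi.
  by apply: (rst_trans _ _ _ mu); [apply: IH | apply: rst_step; exists i].
suff [w p] : exists w, path_end B w = Some la by exists w; rewrite // (path_rank p).
pose reach mu := exists w, path_end B w = Some mu.
have key x y : clos_refl_sym_trans (lpart l) (edge B) x y -> (reach x <-> reach y).
  elim=> {x y} [x y [i xy]|x|x y _ [h1 h2]|x y z _ [h1 h2] _ [h3 h4]]; try by split; auto.
  split=> [[w p]|[w]]; first by exists (rcons w i); rewrite path_rcons p.
  rewrite path_run => p; rewrite crystal_fock in xy.
  have [w' p'] := fock_pred (fr_order fr) e1 p xy.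
  by exists w'; rewrite path_run.
by apply/(key _ _ cl); exists [::].
Qed.

End Paths.

Section Transport.
Variables (e l : nat) (B B' : crystal_rule e l) (v v' : 'I_l -> int) (lt lt' : rel ('I_l * int)).
Variable b : bool.
Hypotheses (fr : fock_rule B v lt) (fr' : fock_rule B' v' lt').
Hypothesis e1 : (1 < e)%N.
Hypothesis same_weight : forall i : 'Z_e,
  (\sum_c ((v c)%:~R == i))%N = (\sum_c ((v' c)%:~R == twist b i))%N.

Let same_phi (i : 'Z_e) :
  fock_phi v lt i (fempty 'I_l) = fock_phi v' lt' (twist b i) (fempty 'I_l).
Proof.
by rewrite (fock_phi_empty v (fr_order fr)) (fock_phi_empty v' (fr_order fr')) same_weight.
Qed.

Lemma path_transfer w la : path_end B w = Some la ->
  exists la', path_end B' (map (twist b) w) = Some la'.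
Proof.
rewrite (path_run fr) (path_run fr'); apply: fock_transfer_run same_phi _ _ => //.
- exact: fr_order fr.
- exact: fr_order fr'.
Qed.

(** The path selected in [transport] need not be w, but all paths to la are
transported to the same endpoint. *)
Lemma transportE w la la' : path_end B w = Some la ->
  path_end B' (map (twist b) w) = Some la' -> transport B B' (twist b) la = la'.
Proof.
move=> p p'; rewrite /transport; case: pickP => [w0 /eqP p0|none]; last first.
  have sw : size w == rank la by rewrite (path_rank fr p).
  by have := none (Tuple sw); rewrite /= p eqxx.
have [la0 p0'] := path_transfer p0; rewrite p0' /=.
move: p p' p0 p0'; rewrite !(path_run fr) !(path_run fr') => p p' p0 p0'.
exact: (fock_transfer_fun (fr_order fr) (fr_order fr') e1 same_phi p0 p p0' p').
Qed.

End Transport.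

(** * Concatenation of the signatures of the components *)

Section Concatenation.
Variable T : eqType.
Implicit Types (w : T -> int) (s : seq T).

Lemma unit_on_cons w x s : unit_on w (x :: s) ->
  [\/ w x = 1, w x = 0 | w x = -1] /\ unit_on w s.
Proof.
move=> u; split; first by apply: u; rewrite mem_head.
by move=> y ys; apply: u; rewrite inE ys orbT.
Qed.

Lemma unit_on_cat w s1 s2 : unit_on w (s1 ++ s2) -> unit_on w s1 /\ unit_on w s2.
Proof. by move=> u; split=> x xs; apply: u; rewrite mem_cat xs ?orbT. Qed.

(** The surviving R of the first word cancel the leftmost surviving A of the
second one: this is the tensor product rule. *)
Lemma free_adds_cat w s1 s2 : unit_on w s1 ->
  free_adds w (s1 ++ s2) = free_adds w s1 ++ drop (eps w s1) (free_adds w s2).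
Proof.
elim: s1 => [_|x s IH uw]; first by rewrite /= /eps /phi /= drop0.
have [ux us] := unit_on_cons uw.
have := phi_eps uw; have := phi_eps us; rewrite big_cons /phi /=.
case: ux => ex; rewrite ex /= IH //= => h1 h2.
- by have -> : eps w (x :: s) = eps w s by lia.
- by have -> : eps w (x :: s) = eps w s by lia.
rewrite size_behead in h2; case: (free_adds w s) h1 h2 => [|y r] /= h1 h2.
  have -> : eps w (x :: s) = (eps w s).+1 by lia.
  by rewrite -drop1 drop_drop add1n.
by have -> : eps w (x :: s) = eps w s by lia.
Qed.

Lemma phi_cat w s1 s2 : unit_on w s1 ->
  phi w (s1 ++ s2) = (phi w s1 + (phi w s2 - eps w s1))%N.
Proof. by move=> u; rewrite /phi free_adds_cat // size_cat size_drop. Qed.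

Lemma eps_cat w s1 s2 : unit_on w (s1 ++ s2) ->
  eps w (s1 ++ s2) = (eps w s2 + (eps w s1 - phi w s2))%N.
Proof.
move=> u; have [u1 u2] := unit_on_cat u.
have := phi_eps u; have := phi_eps u1; have := phi_eps u2; rewrite phi_cat // big_cat /=.
set x := \sum_(_ <- s1) _; set y := \sum_(_ <- s2) _; move: x y => x y; lia.
Qed.

Lemma good_cat w s1 s2 : unit_on w s1 ->
  good w (s1 ++ s2) = if (eps w s1 < phi w s2)%N then good w s2 else good w s1.
Proof.
move=> u; rewrite /good free_adds_cat // rev_cat rev_drop -/(phi w s2).
case: (ltnP (eps w s1) (phi w s2)) => h; last first.
  by move: h; rewrite -subn_eq0 => /eqP ->; rewrite take0.
rewrite (_ : phi w s2 - eps w s1 = (phi w s2 - eps w s1).-1.+1)%N; last by lia.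
case E: (rev (free_adds w s2)) => [|a r] //.
by have := size_rev (free_adds w s2); rewrite E /= -/(phi w s2); lia.
Qed.

End Concatenation.

Lemma eps_map (T U : eqType) (g : T -> U) w s : eps w (map g s) = eps (w \o g) s.
Proof. by rewrite /eps /phi -map_rev free_adds_map size_map. Qed.

(** By the tensor product rule the string lengths of the factors decide
which factor contains the good letter. *)
Lemma good_flatten_match (I T T' : eqType) (cs : seq I) (w : T -> int) (w' : T' -> int)
    (s : I -> seq T) (s' : I -> seq T') (x : T) :
  (forall c, unit_on w (s c)) -> (forall c, unit_on w' (s' c)) ->
  (forall c, phi w (s c) = phi w' (s' c) /\ eps w (s c) = eps w' (s' c)) ->
  [/\ phi w (flatten (map s cs)) = phi w' (flatten (map s' cs)),
      eps w (flatten (map s cs)) = eps w' (flatten (map s' cs))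
    & good w (flatten (map s cs)) = Some x -> exists c x',
        [/\ good w (s c) = Some x, good w' (s' c) = Some x'
          & good w' (flatten (map s' cs)) = Some x']].
Proof.
move=> u u' h.
have uf r : unit_on w (flatten (map s r)).
  by elim: r => //= c r IH y; rewrite mem_cat => /orP [/u|/IH].
have uf' r : unit_on w' (flatten (map s' r)).
  by elim: r => //= c r IH y; rewrite mem_cat => /orP [/u'|/IH].
elim: cs => [|c cs [IH1 IH2 IH3]] //=.
have [e1 e2] := h c.
split.
- by rewrite !phi_cat // IH1 e1 e2.
- by rewrite !eps_cat ?IH1 ?IH2 ?e1 ?e2 //; [exact: (uf' (c :: cs)) | exact: (uf (c :: cs))].
rewrite !good_cat // -IH1 -e2; case: ifP => _; first exact: IH3.
move=> g; have : isSome (good w' (s' c)) by rewrite good_phi -e1 -good_phi g.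
by case g' : (good w' (s' c)) => [x'|] // _; exists c, x'.
Qed.

Definition single (p : part) : {ffun 'I_1 -> part} := [ffun=> p].

Definition set_comp l (la : lpart l) (c : 'I_l) (q : part) : lpart l :=
  [ffun c' => if c' == c then q else la c'].

Section Tensor.
Variables (e l : nat).
Implicit Types (vv : {ffun 'I_l -> 'Z_e}) (la : lpart l) (t i : 'Z_e).

Local Notation one t := ([ffun=> t] : {ffun 'I_1 -> 'Z_e}).
Local Notation lt1 := (@kleshchev_lt 1).
Local Notation f1 t := (fock_f (lift_charge (one t)) lt1 (N := e)).
Local Notation ph1 t := (fock_phi (lift_charge (one t)) lt1 (N := e)).
Local Notation ep1 t := (fock_eps (lift_charge (one t)) lt1 (N := e)).
Local Notation f vv := (fock_f (lift_charge vv) (@kleshchev_lt l) (N := e)).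

Let so1 t := fr_order (kleshchev_rule (one t)).
Let sol vv := fr_order (kleshchev_rule vv).

Definition insert (c : 'I_l) (k : 'I_1 * int) : 'I_l * int := (c, k.2).

Definition comp_word vv T i (c : 'I_l) : seq ('I_l * int) :=
  map (insert c) (positions (lift_charge (one (vv c))) lt1 T i).

(** In the Kleshchev order the components come one after the
other. *)
Lemma comp_words_complete vv T i :
  complete (lift_charge vv) (@kleshchev_lt l) i T (flatten (map (comp_word vv T i) (enum 'I_l))).
Proof.
have pc c := positions_complete (lift_charge (one (vv c))) (so1 (vv c)) T i.
have res1 c k : fres (lift_charge vv) e (insert c k) = fres (lift_charge (one (vv c))) e k.
  by rewrite /fres /lift_charge /= ffunE.
split.
- have : sorted (fun c c' : 'I_l => (c < c')%N) (enum 'I_l).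
    have := iota_ltn_sorted 0 l; rewrite -val_enum_ord sorted_map; exact: sub_sorted.
  elim: (enum 'I_l) => //= c cs IH p.
  have tr : transitive (fun c c' : 'I_l => (c < c')%N) by move=> a b d; apply: ltn_trans.
  have sw : sorted (@kleshchev_lt l) (comp_word vv T i c).
    have [ss _ _] := pc c; rewrite sorted_map; apply: sub_sorted ss => k q.
    by rewrite /kleshchev_lt /= [k.1]ord1 [q.1]ord1 ltnn eqxx /= ltnn eqxx.
  have IHs := IH (path_sorted p).
  rewrite (sorted_pairwise (so_trans (sol vv))) pairwise_cat.
  rewrite -!(sorted_pairwise (so_trans (sol vv))) sw IHs !andbT.
  apply/allrelP => k q /mapP [k' _ ->] /flattenP [r /mapP [c' c's ->] /mapP [q' _ ->]].
  by rewrite /kleshchev_lt /=; move: p; rewrite (path_sortedE tr) => /andP [/allP /(_ c' c's) ->].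
- move=> k /flattenP [r /mapP [c _ ->] /mapP [k' k's ->]].
  by rewrite res1; case: (pc c) => _ rs _; apply: rs.
- move=> [c d] rk dT; apply/flattenP; exists (comp_word vv T i c); first by rewrite map_f
  ?mem_enum.
  apply/mapP; exists (ord0, d) => //; case: (pc c) => _ _; apply=> //.
  by rewrite -rk -(res1 c (ord0, d)).
Qed.

Lemma single_weight la c k : fweight la (insert c k) = fweight (single (la c)) k.
Proof. by rewrite /fweight ffunE. Qed.

Lemma single_node_count_le la c : (node_count (single (la c)) <= node_count la)%N.
Proof. by rewrite {1}/node_count big_ord1 ffunE; apply: sumn_le_node_count. Qed.

Section Match.
Variables (vv vv' : {ffun 'I_l -> 'Z_e}) (i i' : 'Z_e) (la nu : lpart l).
Hypothesis same : forall c,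
  ep1 (vv c) i (single (la c)) = ep1 (vv' c) i' (single (nu c)) /\
  ph1 (vv c) i (single (la c)) = ph1 (vv' c) i' (single (nu c)).

Lemma add_at_single ka c k : add_at (insert c k) ka = set_comp ka c (add_at k (single (ka c))
  ord0).
Proof.
apply/ffunP => c'; rewrite !ffunE /=; have [->|//] := c' =P c.
by rewrite [k.1]ord1 eqxx.
Qed.

Lemma single_ord0 (x : {ffun 'I_1 -> part}) : x = single (x ord0).
Proof. by apply/ffunP => c; rewrite ffunE [c]ord1. Qed.

Lemma comp_f t j (ka : lpart l) c T x : (node_count ka <= T)%N ->
  good (fweight (single (ka c))) (positions (lift_charge (one t)) lt1 T j) = Some x ->
  f1 t j (single (ka c)) = Some (single (add_at x (single (ka c)) ord0)).
Proof.
move=> kT g; rewrite -single_ord0.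
have pc := positions_complete (lift_charge (one t)) (so1 t) T j.
have sT := leq_trans (single_node_count_le ka c) kT.
apply/(complete_f (so1 t) _ pc sT); exists x; split=> //; first exact: good_mem g.
apply: add_atP; apply: good_weight g; first exact: fweight_unit.
exact: (sorted_complete (so1 t) pc).
Qed.

(** Two multipartitions, possibly for different charges and colours, whose
components have equal string lengths: the arrows change the same component, and
act on it as the level one arrows do. *)
Lemma tensor_match la' : f vv i la = Some la' -> exists c q q',
  [/\ f1 (vv c) i (single (la c)) = Some (single q), la' = set_comp la c q,
      f1 (vv' c) i' (single (nu c)) = Some (single q') &
      f vv' i' nu = Some (set_comp nu c q')].
Proof.
set T := (node_count la + node_count nu)%N.
have lT : (node_count la <= T)%N by lia.
have nT : (node_count nu <= T)%N by lia.
have cs := comp_words_complete vv T i; have cs' := comp_words_complete vv' T i'.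
have pc t (j : 'Z_e) := positions_complete (lift_charge (one t)) (so1 t) T j.
have wadds ka uu j c : free_adds (fweight ka) (comp_word uu T j c) =
    map (insert c) (free_adds (fweight (single (ka c))) (positions (lift_charge (one (uu c)))
      lt1 T j)).
  rewrite free_adds_map; congr map; apply: free_adds_ext => k _; exact: single_weight.
have wphi ka uu j c : (node_count ka <= T)%N -> phi (fweight ka) (comp_word uu T j c) = ph1 (uu
  c) j (single (ka c)).
  move=> kT; rewrite /phi wadds size_map.
  have sT := leq_trans (single_node_count_le ka c) kT.
  by rewrite (complete_phi (so1 (uu c)) (pc _ _) sT).
have weps ka uu j c : (node_count ka <= T)%N -> eps (fweight ka) (comp_word uu T j c) = ep1 (uu
  c) j (single (ka c)).
  move=> kT.
  have sT := leq_trans (single_node_count_le ka c) kT.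
  rewrite (complete_eps (so1 (uu c)) (pc _ _) sT).
  transitivity (eps (fweight ka \o insert c) (positions (lift_charge (one (uu c))) lt1 T j)).
    exact: eps_map.
  rewrite /eps /phi.
  by congr size; apply: free_adds_ext => k _; rewrite /= single_weight.
have h (d : 'I_l) : phi (fweight la) (comp_word vv T i d) = phi (fweight nu) (comp_word vv' T i'
  d) /\
    eps (fweight la) (comp_word vv T i d) = eps (fweight nu) (comp_word vv' T i' d).
  have [s1 s2] := same d.
  by split; [rewrite (wphi la) // (wphi nu) | rewrite (weps la) // (weps nu)].
move/(complete_f (sol vv) _ cs lT) => [k [_ g m]].
have [_ _ gm] := good_flatten_match (enum 'I_l) k
  (fun c => @fweight_unit _ la (comp_word vv T i c))
  (fun c => @fweight_unit _ nu (comp_word vv' T i' c)) h.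
have [c [k' [g1 g1' g']]] := gm g.
have gg ka uu j z : good (fweight ka) (comp_word uu T j c) = Some z -> exists2 x, z = insert c x &
    good (fweight (single (ka c))) (positions (lift_charge (one (uu c))) lt1 T j) = Some x.
  rewrite /good wadds -map_rev; case: (rev _) => //= a r [<-]; by exists a.
have [x ex gx] := gg _ _ _ _ g1; have [x' ex' gx'] := gg _ _ _ _ g1'.
exists c, (add_at x (single (la c)) ord0), (add_at x' (single (nu c)) ord0); split.
- exact: comp_f gx.
- by rewrite (fmove_add_at m) ex add_at_single.
- exact: comp_f gx'.
apply/(complete_f (sol vv') _ cs' nT); exists k'; split=> //; first exact: good_mem g'.
rewrite -add_at_single -ex'; apply: add_atP; apply: good_weight g'; first exact: fweight_unit.
exact: (sorted_complete (sol vv') cs').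
Qed.

End Match.
End Tensor.

(** * The componentwise Mullineux map and charges with large gaps *)

Section ComponentwiseMullineux.
Variables (e l : nat) (ss : {ffun 'I_l -> 'Z_e}).
Hypothesis e1 : (1 < e)%N.

Local Notation one t := ([ffun=> t] : {ffun 'I_1 -> 'Z_e}).
Local Notation path1 t w := (path_end (kleshchev (one t)) w).

Lemma level_one_weight (t i : 'Z_e) :
  (\sum_c ((lift_charge (one t) c)%:~R == i))%N =
  (\sum_c ((lift_charge (one (- t)) c)%:~R == twist true i))%N.
Proof. by rewrite !big_ord1 /lift_charge !Zp_intr_val !ffunE /= eqr_opp. Qed.

(** Each arrow extends the path of a single component.  Equality of the
string lengths of la c and nu c along negated paths is the level one case of
the comparison of crystals. *)
Lemma componentwise_path w la : path_end (kleshchev ss) w = Some la ->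
  exists nu, path_end (kleshchev (neg_class ss)) (map -%R w) = Some nu /\
   forall c, exists wc, path1 (ss c) wc = Some (single (la c)) /\
      path1 (- ss c) (map -%R wc) = Some (single (nu c)).
Proof.
elim/last_ind: w la => [|w i IH] la.
  move=> [<-]; exists (lempty l); split=> // c; exists [::]; split=> //;
    by congr Some; apply/ffunP => c'; rewrite !ffunE.
rewrite path_rcons map_rcons path_rcons; case p: (path_end _ w) => [mu|] //=.
have [nu [p' hc]] := IH mu p; rewrite p' /=.
rewrite !(crystal_fock (kleshchev_rule _)) => fi.
have same c :
    fock_eps (lift_charge (one (ss c))) (@kleshchev_lt 1) i (single (mu c)) =
    fock_eps (lift_charge (one (neg_class ss c))) (@kleshchev_lt 1) (- i) (single (nu c)) /\
    fock_phi (lift_charge (one (ss c))) (@kleshchev_lt 1) i (single (mu c)) =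
    fock_phi (lift_charge (one (neg_class ss c))) (@kleshchev_lt 1) (- i) (single (nu c)).
  have [wc [q1 q2]] := hc c; rewrite ffunE.
  rewrite (path_run (kleshchev_rule _)) in q1; rewrite (path_run (kleshchev_rule _)) in q2.
  apply: (fock_transfer_eq (b := true) (fr_order (kleshchev_rule (one (ss c))))
     (fr_order (kleshchev_rule (one (- ss c)))) e1 _ i q1 q2).
  move=> j; rewrite (fock_phi_empty _ (fr_order (kleshchev_rule (one (ss c))))).
  by rewrite (fock_phi_empty _ (fr_order (kleshchev_rule (one (- ss c))))) level_one_weight.
have [c0 [q [q' [f1 -> f1' f2]]]] := tensor_match same fi.
exists (set_comp nu c0 q'); split; first by rewrite f2.
move=> c; have [wc [w1 w2]] := hc c; rewrite !ffunE; have [ec|_] := eqVneq c c0; last by exists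
  wc.
subst c0; exists (rcons wc i); rewrite path_rcons map_rcons path_rcons w1 w2 /=.
rewrite !(crystal_fock (kleshchev_rule _)) f1; split=> //.
by move: f1'; rewrite ffunE => ->.
Qed.

Lemma componentwise_mullineux w la : path_end (kleshchev ss) w = Some la ->
  path_end (kleshchev (neg_class ss)) (map -%R w) = Some [ffun c => mullineux1 (ss c) (la c)].
Proof.
move=> p; have [nu [p' hc]] := componentwise_path p; rewrite p'; congr Some.
apply/ffunP => c; rewrite ffunE; have [wc [q1 q2]] := hc c.
rewrite /mullineux1 /mullineux.
have -> : tilde_class (one (ss c)) = one (- ss c) by apply/ffunP => d; rewrite !ffunE.
rewrite (transportE (b := true) (kleshchev_rule _) (kleshchev_rule _) e1
  (level_one_weight (ss c)) q1 q2).
by rewrite ffunE.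
Qed.

End ComponentwiseMullineux.

Section Agreement.
Variables (e l n : nat) (v : {ffun 'I_l -> int}).
Hypothesis gap : forall b c : 'I_l, c = b.+1 :> nat -> n%:Z - 1 < v c - v b.

Lemma gap_lt (b c : 'I_l) : (b < c)%N -> n%:Z - 1 < v c - v b.
Proof.
case: c => c cl; elim: c cl => // c IH cl; rewrite ltnS leq_eqVlt => /orP [/eqP bc|bc].
  by apply: gap => /=; rewrite bc.
have cl' : (c < l)%N by apply: ltnW.
have := IH cl' bc; have := gap (_ : Ordinal cl = (Ordinal cl').+1 :> nat); move=> /(_ erefl); lia.
Qed.

(** A diagonal of a component with nonzero weight is bounded by the size of the
component.  Two components together have fewer than n nodes, so the gap
between their charges separates the contents of these diagonals. *)
Lemma uglov_kleshchev_f (i : 'Z_e) la : (rank la < n)%N ->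
  crystal_f (uglov e v) i la = crystal_f (kleshchev (class_mod e v)) i la.
Proof.
move=> rn; rewrite (crystal_fock (uglov_rule e v)) (crystal_fock (kleshchev_rule _)) /fock_f.
congr omap; rewrite /good free_adds_filter [X in _ = ohead (rev X)]free_adds_filter.
congr (ohead (rev (free_adds _ _))).
have so1 := fr_order (uglov_rule e v); have so2 := fr_order (kleshchev_rule (class_mod e v)).
have [ss1 r1 c1] := positions_complete v so1 (node_count la) i.
have [ss2 r2 c2] := positions_complete (lift_charge (class_mod e v)) so2 (node_count la) i.
have re k : fres (lift_charge (class_mod e v)) e k = fres v e k.
  by rewrite /fres !rmorphD /= /lift_charge; congr (_ + _); rewrite [LHS]Zp_intr_val ffunE.
apply: (shift_sorted_eq so2).
- have : sorted (uglov_lt v) [seq k <- fsig v (uglov_lt v) i la | fweight la k != 0].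
    exact: sorted_filter (so_trans so1) _ _ ss1.
  apply: (@sub_in_sorted _ (fun k => fweight la k != 0)); last exact: filter_all.
  move=> [c d] [c' d'] wk wq; rewrite /uglov_lt /kleshchev_lt /=.
  have [ec|nc] := eqVneq c c'; first by subst c'; rewrite ltnn /=; lia.
  case/orP: (ord_neq_lt nc) => cc; first by rewrite cc.
  have b1 : (`|d| <= sumn (val (la c)))%N by apply: dweight_bound wk.
  have b2 : (`|d'| <= sumn (val (la c')))%N by apply: dweight_bound wq.
  have b3 : (sumn (val (la c)) + sumn (val (la c')) <= rank la)%N.
    rewrite /rank (bigD1 c) //= leq_add2l (bigD1 c') /=; first exact: leq_addr.
    by rewrite eq_sym.
  have g := gap_lt cc; lia.
- exact: sorted_filter (so_trans so2) _ _ ss2.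
move=> k; rewrite !mem_filter; case: (boolP (fweight la k != 0)) => //= w.
have kb := fweight_bound w.
by apply/idP/idP => [/r1 h|/r2 h]; [apply: c2; rewrite ?re | apply: c1; rewrite -?re].
Qed.

Lemma uglov_kleshchev_path w : (size w <= n)%N ->
  path_end (uglov e v) w = path_end (kleshchev (class_mod e v)) w.
Proof.
elim/last_ind: w => [//|w i IH]; rewrite size_rcons => sn.
rewrite !path_rcons IH; last exact: ltnW.
case p: (path_end _ w) => [la|] //=; apply: uglov_kleshchev_f.
by rewrite (path_rank (kleshchev_rule _) p).
Qed.

Lemma uglov_kleshchev_Phi la : (1 < e)%N ->
  Phi (uglov e v) n la <-> Phi (kleshchev (class_mod e v)) n la.
Proof.
move=> e1; rewrite (Phi_path (uglov_rule e v) e1) (Phi_path (kleshchev_rule _) e1).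
by split=> -[w sw p]; exists w => //; move: p; rewrite uglov_kleshchev_path // sw.
Qed.

End Agreement.

(** * The action on multicharges *)

Section Action.
Variables (e l : nat).
Implicit Types (v u : {ffun 'I_l -> int}) (j c d p q m : nat).

(** Entries are indexed by natural numbers, to allow computing with indices; the
value 0 outside the range is never used. *)
Definition entry v j : int := if insub j is Some i then v i else 0.

Lemma entry_ord v (c : 'I_l) : entry v c = v c.
Proof. by rewrite /entry valK. Qed.

Lemma entry_insubd v (j0 : 'I_l) j : (j < l)%N -> v (insubd j0 j) = entry v j.
Proof. by move=> jl; rewrite /insubd /entry insubT. Qed.

Lemma entry_ffun (F : 'I_l -> int) j (jl : (j < l)%N) : entry [ffun i => F i] j = F (Ordinal jl).
Proof. by rewrite /entry insubT ffunE. Qed.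

Lemma entry_sigma c v j : (0 < c < l)%N -> (j < l)%N ->
  entry (sigma c v) j = if j == c.-1 then entry v c
                        else if j == c then entry v c.-1 else entry v j.
Proof.
move=> cl jl; rewrite /sigma entry_ffun /=.
rewrite !entry_insubd; [ | lia | lia].
by rewrite -[v (Ordinal jl)]entry_ord.
Qed.

Lemma entry_tau v j : (j < l)%N ->
  entry (tau e v) j = if j.+1 == l then entry v 0 + e%:Z else entry v j.+1.
Proof.
move=> jl; rewrite /tau entry_ffun /=; case: eqP => h; rewrite entry_insubd //; lia.
Qed.

(** The entry at d - 1 moves to the end of the range of indices, and the entries
passed on the way move one place to the left. *)
Lemma entry_w v d m j : (0 < d)%N -> (d + m <= l)%N -> (j < l)%N ->
  entry (foldr (fun k => @sigma l k) v (rev (iota d m))) j =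
  if (d.-1 <= j < d.-1 + m)%N then entry v j.+1
  else if j == (d.-1 + m)%N then entry v d.-1 else entry v j.
Proof.
move=> d0; elim: m j => [|m IH] j dm jl.
  by rewrite addn0 /=; do ! (case: ifP => ?); congr entry; lia.
rewrite -(addn1 m) iotaD rev_cat /= entry_sigma //; last by lia.
rewrite !IH; try lia.
by do ! (case: ifP => ?); congr entry; lia.
Qed.

Lemma entry_w_act c d v j : (0 < d <= c.+1)%N -> (c < l)%N -> (j < l)%N ->
  entry (w_act c d v) j =
  if (d.-1 <= j < c)%N then entry v j.+1 else if j == c then entry v d.-1 else entry v j.
Proof.
move=> db cl jl; rewrite /w_act entry_w //; try lia.
have -> : (d.-1 + (c.+1 - d))%N = c by lia.
by [].
Qed.

(** Successive moves bring the first p entries, last one first, to the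
end: a rotation by p. *)
Lemma entry_gamma p v j : (0 < p < l)%N -> (j < l)%N ->
  entry (gamma_act p v) j = if (j < l - p)%N then entry v (j + p) else entry v (j - (l - p)).
Proof.
move=> pl; have gen m q i : (q + m)%N = p -> (i < l)%N ->
  entry (foldr (fun k => @w_act l (l - p + k).-1%N k) v (iota q.+1 m)) i =
  if (i < q)%N then entry v i else if (i < q + (l - p))%N then entry v (i + (p - q))
  else entry v (i - (l - p)).
  elim: m q i => [|m IH] q i qm il.
    rewrite /=; case: ifP => // c1; case: ifP => c2; congr entry; lia.
  rewrite /= entry_w_act; try lia.
  by case: ifP => h1; [|case: ifP => h2]; (rewrite IH; try lia);
    do ! (case: ifP => ?); congr entry; lia.
by move=> jl; rewrite /gamma_act (gen p 0%N) //=; do ! (case: ifP => ?); congr entry; lia.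
Qed.

Lemma entry_tau_iter t v j : (t <= l)%N -> (j < l)%N ->
  entry (iter t (@tau e l) v) j =
  if (j + t < l)%N then entry v (j + t) else entry v (j + t - l) + e%:Z.
Proof.
elim: t j => [|t IH] j tl jl; first by rewrite addn0 jl.
rewrite iterS entry_tau //; case: ifP => h; (rewrite IH; try lia);
  do ! (case: ifP => ?); try lia;
  by [congr entry; lia | congr (entry _ _ + _); lia].
Qed.

Lemma entry_alpha p v j : (0 < p < l)%N -> (j < l)%N ->
  entry (alpha_act e p v) j = entry v j + (if (p <= j)%N then e%:Z else 0).
Proof.
move=> pl jl; rewrite /alpha_act entry_tau_iter //; last by lia.
case: (leqP p j) => c; case: ifP => h; try lia; rewrite entry_gamma //; try lia.
  by case: ifP => ?; [congr (entry _ _ + _); lia | lia].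
by rewrite addr0; case: ifP => ?; [lia | congr entry; lia].
Qed.

Lemma entry_alpha_iter m p v j : (0 < p < l)%N -> (j < l)%N ->
  entry (iter m (@alpha_act e l p) v) j = entry v j + (if (p <= j)%N then (m * e)%N%:Z else 0).
Proof.
move=> pl jl; elim: m => [|m IH]; first by case: ifP; rewrite addr0.
by rewrite iterS entry_alpha // IH; case: ifP => _; lia.
Qed.

(** Successive moves of the current first entry to the end of a shrinking range
reverse the charge. *)
Lemma entry_w0 v j : (j < l)%N -> entry (w0_act v) j = entry v (l.-1 - j).
Proof.
move=> jl; have gen m q i : (q + m)%N = l.-1 -> (i < l)%N ->
  entry (foldr (fun k => @w_act l k 1) v (iota q.+1 m)) i =
  if (i <= q)%N then entry v (i + m) else entry v (l.-1 - i).
  elim: m q i => [|m IH] q i qm il.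
    by rewrite /= addn0; case: ifP => // ?; congr entry; lia.
  rewrite /= entry_w_act; try lia.
  by case: ifP => h1; [|case: ifP => h2]; (rewrite IH; try lia);
    do ! (case: ifP => ?); congr entry; lia.
rewrite /w0_act (gen l.-1 0%N) //; case: ifP => // h; congr entry; lia.
Qed.

Lemma entry_eta (p : nat -> nat) v j : (j < l)%N ->
  entry (eta_act e p v) j = entry v (l.-1 - j) +
    \sum_(k <- iota 1 l.-1) (if (k <= j)%N then (2 * (p (l - k)%N).+1 * e)%N%:Z else 0).
Proof.
move=> jl; rewrite /eta_act -entry_w0 //.
have : {in iota 1 l.-1, forall k, 0 < k < l}%N by move=> k; rewrite mem_iota; lia.
elim: (iota 1 l.-1) => [|k ks IH] h; first by rewrite big_nil addr0.
rewrite big_cons -[foldr _ _ (k :: ks)]/(iter (2 * (p (l - k)%N).+1)%N (@alpha_act e l k) (foldr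
  _ _ ks)).
rewrite entry_alpha_iter //; last by apply: h; rewrite mem_head.
rewrite IH; first by rewrite -addrA [X in _ + X]addrC.
by move=> i iks; apply: h; rewrite inE iks orbT.
Qed.

End Action.

(** * The charges of the theorem, and its proof *)

Section Charges.
Variables (e l n : nat) (s : {ffun 'I_l -> int}) (p : nat -> nat).
Hypothesis ms : is_min_shift e n s p.

Lemma neg_charge_step (b c : 'I_l) : c = b.+1 :> nat ->
  neg_charge e p s c - neg_charge e p s b = s b - s c + (p c * e)%N%:Z.
Proof.
move=> h; rewrite !ffunE h big_nat_recr //=.
by move: (\sum_(1 <= i < _) _) (Posz _) => S P; lia.
Qed.

Lemma neg_charge_gap (b c : 'I_l) : c = b.+1 :> nat ->
  n%:Z - 1 < neg_charge e p s c - neg_charge e p s b.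
Proof. by move=> h; rewrite neg_charge_step //; case: (ms h). Qed.

Hypothesis e1 : (1 < e)%N.

Lemma neg_charge_class : class_mod e (neg_charge e p s) = neg_class (class_mod e s).
Proof.
apply/ffunP => c; rewrite !ffunE -rmorphN /=; apply/(Zp_intr_eq _ _ e1).
exists (\sum_(1 <= i < c.+1) (p i)%:Z); congr (_ + _); rewrite mulr_suml.
by apply: eq_bigr => i _; rewrite PoszM.
Qed.

Hypothesis sb : forall c : 'I_l, 0 <= s c < e%:Z.

Let tilde := eta_act e p (neg_charge e p s).

Lemma tilde_charge (c : 'I_l) : tilde c = neg_charge e p s (rev_ord c) +
  \sum_(k <- iota 1 l.-1) (if (k <= c)%N then (2 * (p (l - k)%N).+1 * e)%N%:Z else 0).
Proof.
rewrite -entry_ord /tilde entry_eta //; congr (_ + _).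
by rewrite -entry_ord; congr entry => /=; have := ltn_ord c; lia.
Qed.

(** Reversal turns the gap g = s_b - s_c + p_c e of the charge -s into -g, and the
action of the alpha_k adds 2 (p_c + 1) e.  The result equals g + 2 (e - (s_b - s_c)),
which exceeds g because the s_c lie in an interval of length e. *)
Lemma tilde_charge_gap (b c : 'I_l) : c = b.+1 :> nat -> n%:Z - 1 < tilde c - tilde b.
Proof.
move=> h; rewrite !tilde_charge.
have cl := ltn_ord c; have rbc : rev_ord b = (rev_ord c).+1 :> nat by rewrite /= h; lia.
have -> : \sum_(k <- iota 1 l.-1) (if (k <= c)%N then (2 * (p (l - k)%N).+1 * e)%N%:Z else 0) =
    \sum_(k <- iota 1 l.-1) (if (k <= b)%N then (2 * (p (l - k)%N).+1 * e)%N%:Z else 0) +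
    (2 * (p (l - c)%N).+1 * e)%N%:Z.
  rewrite -[X in _ = _ + X](_ : \sum_(k <- iota 1 l.-1)
     (if k == c :> nat then (2 * (p (l - k)%N).+1 * e)%N%:Z else 0) = _).
    rewrite -big_split /=; apply: eq_bigr => k _; rewrite h leq_eqVlt ltnS.
    by case: eqP => [->|_] /=; rewrite ?ltnn ?add0r ?addr0.
  rewrite -big_mkcond (big_rem (c : nat)) ?mem_iota /=; last by rewrite h in cl *; lia.
  rewrite eqxx big_seq_cond big_pred0 ?addr0 // => k.
  by rewrite mem_rem_uniq ?iota_uniq // inE andbC; case: eqP.
have stp := neg_charge_step rbc; have [g _] := ms rbc.
have sc := sb (rev_ord c); have sd := sb (rev_ord b).
have -> : (l - c)%N = rev_ord b by rewrite /= h.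
move: g stp; move: (p (rev_ord b)) => P; lia.
Qed.

Lemma tilde_charge_class : class_mod e tilde = tilde_class (class_mod e s).
Proof.
apply/ffunP => c; rewrite !ffunE tilde_charge rmorphD /=.
have := congr1 (fun F : {ffun 'I_l -> 'Z_e} => F (rev_ord c)) neg_charge_class.
rewrite !ffunE => ->; rewrite -[RHS]addr0; congr (_ + _).
apply/(Zp_intr_eq0 _ e1).
exists (\sum_(k <- iota 1 l.-1) (if (k <= c)%N then (2 * (p (l - k)%N).+1)%N%:Z else 0)).
by rewrite mulr_suml; apply: eq_bigr => k _; case: ifP => _; rewrite ?mul0r // -PoszM.
Qed.

End Charges.

(** The highest weight does not depend on the order of the components. *)
Lemma reversed_weight e l (g : 'I_l -> int) (g' : 'I_l -> int) b :
  (forall c, (g' c)%:~R = twist b (g (rev_ord c))%:~R :> 'Z_e) ->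
  forall i : 'Z_e, (\sum_c ((g c)%:~R == i))%N = (\sum_c ((g' c)%:~R == twist b i))%N.
Proof.
move=> h i; rewrite (reindex_inj rev_ord_inj); apply: eq_bigr => c _; rewrite h.
by congr nat_of_bool; case: b {h} => //=; rewrite eqr_opp.
Qed.

Theorem mainTheorem1 (e l n : nat) (s : {ffun 'I_l -> int}) (p : nat -> nat)
    (la : lpart l) :
  (1 < e)%N -> (0 < l)%N -> (0 < n)%N ->
  (forall c : 'I_l, 0 <= s c < e%:Z) ->
  is_min_shift e n s p ->
  let ss : {ffun 'I_l -> 'Z_e} := class_mod e s in
  let minus_s : {ffun 'I_l -> int} := neg_charge e p s in
  let tilde_s : {ffun 'I_l -> int} := eta_act e p minus_s in
  Phi (kleshchev ss) n la ->
  let nu : lpart l := [ffun c => mullineux1 (ss c) (la c)] in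
  let hat_nu : lpart l := Psi e minus_s tilde_s nu in
  [/\ Phi (kleshchev (neg_class ss)) n nu,
      forall mu : lpart l,
        Phi (kleshchev (neg_class ss)) n mu <-> Phi (uglov e minus_s) n mu,
      Phi (uglov e tilde_s) n hat_nu,
      forall mu : lpart l,
        Phi (uglov e tilde_s) n mu <-> Phi (kleshchev (tilde_class ss)) n mu
    & mullineux ss la = hat_nu].
Proof.
move=> e1 _ _ sb ms ss minus_s tilde_s la_in nu hat_nu.
have minus_gap := neg_charge_gap ms; have tilde_gap := tilde_charge_gap ms e1 sb.
have minus_class : class_mod e minus_s = neg_class ss := neg_charge_class s p e1.
have tilde_class' : class_mod e tilde_s = tilde_class ss := tilde_charge_class s p e1.
have [w sw pw] := (Phi_path (kleshchev_rule ss) e1 n la).1 la_in.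
have sw' : size (map -%R w) = n by rewrite size_map.
have p_nu := componentwise_mullineux e1 pw; rewrite -/nu in p_nu.
have p_nu' : path_end (uglov e minus_s) (map -%R w) = Some nu.
  by rewrite (uglov_kleshchev_path minus_gap) ?sw' // minus_class.
have weights := @reversed_weight e l minus_s tilde_s false.
have same : forall i : 'Z_e, (\sum_c ((minus_s c)%:~R == i))%N =
    (\sum_c ((tilde_s c)%:~R == twist false i))%N.
  apply: weights => c /=.
  have := congr1 (fun F : {ffun 'I_l -> 'Z_e} => F c) tilde_class'.
  have := congr1 (fun F : {ffun 'I_l -> 'Z_e} => F (rev_ord c)) minus_class.
  by rewrite !ffunE => -> ->.
have [hat p_hat] := path_transfer (uglov_rule e minus_s) (uglov_rule e tilde_s) e1 same p_nu'.
have hatE : hat_nu = hat.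
  exact: (transportE (uglov_rule e minus_s) (uglov_rule e tilde_s) e1 same p_nu' p_hat).
have p_hat' : path_end (kleshchev (tilde_class ss)) (map -%R w) = Some hat.
  by rewrite -tilde_class' -(uglov_kleshchev_path tilde_gap) ?sw' // -p_hat map_id.
split.
- by apply/(Phi_path (kleshchev_rule _) e1); exists (map -%R w).
- by move=> mu; rewrite (uglov_kleshchev_Phi minus_gap mu e1) minus_class.
- rewrite hatE; apply/(Phi_path (uglov_rule _ _) e1); exists (map -%R w) => //.
  by rewrite -p_hat map_id.
- by move=> mu; rewrite (uglov_kleshchev_Phi tilde_gap mu e1) tilde_class'.
rewrite hatE; apply: (transportE (b := true) (kleshchev_rule _) (kleshchev_rule _) e1 _ pw
  p_hat').
apply: reversed_weight => c /=.
by rewrite /lift_charge !Zp_intr_val ffunE.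
Qed.
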